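(* For any Riemannian metric $g$ on the two-torus $\mathbb{T}^2$, there exist a unit vector field $\sigma$ on $(\mathbb{T}^2,g)$ and a Kaluza-Klein metric $G$ on $T\mathbb{T}^2$ with $A\equiv 1$ such that $\sigma:(\mathbb{T}^2,g)\to(T\mathbb{T}^2,G)$ is a harmonic section. Moreover, $\sigma$ is a harmonic map if and only if the Gaussian curvature of $(\mathbb{T}^2,g)$ vanishes.
   Context: Let $(M,g)$ be a Riemannian manifold with Levi-Civita connection $\nabla$. At $(p,e)\in TM$ the space $T_{(p,e)}TM$ splits into the vertical space (kernel of $d\pi$, $\pi:TM\to M$ the projection) and the horizontal space defined by $\nabla$; each $X\in T_pM$ has a horizontal lift $X^h$ and a vertical lift $X^v$. A Kaluza-Klein metric on $TM$ is a Riemannian metric $G$ such that at $(p,e)$ $$G(X^h,Y^h)=A(|e|^2)g(X,Y),\quad G(X^h,Y^v)=0,\quad G(X^v,Y^v)=B(|e|^2)g(X,Y)+C(|e|^2)g(X,e)g(Y,e),$$ where $A,B,C$ are real $C^2$ functions on $[0,\infty)$, $A>0$, and $B,C$ are such that $G$ is positive definite. A vector field $\sigma$ on $M$ is viewed as a map $\sigma:(M,g)\to(TM,G)$. Its tension field $\tau(\sigma)=\operatorname{trace}\nabla d\sigma$ (computed with the Levi-Civita connections of $g$ and $G$) is decomposed as $\tau(\sigma)=[\tau^h(\sigma)]^h+[\tau^v(\sigma)]^v$ with $\tau^h(\sigma),\tau^v(\sigma)$ vector fields on $M$. $\sigma$ is a harmonic map if $\tau(\sigma)=0$, and a harmonic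 section if $\tau^v(\sigma)=0$ (equivalently, it is critical for the energy with respect to variations through vector fields). *)

(* Defs.v *)
(* The torus is R^2/Z^2 and its objects are lifted to R^2: functions, metrics
   and vector fields on T^2 are exactly the Z^2-periodic ones on R^2.  As T^2 is
   parallelized by the coordinate fields, T(T^2) is (R^2/Z^2) x R^2, a point
   (p, e) being row_mx p e : 'rV_(2 + 2).  All tensors are given by their
   components in these global coordinates, with tangent vectors as rows. *)
From HB Require Import structures.
From mathcomp Require Import all_boot all_order all_algebra.
From mathcomp Require Import all_classical all_reals all_analysis.
Set Implicit Arguments.
Unset Strict Implicit.
Unset Printing Implicit Defensive.
Import Order.TTheory GRing.Theory Num.Theory.
Import numFieldNormedType.Exports.
Local Open Scope classical_set_scope.
Local Open Scope ring_scope.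

Definition pd (R : realType) n (f : 'rV[R]_n -> R) (i : 'I_n) (x : 'rV[R]_n) : R :=
  'D_('e_i) f x.

Fixpoint Ck (R : realType) n (k : nat) (f : 'rV[R]_n -> R) : Prop :=
  continuous f /\
  if k is k'.+1
  then forall i, (forall x, derivable f x 'e_i) /\ Ck k' (pd f i)
  else True.

Definition smooth (R : realType) n (f : 'rV[R]_n -> R) : Prop :=
  forall k, Ck k f.

(* f' is the derivative of f on [0, +oo), one-sided at 0; the values of f on
   the negative reals are irrelevant. *)
Definition halfline_deriv (R : realType) (f f' : R -> R) : Prop :=
  forall t, 0 <= t ->
    h^-1 * (f (t + h) - f t) @[h --> within [set h | 0 <= t + h] 0^'] --> f' t.

Definition C2_halfline (R : realType) (f : R -> R) : Prop :=
  exists f1 f2 : R -> R,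
    [/\ halfline_deriv f f1, halfline_deriv f1 f2
      & {within [set t | 0 <= t], continuous f2}].

Section RiemannianGeometry.
Context {R : realType} {n : nat}.
Implicit Types (g : 'rV[R]_n -> 'M[R]_n) (x v w : 'rV[R]_n).

Definition inner g x v w : R := (v *m g x *m w^T) 0 0.

Definition is_metric g : Prop :=
  forall x, (g x)^T = g x /\ forall v, v != 0 -> 0 < inner g x v v.

(* Gamma^k_ij of the Levi-Civita connection *)
Definition christoffel g (k i j : 'I_n) x : R :=
  2^-1 * \sum_(l < n) invmx (g x) k l *
    (pd (fun y => g y j l) i x + pd (fun y => g y i l) j x
     - pd (fun y => g y i j) l x).

(* Gamma^k_ij v^i w^j *)
Definition christoffel_form g x v w : 'rV[R]_n :=
  \row_k \sum_(i < n) \sum_(j < n) christoffel g k i j x * v 0 i * w 0 j.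

(* R(d_i, d_j) d_k = nabla_i nabla_j d_k - nabla_j nabla_i d_k *)
Definition riemann g (i j k : 'I_n) x : 'rV[R]_n :=
  \row_l (pd (christoffel g l j k) i x - pd (christoffel g l i k) j x
    + \sum_(m < n) (christoffel g m j k x * christoffel g l i m x
                    - christoffel g m i k x * christoffel g l j m x)).

End RiemannianGeometry.

Definition gauss_curvature (R : realType) (g : 'rV[R]_2 -> 'M[R]_2) (x : 'rV[R]_2) : R :=
  inner g x (riemann g 0 1 1 x) 'e_0 / \det (g x).

Section Tension.
Context {R : realType} {m n : nat}.
Variables (g : 'rV[R]_m -> 'M[R]_m) (h : 'rV[R]_n -> 'M[R]_n).
Variable phi : 'rV[R]_m -> 'rV[R]_n.
Let comp (c : 'I_n) (x : 'rV[R]_m) : R := phi x 0 c.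

(* (nabla d phi)(d_i, d_j), with nabla the connection induced on
   T^*M (x) phi^* TN by the Levi-Civita connections of g and h *)
Definition nabla_d (i j : 'I_m) (x : 'rV[R]_m) : 'rV[R]_n :=
  \row_c (pd (pd (comp c) j) i x
    - \sum_(k < m) christoffel g k i j x * pd (comp c) k x
    + \sum_(a < n) \sum_(b < n)
        christoffel h c a b (phi x) * pd (comp a) i x * pd (comp b) j x).

Definition tension (x : 'rV[R]_m) : 'rV[R]_n :=
  \sum_(i < m) \sum_(j < m) invmx (g x) i j *: nabla_d i j x.

End Tension.

Section Torus.
Context {R : realType}.
Implicit Types (g : 'rV[R]_2 -> 'M[R]_2) (G : 'rV[R]_(2 + 2) -> 'M[R]_(2 + 2)).
Implicit Types (sigma : 'rV[R]_2 -> 'rV[R]_2) (x e X Y : 'rV[R]_2).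

Definition T2_periodic {T : Type} (f : 'rV[R]_2 -> T) : Prop :=
  forall i x, f (x + 'e_i) = f x.

Definition TT2_periodic {T : Type} (f : 'rV[R]_(2 + 2) -> T) : Prop :=
  forall (i : 'I_2) u, f (u + 'e_(lshift 2 i)) = f u.

Definition T2_metric g : Prop :=
  [/\ T2_periodic g, forall i j, smooth (fun x => g x i j) & is_metric g].

(* Only C^2, since A, B and C below are only C^2. *)
Definition TT2_metric G : Prop :=
  [/\ TT2_periodic G, forall i j, Ck 2 (fun u => G u i j) & is_metric G].

Definition T2_vector_field sigma : Prop :=
  T2_periodic sigma /\ forall i, smooth (fun x => sigma x 0 i).

Definition unit_vector_field g sigma : Prop :=
  T2_vector_field sigma /\ forall x, inner g x (sigma x) (sigma x) = 1.

(* Lifts of X to the point (x, e), whose base point is x. *)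
Definition hlift g x e X : 'rV[R]_(2 + 2) := row_mx X (- christoffel_form g x X e).
Definition vlift X : 'rV[R]_(2 + 2) := row_mx 0 X.

Definition hpart (w : 'rV[R]_(2 + 2)) : 'rV[R]_2 := lsubmx w.
Definition vpart g x e (w : 'rV[R]_(2 + 2)) : 'rV[R]_2 :=
  rsubmx w + christoffel_form g x (lsubmx w) e.

Lemma hvpartP g x e (w : 'rV[R]_(2 + 2)) X Y :
  w = hlift g x e X + vlift Y <-> X = hpart w /\ Y = vpart g x e w.
Proof.
rewrite /hlift /vlift /hpart /vpart add_row_mx addr0; split.
  by move=> ->; rewrite row_mxKl row_mxKr addrC addNKr.
by move=> [-> ->]; rewrite [_ + _ in X in row_mx _ X]addrC addrK hsubmxK.
Qed.

Definition kaluza_klein g (A B C : R -> R) G : Prop :=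
  [/\ [/\ C2_halfline A, C2_halfline B & C2_halfline C],
      forall t, 0 <= t -> 0 < A t,
      TT2_metric G
    & forall x e X Y,
        let u := row_mx x e in
        let r := inner g x e e in
        [/\ inner G u (hlift g x e X) (hlift g x e Y) = A r * inner g x X Y,
            inner G u (hlift g x e X) (vlift Y) = 0
          & inner G u (vlift X) (vlift Y) =
              B r * inner g x X Y + C r * inner g x X e * inner g x Y e]].

Definition section sigma x : 'rV[R]_(2 + 2) := row_mx x (sigma x).

Definition tau g G sigma x : 'rV[R]_(2 + 2) := tension g G (section sigma) x.
Definition tau_v g G sigma x : 'rV[R]_2 := vpart g x (sigma x) (tau g G sigma x).

Definition harmonic_section g G sigma : Prop := forall x, tau_v g G sigma x = 0.
Definition harmonic_map g G sigma : Prop := forall x, tau g G sigma x = 0.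

End Torus.

(* Main.v *)
(** A unit field is [sigma = cos theta E1 + sin theta E2] in a global orthonormal
    frame, with [nabla sigma = eta (x) nu], where [nu] is [sigma] turned by a right
    angle and [eta = d theta + omega] for the connection form [omega] of the frame.
    For [A = 1], [C = 0],
      [tau^v = (div eta) nu - (1 + B'(1) / B(1)) |eta|^2 sigma],
    so it suffices to take [B(t) = (1 + t)^-2], for which [B'(1) = - B(1)], and [theta]
    with [div (d theta + omega) = 0], an elliptic equation on the torus.
    This equation is solved by finite differences: on the grids [(Z/N)^2] the equation
    is finite-dimensional, and difference quotients of a solution solve an equation of
    the same kind, so that the energy estimate bounds all of them uniformly in N;
    a limit along an ultrafilter is then a smooth solution.
    Finally [tau^h] is [B(1) kappa] times the quarter turn of [eta], up to sign and
    normalization, where [d eta = kappa dx dy] is the curvature form.  If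
    [kappa eta = 0], then [eta] vanishes near every point where [kappa] does not, hence
    so does [d eta]: thus [kappa = 0]. *)
Require Import Defs.
From HB Require Import structures.
From mathcomp Require Import all_boot all_order all_algebra.
From mathcomp Require Import all_classical all_reals all_analysis.
From mathcomp Require Import ring lra.
Set Implicit Arguments.
Unset Strict Implicit.
Unset Printing Implicit Defensive.
Import Order.TTheory GRing.Theory Num.Theory.
Import numFieldNormedType.Exports.
Local Open Scope classical_set_scope.
Local Open Scope ring_scope.

(** * Differential calculus in coordinates *)

(** The equation for [theta] is solvable without a compatibility condition because its right-hand
    side is again a divergence: on each grid its average vanishes, which is exactly the condition
    for lying in the range of the discrete operator. Differences commute with the translations of
    the periodic grid, so the energy estimate applies to differences of any order without cut-offs;
    in dimension two, two further differences in mean square give a uniform bound. On the tangent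
    bundle the obstacle is the 4 by 4 metric, whose inverse enters the Christoffel symbols. It is
    avoided by pairing the tension with test vectors, which turns the symbols into derivatives of
    the metric. Vertical test vectors detect tau^v; once that vanishes, the coordinate vectors of
    the base leave only the curvature term. The weight only has to be positive and C^2 on the
    half-line with logarithmic derivative -1 at 1. For (1 + t)^-m this derivative is -m/2, whence m
    = 2; the simpler 1/t would blow up on the zero section. *)

Section DirectionalDerivative.
Context {R : realType} {n : nat}.
Implicit Types (f g : 'rV[R]_n -> R) (x v : 'rV[R]_n) (phi : R -> R).

(** Both difference quotients are the same function of the increment. The one-variable chain rule
    and mean value theorem thus become available for partial derivatives. *)
Lemma is_derive_line f x v (t df : R) :
  is_derive (x + t *: v) v f df <->
  is_derive t 1 (fun s => f (x + s *: v)) df.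
Proof.
have E : (fun h : R => h^-1 *: ((f \o shift (x + t *: v)) (h *: v) - f (x + t *: v)))
  = (fun h : R => h^-1 *: (((fun s => f (x + s *: v)) \o shift t) (h *: 1) - f (x + t *: v))).
  apply/funext => h /=; congr (_ *: (f _ - _)).
  by rewrite [h *: 1]mulr1 scalerDl addrCA.
by split=> -[D1 D2]; split; move: D1 D2; rewrite /derivable /derive E.
Qed.

Lemma is_derive_line0 f x v (df : R) :
  is_derive x v f df <-> is_derive (0 : R) 1 (fun s => f (x + s *: v)) df.
Proof. by rewrite -is_derive_line scale0r addr0. Qed.

Lemma is_deriveDl f g x v (a b : R) : is_derive x v f a -> is_derive x v g b ->
  is_derive x v (fun y => f y + g y) (a + b).
Proof. by move=> ? ?; exact: is_deriveD. Qed.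

Lemma is_deriveMl f g x v (a b : R) : is_derive x v f a -> is_derive x v g b ->
  is_derive x v (fun y => f y * g y) (a * g x + f x * b).
Proof.
move=> fa gb; have := is_deriveM fa gb.
by rewrite /GRing.scale /= addrC [g x * a]mulrC.
Qed.

Lemma is_derive_comp_real phi f x v (a b : R) : is_derive (f x) 1 phi b ->
  is_derive x v f a -> is_derive x v (fun y => phi (f y)) (b * a).
Proof.
move=> pb fa; apply/is_derive_line0.
move/is_derive_line0 : fa => fa.
have pb' : is_derive (f (x + 0 *: v)) 1 phi b by rewrite scale0r addr0.
have := @is_derive1_comp _ phi (fun s => f (x + s *: v)) 0 b a pb' fa.
by [].
Qed.

Lemma pdP f i x : derivable f x 'e_i -> is_derive x 'e_i f (pd f i x).
Proof. by move=> /derivableP. Qed.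

Lemma pd_val f i x (a : R) : is_derive x 'e_i f a -> pd f i x = a.
Proof. by move=> []. Qed.

Lemma mean_value_pd f i x (h : R) : (forall y, derivable f y 'e_i) -> 0 < h ->
  exists2 c, 0 < c < h & f (x + h *: 'e_i) - f x = h * pd f i (x + c *: 'e_i).
Proof.
move=> df h0.
have D (t : R) : is_derive t 1 (fun s => f (x + s *: 'e_i)) (pd f i (x + t *: 'e_i)).
  by apply/is_derive_line; apply: pdP.
have [c] := @MVT R _ _ 0 h h0 (fun t _ => D t) (derivable_within_continuous
  (fun t _ => (@ex_derive _ _ _ _ _ _ _ (D t)))).
rewrite in_itv /= => ch; rewrite scale0r addr0 subr0 => E.
by exists c; rewrite // E mulrC.
Qed.

End DirectionalDerivative.

Section CkTheory.
Context {R : realType} {n : nat}.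
Implicit Types (f g : 'rV[R]_n -> R) (x v : 'rV[R]_n).

Lemma Ck_continuous k f : Ck k f -> continuous f.
Proof. by case: k => [|k] []. Qed.

Arguments Ck_continuous {k f} _ x.

Lemma Ck_derivable k f i x : Ck k.+1 f -> derivable f x 'e_i.
Proof. by case=> _ /(_ i) [/(_ x)]. Qed.

Lemma Ck_pd k f i : Ck k.+1 f -> Ck k (pd f i).
Proof. by case=> _ /(_ i) []. Qed.

Lemma Ck_is_derive k f i x : Ck k.+1 f -> is_derive x 'e_i f (pd f i x).
Proof. by move=> fk; apply: pdP; apply: Ck_derivable fk. Qed.

Lemma CkW k f : Ck k.+1 f -> Ck k f.
Proof.
elim: k f => [|k IH] f [fc fd]; split=> // i.
by have [d1 d2] := fd i; split => //; apply: IH.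
Qed.

Lemma Ck_intro k f (df : 'I_n -> 'rV[R]_n -> R) : continuous f ->
  (forall i x, is_derive x 'e_i f (df i x)) -> (forall i, Ck k (df i)) -> Ck k.+1 f.
Proof.
move=> fc fd dfk; split => // i; split=> [x|]; first by have [] := fd i x.
by rewrite (_ : pd f i = df i)//; apply/funext => x; apply: pd_val.
Qed.

Lemma Ck_cst k (c : R) : Ck k (fun _ : 'rV[R]_n => c).
Proof.
elim: k c => [|k IH] c; first by split=> //; exact: cst_continuous.
apply: (@Ck_intro _ _ (fun _ _ => 0)) => [|i]; [exact: cst_continuous|exact: IH].
Qed.

Lemma CkD k f g : Ck k f -> Ck k g -> Ck k (fun x => f x + g x).
Proof.
elim: k f g => [|k IH] f g fk gk.
  by split => // x; exact: (continuousD (Ck_continuous fk x) (Ck_continuous gk x)).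
apply: (@Ck_intro _ _ (fun i x => pd f i x + pd g i x)).
- by move=> x; exact: (continuousD (Ck_continuous fk x) (Ck_continuous gk x)).
- by move=> i x; apply: is_deriveDl; apply: Ck_is_derive; eassumption.
- by move=> i; apply: IH; apply: Ck_pd.
Qed.

Lemma CkM k f g : Ck k f -> Ck k g -> Ck k (fun x => f x * g x).
Proof.
elim: k f g => [|k IH] f g fk gk.
  by split => // x; exact: (continuousM (Ck_continuous fk x) (Ck_continuous gk x)).
apply: (@Ck_intro _ _ (fun i x => pd f i x * g x + f x * pd g i x)).
- by move=> x; exact: (continuousM (Ck_continuous fk x) (Ck_continuous gk x)).
- by move=> i x; apply: is_deriveMl; apply: Ck_is_derive; eassumption.
- by move=> i; apply: CkD; apply: IH; (try exact: Ck_pd); exact: CkW.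
Qed.

Lemma CkZ k (c : R) f : Ck k f -> Ck k (fun x => c * f x).
Proof. by apply: CkM; exact: Ck_cst. Qed.

Lemma CkN k f : Ck k f -> Ck k (fun x => - f x).
Proof.
move=> /(CkZ (-1)); congr Ck; apply/funext => x; exact: mulN1r.
Qed.

Lemma CkB k f g : Ck k f -> Ck k g -> Ck k (fun x => f x - g x).
Proof. by move=> fk gk; apply: CkD => //; exact: CkN. Qed.

Lemma Ck_sum (I : Type) (r : seq I) (P : pred I) k (F : I -> 'rV[R]_n -> R) :
  (forall i, P i -> Ck k (F i)) -> Ck k (fun x => \sum_(i <- r | P i) F i x).
Proof.
move=> Fk; elim: r => [|i r IH].
  by under eq_fun do rewrite big_nil; exact: Ck_cst.
have [Pi|Pi] := boolP (P i); last first.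
  by congr Ck: IH; apply/funext => x; rewrite big_cons (negbTE Pi).
have := CkD (Fk i Pi) IH.
by congr Ck; apply/funext => x; rewrite big_cons Pi.
Qed.

Lemma Ck_comp_cont k f (phi : R -> R) : Ck k f ->
  (forall x, {for f x, continuous phi}) -> continuous (fun x => phi (f x)).
Proof.
move=> /Ck_continuous fc pc x.
by apply: (@continuous_comp _ _ _ f phi); [exact: fc|exact: pc].
Qed.

Lemma is_deriveV_real (f : R -> R) (x a : R) : f x != 0 -> is_derive x 1 f a ->
  is_derive x 1 (fun y => (f y)^-1) (- (f x) ^- 2 * a).
Proof.
move=> fx [df <-]; split; first exact: (derivableV fx df).
by have := deriveV fx df.
Qed.

Lemma CkV k f : (forall x, f x != 0) -> Ck k f -> Ck k (fun x => (f x)^-1).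
Proof.
move=> f0; elim: k => [|k IH] fk.
  by split => //; apply: (Ck_comp_cont fk) => x; apply: (inv_continuous (f0 x)).
apply: (@Ck_intro _ _ (fun i x => - ((f x)^-1 * (f x)^-1) * pd f i x)).
- by apply: (Ck_comp_cont fk) => x; apply: (inv_continuous (f0 x)).
- move=> i x.
  have D := @is_deriveV_real id (f x) 1 (f0 x) (is_derive_id _ _).
  have := @is_derive_comp_real _ _ GRing.inv f x 'e_i (pd f i x) _ D
     (Ck_is_derive i x fk).
  by rewrite mulr1 expr2 invfM.
- by move=> i; apply: CkM (Ck_pd i fk); apply: CkN; apply: CkM; apply: IH; apply: CkW.
Qed.

Lemma Ck_sqrt k f : (forall x, 0 < f x) -> Ck k f -> Ck k (fun x => Num.sqrt (f x)).
Proof.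
move=> f0; elim: k => [|k IH] fk.
  by split => //; apply: (Ck_comp_cont fk) => x; exact: sqrt_continuous.
apply: (@Ck_intro _ _ (fun i x => (2 * Num.sqrt (f x))^-1 * pd f i x)).
- by apply: (Ck_comp_cont fk) => x; exact: sqrt_continuous.
- move=> i x.
  have D := @is_derive1_sqrt _ (f x) (f0 x).
  by have := @is_derive_comp_real _ _ Num.sqrt f x 'e_i (pd f i x) _ D
     (Ck_is_derive i x fk).
- move=> i; apply: CkM (Ck_pd i fk); apply: CkV.
    by move=> x; rewrite mulf_neq0 // gt_eqF // sqrtr_gt0.
  by apply: CkZ; apply: IH; exact: CkW.
Qed.

(** The two claims are proved together because each function occurs in the derivative of the
    other. *)
Lemma Ck_sin_cos k f : Ck k f ->
  Ck k (fun x => sin (f x)) /\ Ck k (fun x => cos (f x)).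
Proof.
have sc g : Ck k g -> continuous (fun x => sin (g x)) /\ continuous (fun x => cos (g x)).
  by move=> gk; split; apply: (Ck_comp_cont gk) => x;
    [exact: continuous_sin | exact: continuous_cos].
elim: k f sc => [|k IH] f sc fk; first by have [] := sc _ fk.
have [sf cf] := sc _ fk; have [|sk ck] := IH f _ (CkW fk).
  by move=> g gk; split; apply: (Ck_comp_cont gk) => x;
    [exact: continuous_sin | exact: continuous_cos].
split.
  apply: (@Ck_intro _ _ (fun i x => cos (f x) * pd f i x)) => // [i x|i].
    exact: is_derive_comp_real (is_derive_sin _) (Ck_is_derive i x fk).
  by apply: CkM => //; exact: Ck_pd.
apply: (@Ck_intro _ _ (fun i x => - sin (f x) * pd f i x)) => // [i x|i].
  exact: is_derive_comp_real (is_derive_cos _) (Ck_is_derive i x fk).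
by apply: CkM; [exact: CkN|exact: Ck_pd].
Qed.

(** The mean value theorem is used twice: in direction [i] for the increment of [f] in direction
    [j], then in direction [j] for [pd f i]. *)
Lemma pd_second_difference f i j x (h : R) : Ck 2 f -> 0 < h ->
  exists c d, [/\ 0 < c < h, 0 < d < h &
  f (x + h *: 'e_i + h *: 'e_j) - f (x + h *: 'e_i) - f (x + h *: 'e_j) + f x
  = h * (h * pd (pd f i) j (x + c *: 'e_i + d *: 'e_j))].
Proof.
move=> fk h0.
pose F y := f (y + h *: 'e_j) - f y.
have DF y : is_derive y 'e_i F (pd f i (y + h *: 'e_j) - pd f i y).
  apply: is_deriveDl; last first.
    by apply: is_deriveN; apply: Ck_is_derive fk.
  apply/is_derive_line0.
  have /is_derive_line0 := Ck_is_derive i (y + h *: 'e_j) fk.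
  by congr is_derive; apply/funext => s; rewrite addrAC.
have [|c ch E] := @mean_value_pd _ _ F i x h _ h0.
  by move=> y; have [] := DF y.
have [|d dh E'] := @mean_value_pd _ _ (pd f i) j (x + c *: 'e_i) h _ h0.
  by move=> y; apply: Ck_derivable; exact: Ck_pd fk.
exists c, d; split => //.
rewrite (pd_val (DF _)) E' in E; rewrite -E /F; ring.
Qed.

(* The second difference of [f] over a small square is symmetric in [i] and [j]. *)
Lemma pd_comm f i j x : Ck 2 f -> pd (pd f i) j x = pd (pd f j) i x.
Proof.
move=> fk.
(* Two numbers at distance [e] cannot both be closer than [e / 2] to a common value; that value will
   be the second difference divided twice by [h]. *)
have tri (P Q Y Y' e : R) : `|P - Y| < e / 2 -> `|Q - Y'| < e / 2 -> Y = Y' ->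
    `|P - Q| = e -> False.
  move=> H1 H2 E H3; subst Y'; have := ler_normB (P - Y) (Q - Y).
  have -> : P - Y - (Q - Y) = P - Q by ring.
  rewrite H3; lra.
have Pc := Ck_continuous (Ck_pd j (Ck_pd i fk)) x.
have Qc := Ck_continuous (Ck_pd i (Ck_pd j fk)) x.
apply/eqP; rewrite -subr_eq0 -normr_eq0; apply/negPn/negP => nz.
set e := `|_| in nz.
have e0 : 0 < e / 2 by rewrite divr_gt0 // lt0r nz normr_ge0.
move/cvgrPdist_lt : Pc => /(_ _ e0) Pc; move/cvgrPdist_lt : Qc => /(_ _ e0) Qc.
have [r /= r0 B] := (nbhs_ballP _ _).1 (filterI Pc Qc).
(* With [h = r / K], displacements shorter than [h] along both axes stay in the ball of radius [r];
   the summand 1 makes [K] positive whatever the norms are. *)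
pose K := `|'e_i : 'rV[R]_n| + `|'e_j : 'rV[R]_n| + 1.
have K0 : 0 < K by rewrite ltr_wpDl // addr_ge0.
pose h := r / K; have h0 : 0 < h by rewrite divr_gt0.
have inB a b : 0 < a < h -> 0 < b < h -> ball x r (x + a *: 'e_i + b *: 'e_j).
  move=> /andP[a0 ah] /andP[b0 bh]; rewrite -ball_normE /= -addrA opprD addNKr normrN.
  rewrite (le_lt_trans (ler_normD _ _)) // !normrZ (gtr0_norm a0) (gtr0_norm b0).
  have : a * `|'e_i : 'rV[R]_n| <= h * `|'e_i : 'rV[R]_n| by rewrite ler_wpM2r // ltW.
  have : b * `|'e_j : 'rV[R]_n| <= h * `|'e_j : 'rV[R]_n| by rewrite ler_wpM2r // ltW.
  have : h * K = r by rewrite /h divfK // gt_eqF.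
  rewrite /K; lra.
have [c [d [ch dh E]]] := pd_second_difference i j x fk h0.
have [d' [c' [dh' ch' E']]] := pd_second_difference j i x fk h0.
have [B1 _] := B _ (inB _ _ ch dh).
have [_ B2] := B _ (inB _ _ ch' dh').
rewrite [x + h *: 'e_j + _]addrAC [x + d' *: 'e_j + _]addrAC in E'.
have EE : pd (pd f i) j (x + c *: 'e_i + d *: 'e_j) = pd (pd f j) i (x + c' *: 'e_i + d' *: 'e_j).
  have hn0 : h != 0 by rewrite gt_eqF.
  have swap (a b u v : R) : a - b - u + v = a - u - b + v by ring.
  exact: (mulfI hn0 (mulfI hn0 (etrans (esym E) (etrans (swap _ _ _ _) E')))).
exact: (tri _ _ _ _ _ B1 B2 EE erefl).
Qed.

End CkTheory.

Arguments Ck_continuous {R n k f} _ x.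

(** * Finite differences on periodic grids *)

Definition grid (n : nat) := ('I_n.+1 * 'I_n.+1)%type.

(** Addition on [grid n] is modulo [n.+1], so periodicity is built in. For [n = 0] the step is zero
    and all differences vanish. *)
Definition gstep (n : nat) (i : 'I_2) : grid n :=
  if i == 0 then (inZp 1, 0) else (0, inZp 1).

(* A family of functions on the grids (Z/(n+1))^2 of mesh 1/(n+1). *)
Definition gfun (R : realType) := forall n, grid n -> R.

Lemma sum_I2 (V : nmodType) (F : 'I_2 -> V) : \sum_i F i = F 0 + F 1.
Proof. by rewrite big_ord_recl big_ord1; congr (_ + F _); apply/val_inj. Qed.

Section GridFunctions.
Context {R : realType}.
Implicit Types (u v w : gfun R) (i j : 'I_2).

Definition gshift i w : gfun R := fun n p => w n (p + gstep n i).

Definition gdiff i w : gfun R :=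
  fun n p => n.+1%:R * (w n (p + gstep n i) - w n p).

(** Backward difference. Up to sign it is the adjoint of [gdiff] for [gavg]; divergences are formed
    with it and gradients with [gdiff], so that summation by parts is exact. *)
Definition gdiffm i w : gfun R :=
  fun n p => n.+1%:R * (w n p - w n (p - gstep n i)).

Arguments gshift : clear implicits.
Arguments gdiff : clear implicits.
Arguments gdiffm : clear implicits.

Definition gavg n (f : grid n -> R) : R := (\sum_p f p) / n.+1%:R ^+ 2.

Definition gsup w : Prop := exists M, forall n p, `|w n p| <= M.

Definition gL2 w : Prop := exists M, forall n, gavg (fun p => w n p ^+ 2) <= M.

(** Discrete Sobolev classes with bounds independent of the mesh: [gL2] for [P] plays the role of
    H^k, and [gsup] that of C^k. *)
Fixpoint gbd (P : gfun R -> Prop) (k : nat) w : Prop :=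
  P w /\ if k is k'.+1 then forall i, gbd P k' (gdiff i w) else True.

Lemma gfunP v w : (forall n p, v n p = w n p) -> v = w.
Proof. by move=> E; apply: functional_extensionality_dep => n; apply/funext => p. Qed.

Lemma gdiffC i j w : gdiff i (gdiff j w) = gdiff j (gdiff i w).
Proof.
apply: gfunP => n p; rewrite /gdiff.
rewrite (addrAC p (gstep n i)); ring.
Qed.

Lemma gdiff_shift i j w : gdiff i (gshift j w) = gshift j (gdiff i w).
Proof. by apply: gfunP => n p; rewrite /gdiff /gshift addrAC. Qed.

Lemma gdiffD i v w :
  gdiff i (fun n p => v n p + w n p) = (fun n p => gdiff i v n p + gdiff i w n p).
Proof. by apply: gfunP => n p; rewrite /gdiff; ring. Qed.

Lemma gdiffM i v w : gdiff i (fun n p => v n p * w n p) =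
  (fun n p => v n p * gdiff i w n p + gdiff i v n p * gshift i w n p).
Proof. by apply: gfunP => n p; rewrite /gdiff /gshift; ring. Qed.

Lemma gdiff_diffm i j w : gdiff i (gdiffm j w) = gdiffm j (gdiff i w).
Proof.
apply: gfunP => n p; rewrite /gdiff /gdiffm (addrAC p _ (- gstep n j)); ring.
Qed.

Section Averages.
Context {n : nat}.
Implicit Types f h : grid n -> R.

Lemma gavg_le f h : (forall p, f p <= h p) -> gavg f <= gavg h.
Proof.
move=> fh; rewrite ler_wpM2r ?invr_ge0 ?exprn_ge0 //.
by apply: ler_sum.
Qed.

Lemma gavg_cst (c : R) : gavg (fun _ : grid n => c) = c.
Proof.
rewrite /gavg sumr_const cardT -cardE card_prod !card_ord -(mulr_natr c).
by rewrite natrM -expr2 mulfK // expf_neq0 // pnatr_eq0.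
Qed.

Lemma gavgD f h : gavg (fun p => f p + h p) = gavg f + gavg h.
Proof. by rewrite /gavg big_split mulrDl. Qed.

Lemma gavgZ c f : gavg (fun p => c * f p) = c * gavg f.
Proof. by rewrite /gavg -mulr_sumr mulrA. Qed.

Lemma gavg_sum (F : 'I_2 -> grid n -> R) :
  gavg (fun p => \sum_i F i p) = \sum_i gavg (F i).
Proof. by rewrite /gavg exchange_big /= mulr_suml. Qed.

Lemma gavg_shift (q : grid n) f : gavg (fun p => f (p + q)) = gavg f.
Proof.
rewrite /gavg; congr (_ / _).
rewrite [RHS](reindex_inj (addIr q)); exact: eq_bigr.
Qed.

Lemma gavg_eq f h : f =1 h -> gavg f = gavg h.
Proof. by move/funext => ->. Qed.

End Averages.

Lemma gavg_by_parts i u v n :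
  gavg (fun p => u n p * gdiffm i v n p) = - gavg (fun p => gdiff i u n p * v n p).
Proof.
apply/eqP; rewrite -subr_eq0 opprK -gavgD; apply/eqP.
(* The sum of the two integrands at [p] is [f p] minus the value of [f] one step back, and averages
   are invariant under translation. *)
pose f p := n.+1%:R * (u n (p + gstep n i) * v n p).
transitivity (gavg f - gavg f); last exact: subrr.
rewrite -[X in _ - X](gavg_shift (- gstep n i)) -mulN1r -gavgZ -gavgD.
by apply: gavg_eq => p; rewrite /f /gdiff /gdiffm subrK; ring.
Qed.

Lemma gL2_sup w : gsup w -> gL2 w.
Proof.
move=> [M wM]; exists (M ^+ 2) => n; rewrite -[leRHS](@gavg_cst n).
apply: gavg_le => p; rewrite -[leLHS]real_normK ?num_real //.
by rewrite ler_sqr ?nnegrE // (le_trans _ (wM n p)).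
Qed.

Lemma gsupD v w : gsup v -> gsup w -> gsup (fun n p => v n p + w n p).
Proof.
move=> [M vM] [N wN]; exists (M + N) => n p.
by rewrite (le_trans (ler_normD _ _)) // lerD.
Qed.

Lemma gsupM v w : gsup v -> gsup w -> gsup (fun n p => v n p * w n p).
Proof. by move=> [M vM] [N wN]; exists (M * N) => n p; rewrite normrM ler_pM. Qed.

Lemma gsup_shift i w : gsup w -> gsup (gshift i w).
Proof. by move=> [M wM]; exists M => n p; exact: wM. Qed.

Lemma gL2D v w : gL2 v -> gL2 w -> gL2 (fun n p => v n p + w n p).
Proof.
move=> [M vM] [N wN]; exists (2 * M + 2 * N) => n.
apply: (@le_trans _ _ (gavg (fun p => 2 * v n p ^+ 2 + 2 * w n p ^+ 2))).
  by apply: gavg_le => p; have := sqr_ge0 (v n p - w n p); nra.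
rewrite gavgD !gavgZ; have := vM n; have := wN n; lra.
Qed.

Lemma gL2M v w : gsup v -> gL2 w -> gL2 (fun n p => v n p * w n p).
Proof.
move=> [M vM] [N wN]; exists (M ^+ 2 * N) => n.
apply: (@le_trans _ _ (gavg (fun p => M ^+ 2 * w n p ^+ 2))).
  apply: gavg_le => p; rewrite exprMn ler_wpM2r ?sqr_ge0 //.
  by rewrite -[leLHS]real_normK ?num_real // ler_sqr ?nnegrE // (le_trans _ (vM n p)).
by rewrite gavgZ ler_wpM2l ?sqr_ge0.
Qed.

Lemma gL2_shift i w : gL2 w -> gL2 (gshift i w).
Proof.
move=> [M wM]; exists M => n.
by rewrite (gavg_shift (gstep n i) (fun p => w n p ^+ 2)).
Qed.

Section BoundedClasses.
Variable P : gfun R -> Prop.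
Hypothesis PD : forall v w, P v -> P w -> P (fun n p => v n p + w n p).
Hypothesis PM : forall v w, gsup v -> P w -> P (fun n p => v n p * w n p).
Hypothesis PS : forall i w, P w -> P (gshift i w).

Lemma gbd0 k w : gbd P k w -> P w. Proof. by case: k => [|k] []. Qed.

Lemma gbdW k w : gbd P k.+1 w -> gbd P k w.
Proof.
by elim: k w => [|k IH] w [Pw dw]; split => // i; apply: IH; apply: dw.
Qed.

Lemma gbdD k v w : gbd P k v -> gbd P k w -> gbd P k (fun n p => v n p + w n p).
Proof.
elim: k v w => [|k IH] v w [Pv dv] [Pw dw]; split=> //; try exact: PD.
by move=> i; rewrite gdiffD; apply: IH; [exact: dv|exact: dw].
Qed.

Lemma gbd_shift k i w : gbd P k w -> gbd P k (gshift i w).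
Proof.
elim: k w => [|k IH] w [Pw dw]; split=> //; try exact: PS.
by move=> j; rewrite gdiff_shift; apply: IH; exact: dw.
Qed.

End BoundedClasses.

(** The discrete Leibniz rule shifts one factor, which is why the class has to be stable under
    translations. *)
Lemma gbdM (P : gfun R -> Prop) k v w :
  (forall v w, P v -> P w -> P (fun n p => v n p + w n p)) ->
  (forall v w, gsup v -> P w -> P (fun n p => v n p * w n p)) ->
  (forall i w, P w -> P (gshift i w)) ->
  gbd gsup k v -> gbd P k w -> gbd P k (fun n p => v n p * w n p).
Proof.
move=> PD PM PS; elim: k v w => [|k IH] v w vk wk; (split; first by
  apply: PM; [exact: gbd0 vk|exact: gbd0 wk]) => // i.
rewrite gdiffM; apply: gbdD => //; apply: IH.
- exact: gbdW.
- by case: wk => _; exact.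
- by case: vk => _; exact.
- by apply: gbd_shift => //; exact: gbdW.
Qed.

Lemma gbd_cst c k : gbd gsup k (fun n p => c).
Proof.
elim: k c => [|k IH] c; (split; first by exists `|c|) => // i.
by rewrite (_ : gdiff i _ = fun n p => 0)//; apply: gfunP => n p; rewrite /gdiff subrr mulr0.
Qed.

Lemma gbd_opp P k w : (forall v w, P v -> P w -> P (fun n p => v n p + w n p)) ->
  (forall v w, gsup v -> P w -> P (fun n p => v n p * w n p)) ->
  (forall i w, P w -> P (gshift i w)) ->
  gbd P k w -> gbd P k (fun n p => - w n p).
Proof.
move=> PD PM PS wk; have := gbdM PD PM PS (gbd_cst (-1) k) wk.
by congr gbd; apply: gfunP => n p; rewrite mulN1r.
Qed.

End GridFunctions.

Arguments gshift {R} i w n p.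
Arguments gdiff {R} i w n p.
Arguments gdiffm {R} i w n p.

(** * Elliptic estimates uniform in the mesh *)

Section DiscretePoisson.
Context {R : realType}.
Implicit Types (u v w : gfun R) (i j : 'I_2) (a : 'I_2 -> 'I_2 -> gfun R) (F : 'I_2 -> gfun R).

Definition gflux a F u i : gfun R :=
  fun n p => \sum_j a i j n p * gdiff j u n p - F i n p.
Arguments gflux : clear implicits.

Definition gelliptic a (lam : R) :=
  forall n p (v : 'I_2 -> R),
    lam * \sum_i v i ^+ 2 <= \sum_i \sum_j a i j n p * v j * v i.

(** The equation is multiplied by [u] and summed by parts, so that the product of gradient and flux
    has average zero. Ellipticity bounds its quadratic part from below, and Young's inequality
    absorbs the term in [F]. *)
Lemma energy_estimate a F u lam n : 0 < lam -> gelliptic a lam ->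
  (forall p, \sum_i gdiffm i (gflux a F u i) n p = 0) ->
  \sum_i gavg (fun p => gdiff i u n p ^+ 2) <=
    lam ^- 2 * \sum_i gavg (fun p => F i n p ^+ 2).
Proof.
move=> lam0 ell eqn.
have Z : gavg (fun p : grid n => \sum_i gdiff i u n p * gflux a F u i n p) = 0.
  rewrite gavg_sum (eq_bigr (fun i => - gavg (fun p => u n p * gdiffm i (gflux a F u i) n p))).
    rewrite sumrN -gavg_sum (@gavg_eq _ _ _ (fun=> 0)) ?gavg_cst ?oppr0 // => p.
    by rewrite -mulr_sumr eqn mulr0.
  by move=> i _; rewrite gavg_by_parts opprK.
(* The weights [lam / 2] and [lam^-1 / 2] in Young's inequality keep half of the elliptic term;
   dividing by [lam / 2] at the end produces [lam ^- 2]. *)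
have P (p : grid n) : \sum_i (lam / 2 * gdiff i u n p ^+ 2 - lam^-1 / 2 * F i n p ^+ 2)
   <= \sum_i gdiff i u n p * gflux a F u i n p.
  have := ell n p (fun i => gdiff i u n p).
  rewrite /gflux !sum_I2; set d0 := gdiff 0 u n p; set d1 := gdiff 1 u n p.
  set f0 := F 0 n p; set f1 := F 1 n p => H.
  have Y (d f : R) : f * d <= lam / 2 * d ^+ 2 + lam^-1 / 2 * f ^+ 2.
    have : 0 <= lam / 2 * (d - lam^-1 * f) ^+ 2.
      by rewrite mulr_ge0 ?sqr_ge0 // divr_ge0 // ltW.
    suff -> : lam / 2 * (d - lam^-1 * f) ^+ 2 = lam / 2 * d ^+ 2 + lam^-1 / 2 * f ^+ 2 - f * d.
      lra.
    by field; rewrite gt_eqF.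
  have := Y d0 f0; have := Y d1 f1; lra.
have := gavg_le P; rewrite Z gavg_sum.
have E i : gavg (fun p => lam / 2 * gdiff i u n p ^+ 2 - lam^-1 / 2 * F i n p ^+ 2)
  = lam / 2 * gavg (fun p => gdiff i u n p ^+ 2) - lam^-1 / 2 * gavg (fun p => F i n p ^+ 2).
  rewrite gavgD gavgZ; congr (_ + _).
  by rewrite -mulNr -gavgZ; apply: gavg_eq => p; rewrite mulNr.
under eq_bigr do rewrite E; rewrite sumrB -!mulr_sumr => H.
have l2 : 0 < 2 / lam by rewrite divr_gt0.
have := ler_wpM2l (ltW l2) H.
rewrite mulr0 mulrBr !mulrA.
suff [-> ->] : 2 / lam * lam / 2 = 1 /\ 2 / lam * lam^-1 / 2 = lam ^- 2.
  by rewrite mul1r; lra.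
by split; field; rewrite gt_eqF.
Qed.

Lemma gL2_gdiff_solution a F u lam : 0 < lam -> gelliptic a lam ->
  (forall n p, \sum_i gdiffm i (gflux a F u i) n p = 0) ->
  (forall i, gL2 (F i)) -> forall i, gL2 (gdiff i u).
Proof.
move=> lam0 ell eqn FL i.
have [M0 H0] := FL 0; have [M1 H1] := FL 1.
exists (lam ^- 2 * (M0 + M1)) => n.
have E := energy_estimate lam0 ell (eqn n).
apply: (@le_trans _ _ (lam ^- 2 * \sum_i gavg (fun p => F i n p ^+ 2))); last first.
  by rewrite ler_wpM2l ?invr_ge0 ?exprn_ge0 ?(ltW lam0) // sum_I2 lerD.
apply: le_trans E; rewrite (bigD1 i) //= lerDl sumr_ge0 // => j _.
rewrite -[leLHS](@gavg_cst _ n); apply: gavg_le => p; exact: sqr_ge0.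
Qed.

(* A difference quotient of a solution solves an equation of the same form, with a
   right-hand side controlled by the first differences of the solution. *)
Lemma gflux_gdiff a F u k i :
  gdiff k (gflux a F u i) =
  gflux a (fun i n p => gdiff k (F i) n p
                        - \sum_j gdiff k (a i j) n p * gshift k (gdiff j u) n p)
        (gdiff k u) i.
Proof.
apply: gfunP => n p; rewrite /gflux !sum_I2 -!(gdiffC k) {1}/gdiff !sum_I2 /gdiff /gshift; ring.
Qed.

(** Induction on the order with [F] and [u] general: a difference of [u] solves the same kind of
    equation, and the commutator with [a] involves only differences of [u] of an order already
    bounded. *)
Lemma gbd_gdiff_solution k a F u lam : 0 < lam -> gelliptic a lam ->
  (forall i j l, gbd gsup l (a i j)) ->
  (forall n p, \sum_i gdiffm i (gflux a F u i) n p = 0) ->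
  (forall i, gbd gL2 k (F i)) -> forall i, gbd gL2 k (gdiff i u).
Proof.
move=> lam0 ell abd; elim: k F u => [|k IH] F u eqn Fk i.
  by split => //; apply: (gL2_gdiff_solution lam0 ell eqn) => j; have [] := Fk j.
(* Bounds of order [k] from the equation before differencing; they control the commutator terms
   below. *)
have uk := IH F u eqn (fun j => gbdW (Fk j)).
split=> [|j]; first exact: gbd0 (uk i).
rewrite gdiffC.
apply: (IH (fun i n p => gdiff j (F i) n p
   - \sum_l gdiff j (a i l) n p * gshift j (gdiff l u) n p) (gdiff j u)) => [n p|l].
  transitivity (gdiff j (fun n p => \sum_i gdiffm i (gflux a F u i) n p) n p).
    rewrite sum_I2 -!gflux_gdiff -!gdiff_diffm -/(gdiff j (fun n p => _) n p).
    by rewrite /gdiff !sum_I2; ring.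
  by rewrite /gdiff !eqn subrr mulr0.
have [_ Fl] := Fk l.
apply: gbdD; [exact: gL2D|exact: Fl|].
apply: gbd_opp; [exact: gL2D|exact: gL2M|exact: gL2_shift|].
have M m : gbd gL2 k (fun n p => gdiff j (a l m) n p * gshift j (gdiff m u) n p).
  apply: gbdM; [exact: gL2D|exact: gL2M|exact: gL2_shift| |].
    by have [_] := abd l m k.+1; exact.
  by apply: gbd_shift => //; exact: gL2_shift.
have := gbdD gL2D (M 0) (M 1).
by congr gbd; apply: gfunP => n p; rewrite sum_I2.
Qed.

(** One-dimensional Sobolev inequality on a cycle: [v c] differs from each [v b] by at most the
    total variation, and the resulting bound is averaged over [b]. *)
Lemma cyclic_sup n (v : 'I_n.+1 -> R) c :
  `|v c| <= n.+1%:R^-1 * \sum_b (`|v b| + n.+1%:R * `|v (b + inZp 1) - v b|).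
Proof.
have P b m : `|v (b + inZp 1 *+ m) - v b| <=
    \sum_(j < m) `|v (b + inZp 1 *+ j + inZp 1) - v (b + inZp 1 *+ j)|.
  elim: m => [|m IH]; first by rewrite mulr0n addr0 subrr normr0 big_ord0.
  rewrite big_ord_recr /= mulrSr addrA.
  by apply: (le_trans (ler_distD (v (b + inZp 1 *+ m)) _ _)); rewrite [leLHS]addrC lerD.
have ZE (z : 'I_n.+1) : inZp 1 *+ z = z.
  apply/val_inj; rewrite /= Zp_mulrn /=.
  by case: n z {v c P} => [|n] z; rewrite ?modn1 ?ord1 // mul1n !modn_small // ltnS.
(* The walk upward from [b] to [c] takes [c - b] steps, read modulo [n.+1], hence crosses each edge
   of the cycle at most once. *)
have S b : `|v c - v b| <= \sum_z `|v (z + inZp 1) - v z|.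
  have := P b (c - b); rewrite ZE addrCA subrr addr0 => /le_trans; apply.
  rewrite [leRHS](reindex_inj (addrI b)) /=.
  pose G m := `|v (b + inZp 1 *+ m + inZp 1) - v (b + inZp 1 *+ m)|.
  rewrite (big_ord_widen n.+1 G) ?(ltnW (ltn_ord (c - b))) //.
  rewrite [leRHS](eq_bigr (fun j : 'I_n.+1 => G j)) => [|j _]; last by rewrite /G ZE.
  rewrite [leRHS](bigID (fun j : 'I_n.+1 => (j < (c - b)%R)%N)) /= lerDl.
  by apply: sumr_ge0 => j _; exact: normr_ge0.
have N0 : n.+1%:R != 0 :> R by rewrite pnatr_eq0.
have -> : `|v c| = n.+1%:R^-1 * \sum_(b < n.+1) `|v c|.
  by rewrite sumr_const card_ord -(mulr_natl `|v c|) mulKf.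
rewrite ler_wpM2l ?invr_ge0 // big_split /= -mulr_sumr.
have -> : n.+1%:R * \sum_z `|v (z + inZp 1) - v z| =
   \sum_(b < n.+1) \sum_z `|v (z + inZp 1) - v z|.
  by rewrite sumr_const card_ord mulr_natl.
rewrite -big_split /=; apply: ler_sum => b _.
have := S b; have := ler_distD 0 (v c) (v b); rewrite !subr0 !sub0r normrN => H1 H2.
have := ler_normD (v c - v b) (v b); rewrite subrK; lra.
Qed.

(** The inequality on cycles is applied along the first coordinate, then along the second to both
    [w] and [gdiff 0 w]. Hence a mixed second difference occurs, but no pure one. *)
Lemma grid_sup n (w : gfun R) p : `|w n p| <=
  gavg (fun q => `|w n q| + `|gdiff 0 w n q| + `|gdiff 1 w n q| + `|gdiff 1 (gdiff 0 w) n q|).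
Proof.
have N0 : (0 : R) <= n.+1%:R by [].
have Ni : (0 : R) <= n.+1%:R^-1 by rewrite invr_ge0.
case: p => a b.
have S1 (f : gfun R) x : `|f n (x, b)| <= n.+1%:R^-1 * \sum_y (`|f n (x, y)| + `|gdiff 1 f n (x, y)|).
  apply: (le_trans (cyclic_sup (fun y => f n (x, y)) b)).
  rewrite ler_wpM2l //; apply: ler_sum => y _; rewrite lerD2l.
  rewrite /gdiff normrM (ger0_norm N0) /gstep /=.
  by rewrite (_ : (x, y) + (0, inZp 1) = (x, y + inZp 1)) // -[in RHS](addr0 x).
apply: (le_trans (cyclic_sup (fun x => w n (x, b)) a)).
rewrite /gavg expr2 invfM [leRHS]mulrC -[leRHS]mulrA ler_wpM2l //.
pose H (q : grid n) := `|w n q| + `|gdiff 0 w n q| + `|gdiff 1 w n q| + `|gdiff 1 (gdiff 0 w) n q|.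
rewrite -/H.
have -> : \sum_(q : grid n) H q = \sum_x \sum_y H (x, y).
  by rewrite pair_bigA; apply: eq_bigr => -[].
rewrite {}/H mulr_sumr; apply: ler_sum => x _.
have := S1 w x; have := S1 (gdiff 0 w) x.
have -> : n.+1%:R * `|w n (x + inZp 1, b) - w n (x, b)| = `|gdiff 0 w n (x, b)|.
  rewrite /gdiff normrM (ger0_norm N0) /gstep /=.
  by rewrite (_ : (x, b) + (inZp 1, 0) = (x + inZp 1, b)) // -[in RHS](addr0 b).
move=> H1 H2; apply: (le_trans (lerD H2 H1)).
rewrite -mulrDr ler_wpM2l // -big_split /=; apply: ler_sum => y _; lra.
Qed.

Lemma gsup_gL2 (w : gfun R) : gbd gL2 2 w -> gsup w.
Proof.
move=> [[M0 H0] dw].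
have [[M1 H1] dw0] := dw 0; have [[M2 H2] _] := dw 1.
have [[M3 H3] _] := dw0 1.
exists ((4 + M0 + M1 + M2 + M3) / 2) => n p; apply: (le_trans (grid_sup w p)).
(* An average of absolute values is bounded through [|f| <= (1 + f^2) / 2]; the four summands of
   [grid_sup] account for the constant [(4 + ...) / 2]. *)
have Y (f : grid n -> R) : gavg (fun q => `|f q|) <= 2^-1 + 2^-1 * gavg (fun q => f q ^+ 2).
  rewrite -gavgZ -[X in X + _](@gavg_cst _ n) -gavgD; apply: gavg_le => q.
  have := sqr_ge0 (`|f q| - 1); rewrite -(real_normK (num_real (f q))); lra.
rewrite !gavgD.
have := Y (w n); have := Y (gdiff 0 w n); have := Y (gdiff 1 w n).
have := Y (gdiff 1 (gdiff 0 w) n).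
have := H0 n; have := H1 n; have := H2 n; have := H3 n; lra.
Qed.

Lemma gbd_gsup_gL2 k (w : gfun R) : gbd gL2 k.+2 w -> gbd gsup k w.
Proof.
elim: k w => [|k IH] w wk.
  by split => //; exact: gsup_gL2.
split=> [|i]; first by apply: gsup_gL2; elim: k wk {IH} => [|k IH] wk; [exact: gbdW|apply: IH; exact: gbdW].
by apply: IH; case: wk => _; exact.
Qed.

End DiscretePoisson.

(** * Solvability on a single grid *)

Lemma linear_inj_surj (R : realType) (T : finType) (Phi : (T -> R) -> T -> R) :
  (forall c f h p, Phi (fun q => c * f q + h q) p = c * Phi f p + Phi h p) ->
  (forall f, (forall p, Phi f p = 0) -> forall p, f p = 0) ->
  forall h, exists f, forall p, Phi f p = h p.
Proof.
move=> lin inj h.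
pose to (v : 'rV[R]_#|T|) (t : T) := v 0 (enum_rank t).
pose L (v : 'rV[R]_#|T|) : 'rV[R]_#|T| := \row_k Phi (to v) (enum_val k).
have linL : linear L.
  move=> c u v; apply/rowP => k; rewrite !mxE -lin; congr (Phi _ _).
  by apply/funext => t; rewrite /to !mxE.
pose LL : {linear 'rV[R]_#|T| -> 'rV[R]_#|T|} := HB.pack L (GRing.isLinear.Build _ _ _ _ L linL).
have : row_free (lin1_mx LL).
  apply/inj_row_free => v; rewrite mul_rV_lin1 /= => L0.
  apply/rowP => k; rewrite mxE -(enum_valK k); apply: (inj (to v)) => p.
  by have /rowP /(_ (enum_rank p)) := L0; rewrite !mxE enum_rankK.
rewrite row_free_unit => U.
exists (to ((\row_k h (enum_val k)) *m invmx (lin1_mx LL))) => p.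
have : LL ((\row_k h (enum_val k)) *m invmx (lin1_mx LL)) = \row_k h (enum_val k).
  by rewrite -mul_rV_lin1 mulmxKV.
by move=> /rowP /(_ (enum_rank p)); rewrite !mxE enum_rankK.
Qed.

Section DiscreteExistence.
Context {R : realType}.
Implicit Types (u v w : gfun R) (i j : 'I_2) (a : 'I_2 -> 'I_2 -> gfun R) (F : 'I_2 -> gfun R).

Lemma gstep_path n i (w : gfun R) M p m : (forall q, `|gdiff i w n q| <= M) ->
  n.+1%:R * `|w n (p + gstep n i *+ m) - w n p| <= m%:R * M.
Proof.
move=> wM; elim: m => [|m IH]; first by rewrite mulr0n addr0 subrr normr0 mulr0 mul0r.
rewrite (mulrSr (gstep n i)) addrA -[m.+1%:R]natr1 mulrDl mul1r.
set q := p + _.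
have := ler_distD (w n q) (w n (q + gstep n i)) (w n p) => H.
apply: (le_trans (ler_wpM2l (ler0n R n.+1) H)).
rewrite mulrDr addrC lerD //.
by have := wM q; rewrite /gdiff normrM ger0_norm.
Qed.

Lemma gstep_pathz n i (w : gfun R) M p (m : int) : (forall q, `|gdiff i w n q| <= M) ->
  n.+1%:R * `|w n (p + gstep n i *~ m) - w n p| <= `|m|%:~R * M.
Proof.
move=> wM; case: m => m; first exact: gstep_path.
have := gstep_path (p + gstep n i *~ Negz m) m.+1 wM.
by rewrite -addrA [_ *~ _ + _]addrC subrr addr0 distrC.
Qed.

Lemma inZp1_mulrn n (z : 'I_n.+1) : inZp 1 *+ z = z.
Proof.
apply/val_inj; rewrite /= Zp_mulrn /=.
by case: n z => [|n] z; rewrite ?modn1 ?ord1 // mul1n !modn_small // ltnS.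
Qed.

Lemma grid_decomp n (p : grid n) : p = gstep n 0 *+ p.1 + gstep n 1 *+ p.2.
Proof.
have P (x y : 'I_n.+1) m : ((x, y) : grid n) *+ m = (x *+ m, y *+ m).
  by elim: m => // m IH; rewrite !mulrSr IH.
case: p => x y; rewrite /gstep /= !P !inZp1_mulrn !mul0rn.
by congr (_, _); rewrite ?addr0 ?add0r.
Qed.

(** Each grid point is reached from the origin by at most [n] steps in each direction, and one step
    changes [w] by at most [M / n.+1]. *)
Lemma grid_oscillation n (w : gfun R) M p : (forall i q, `|gdiff i w n q| <= M) ->
  `|w n p - w n 0| <= 2 * M.
Proof.
move=> wM; have M0 : 0 <= M by apply: le_trans (wM 0 0).
have N0 : 0 < n.+1%:R :> R by [].
have P i q m : (m <= n.+1)%N -> `|w n (q + gstep n i *+ m) - w n q| <= M.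
  move=> mn; rewrite -(ler_pM2l N0).
  apply: (le_trans (gstep_path q m (wM i))).
  by rewrite ler_wpM2r // ler_nat.
have := P 1 (gstep n 0 *+ p.1) p.2 (ltnW (ltn_ord _)).
have := P 0 0 p.1 (ltnW (ltn_ord _)).
rewrite -grid_decomp add0r => H1 H2.
have := ler_distD (w n (gstep n 0 *+ p.1)) (w n p) (w n 0); lra.
Qed.

(** Solvability concerns one grid at a time, whereas the estimates are stated for families; the
    other levels are filled with zero. *)
Lemma gfun_extend n (f : grid n -> R) : exists w : gfun R, w n = f.
Proof.
exists (fun m => if eqVneq n m is EqNotNeq E then ecast m (grid m -> R) E f else fun _ => 0).
by case: eqVneq => [E|/eqP//]; rewrite (eq_axiomK E).
Qed.

Definition level_div n (a : 'I_2 -> 'I_2 -> grid n -> R) (f : grid n -> R) p : R :=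
  \sum_i n.+1%:R * ((\sum_j a i j p * (n.+1%:R * (f (p + gstep n j) - f p)))
    - \sum_j a i j (p - gstep n i) *
         (n.+1%:R * (f (p - gstep n i + gstep n j) - f (p - gstep n i)))).

Lemma level_divE a F u n p : \sum_i gdiffm i (gflux a F u i) n p =
  level_div (fun i j => a i j n) (u n) p - \sum_i gdiffm i (F i) n p.
Proof. by rewrite /level_div /gdiffm /gflux /gdiff !sum_I2; ring. Qed.

Lemma gavg_sum_gdiffm (H : 'I_2 -> gfun R) n :
  gavg (fun p => \sum_i gdiffm i (H i) n p) = 0.
Proof.
rewrite gavg_sum big1 // => i _.
rewrite /gdiffm gavgZ gavgD -(gavg_shift (- gstep n i) (H i n)).
rewrite (_ : gavg (fun p => - _) = - gavg (fun p => H i n (p - gstep n i))) ?subrr ?mulr0 //.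
by rewrite -[RHS]mulN1r -gavgZ; apply: gavg_eq => p; rewrite mulN1r.
Qed.

(** The operator kills constants and has values of average zero, so it is not invertible. Adding the
    average of [f] makes it injective, hence onto; averaging the equation then shows that the added
    term vanishes, the right-hand side being a divergence. *)
Lemma discrete_poisson a F lam : 0 < lam -> gelliptic a lam ->
  exists u, (forall n, u n 0 = 0) /\
    forall n p, \sum_i gdiffm i (gflux a F u i) n p = 0.
Proof.
move=> lam0 ell.
suff ex n : exists f : grid n -> R, forall p,
    level_div (fun i j => a i j n) f p = \sum_i gdiffm i (F i) n p.
  pose u : gfun R := fun n => projT1 (cid (ex n)).
  (* Only differences of [u] enter the equation, so its value at the origin may be subtracted. This
     normalization later bounds [u] itself, and not only its differences. *)
  exists (fun n p => u n p - u n 0); split=> [n|n p]; first by rewrite subrr.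
  have := projT2 (cid (ex n)) p; rewrite -/(u n) level_divE => <-.
  by apply/eqP; rewrite subr_eq0; apply/eqP; rewrite /level_div !sum_I2; ring.
have avg_div f : gavg (level_div (fun i j => a i j n) f) = 0.
  have [w <-] := gfun_extend f.
  rewrite -[RHS](gavg_sum_gdiffm (gflux a (fun _ _ _ => 0) w) n).
  apply: gavg_eq => p; rewrite level_divE !sum_I2 /gdiffm; ring.
pose Phi f p := level_div (fun i j => a i j n) f p + gavg f.
have avg_Phi f : gavg (Phi f) = gavg f by rewrite /Phi gavgD avg_div add0r gavg_cst.
have [||f fP] := @linear_inj_surj R (grid n) Phi _ _ (fun p => \sum_i gdiffm i (F i) n p).
- by move=> c f h p; rewrite /Phi gavgD gavgZ /level_div !sum_I2; ring.
- move=> f f0.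
  have a0 : gavg f = 0 by rewrite -avg_Phi -(@gavg_cst _ n 0); apply: gavg_eq.
  have [w wf] := gfun_extend f.
  (* With zero right-hand side the estimate forces all differences to vanish: [f] is constant, and
     its average is zero. *)
  have E := @energy_estimate R a (fun _ _ _ => 0) w lam n lam0 ell.
  have {}E : \sum_i gavg (fun p => gdiff i w n p ^+ 2) <= 0.
    apply: le_trans (E _) _ => [p|].
      rewrite level_divE wf; have := f0 p; rewrite /Phi a0 addr0 => ->.
      by rewrite sum_I2 /gdiffm; ring.
    by rewrite big1 ?mulr0 // => i _; rewrite expr0n /= gavg_cst.
  have G i q : gdiff i w n q = 0.
    have S0 j : 0 <= \sum_q gdiff j w n q ^+ 2 by apply: sumr_ge0 => ? _; exact: sqr_ge0.
    have S i' : \sum_q gdiff i' w n q ^+ 2 <= 0.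
      have N0 : 0 < (n.+1%:R ^+ 2)^-1 :> R by rewrite invr_gt0 exprn_gt0.
      rewrite -(pmulr_lle0 _ N0).
      apply: le_trans E; rewrite (bigD1 i') //= /gavg lerDl sumr_ge0 // => j _.
      by rewrite mulr_ge0 // ltW.
    have /eqP : \sum_q gdiff i w n q ^+ 2 = 0 by apply/eqP; rewrite eq_le S S0.
    rewrite psumr_eq0 => [|? _]; last exact: sqr_ge0.
    by move=> /allP /(_ q (mem_index_enum _)); rewrite sqrf_eq0 => /eqP.
  have C p : f p = f 0.
    apply/eqP; rewrite -subr_eq0 -normr_le0 -wf.
    by rewrite -(mulr0 2); apply: grid_oscillation => i q; rewrite G normr0.
  by move=> p; rewrite C -a0 -(@gavg_cst _ n (f 0)); apply: gavg_eq => q; rewrite C.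
- exists f => p.
  have a0 : gavg f = 0.
    by rewrite -avg_Phi -[RHS](gavg_sum_gdiffm F n); apply: gavg_eq.
  by rewrite -fP /Phi a0 addr0.
Qed.

End DiscreteExistence.

Local Open Scope classical_set_scope.

(** * Limits of grid functions and the Poisson equation *)

(** An ultrafilter converges to each of its cluster points, and compactness of the segment provides
    one. The same [U] serves all bounded sequences, at all points and for all differences at once,
    so that no subsequence is ever extracted. *)
Lemma ultra_bounded_cvg (R : realType) (U : set_system nat) (s : nat -> R) (M : R) :
  UltraFilter U -> (forall n, `|s n| <= M) -> cvg (s @ U).
Proof.
move=> UF sM; have UP : ProperFilter U := @ultra_proper _ _ UF.
have [p [_ Cp]] : `[- M, M] `&` cluster (s @ U) !=set0.
  apply: (@segment_compact _ (- M) M).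
  apply: (filterE (F := U)) => n /=; rewrite in_itv /= -ler_norml; exact: sM.
apply/cvg_ex; exists p => A pA.
have [//|UC] := in_ultra_setVsetC (s @^-1` A) UF.
by have [y [yC yA]] := Cp (~` A) A UC pA.
Qed.

Lemma filter_lim_le (R : realType) (U : set_system nat) (f h : nat -> R) (l l' : R) :
  ProperFilter U -> f n @[n --> U] --> l -> h n @[n --> U] --> l' ->
  (forall n, f n <= h n) -> l <= l'.
Proof.
move=> UP fl hl fh.
have -> : l = lim (f @ U) by apply/esym/cvg_lim => //; exact: norm_hausdorff.
have -> : l' = lim (h @ U) by apply/esym/cvg_lim => //; exact: norm_hausdorff.
apply: ler_lim; [exact: cvgP fl|exact: cvgP hl|exact: nearW].
Qed.

Section GridLimit.
Context {R : realType}.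
Variable U : set_system nat.
Hypothesis UF : UltraFilter U.
Hypothesis Uoo : \oo `<=` U.
Implicit Types (v w : gfun R) (x : 'rV[R]_2) (i j : 'I_2).

Let UP : ProperFilter U := @ultra_proper _ _ UF.

(** Lower corner of the mesh cell containing [x], wrapped around the torus because multiples of
    [gstep] are taken modulo [n.+1]. *)
Definition gpoint n x : grid n :=
  gstep n 0 *~ Num.floor (n.+1%:R * x 0 0) + gstep n 1 *~ Num.floor (n.+1%:R * x 0 1).

Definition glim w x : R := lim ((fun n => w n (gpoint n x)) @ U).

Lemma cvg_glim w x : gsup w -> w n (gpoint n x) @[n --> U] --> glim w x.
Proof. by move=> [M wM]; apply: (ultra_bounded_cvg UF (M := M)) => n. Qed.

Arguments cvg_glim {w} x _.

Lemma glimP w x (l : R) : w n (gpoint n x) @[n --> U] --> l -> glim w x = l.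
Proof. by move=> wl; apply/cvg_lim => //; exact: norm_hausdorff. Qed.

(** The values differ by a multiple of the mesh size, which tends to zero along [U]. This serves to
    identify the limits of forward and backward differences. *)
Lemma glim_eq_near v w x (l : R) :
  (forall n, n.+1%:R * `|v n (gpoint n x) - w n (gpoint n x)| <= l) ->
  gsup w -> glim v x = glim w x.
Proof.
move=> vwl wb; apply: glimP.
have wl := cvg_glim x wb.
have l0 : 0 <= l by apply: le_trans (vwl 0%N); rewrite mulr_ge0.
rewrite -[X in _ --> X]addr0.
rewrite [X in X @ _](_ : _ = (fun n => w n (gpoint n x) + (v n (gpoint n x) - w n (gpoint n x)))); last first.
  by apply/funext => n; rewrite addrC subrK.
apply: cvgD => //; apply/cvgrPdist_le => e e0.
have e1 : 0 < e / (l + 1) by rewrite divr_gt0 // ltr_wpDl.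
apply: Uoo; have := near_infty_natSinv_lt (PosNum e1).
apply: filterS => n /= ne; rewrite sub0r normrN.
have N0 : 0 < n.+1%:R :> R by [].
rewrite -(ler_pM2l N0) (le_trans (vwl n)) //.
move: ne; rewrite ltr_pdivlMr ?ltr_wpDl // -[in X in X -> _](ltr_pM2l N0) mulrA mulfV ?gt_eqF // mul1r => H.
by rewrite (le_trans _ (ltW H)) // lerDl.
Qed.

(** Discrete Taylor formula: over [m] steps the first difference drifts by at most [m M / n.+1], and
    [m^2 + m <= (m + 1)^2] closes the induction. *)
Lemma gstep_path2_nat n i w M p m : (forall q, `|gdiff i (gdiff i w) n q| <= M) ->
  n.+1%:R ^+ 2 * `|w n (p + gstep n i *+ m) - w n p - m%:R / n.+1%:R * gdiff i w n p|
     <= m%:R ^+ 2 * M.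
Proof.
move=> wM; have M0 : 0 <= M by apply: le_trans (wM 0).
have N0 : 0 < n.+1%:R :> R by [].
elim: m => [|m IH]; first by rewrite mulr0n addr0 subrr !mul0r subr0 normr0 mulr0 expr0n mul0r.
set q := p + gstep n i *+ m in IH *.
have -> : p + gstep n i *+ m.+1 = q + gstep n i by rewrite (mulrSr (gstep n i)) addrA.
have E : w n (q + gstep n i) - w n p - m.+1%:R / n.+1%:R * gdiff i w n p =
  (w n q - w n p - m%:R / n.+1%:R * gdiff i w n p) + n.+1%:R^-1 * (gdiff i w n q - gdiff i w n p).
  have -> : w n (q + gstep n i) = w n q + n.+1%:R^-1 * gdiff i w n q.
    by rewrite /gdiff mulKf ?gt_eqF // [RHS]addrC subrK.
  by rewrite -[m.+1%:R]natr1; ring.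
rewrite E.
have H := gstep_path p m wM; rewrite -/q in H.
apply: (le_trans (ler_wpM2l (exprn_ge0 2 (ltW N0)) (ler_normD _ _))).
rewrite mulrDr normrM gtr0_norm ?invr_gt0 // mulrA expr2 mulfK ?gt_eqF // -expr2.
rewrite -[m.+1%:R]natr1.
have m0 : 0 <= m%:R :> R by [].
nra.
Qed.

(** For negative [m] the expansion is made at the far end [q] of the path. Carrying the first
    difference from [q] back to [p] costs the same error once more, whence the factor 2. *)
Lemma gstep_path2 n i w M p (m : int) : (forall q, `|gdiff i (gdiff i w) n q| <= M) ->
  `|w n (p + gstep n i *~ m) - w n p - m%:~R / n.+1%:R * gdiff i w n p|
     <= 2 * M * (m%:~R / n.+1%:R) ^+ 2.
Proof.
move=> wM; have M0 : 0 <= M by apply: le_trans (wM 0).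
have N0 : 0 < n.+1%:R :> R by [].
have N2 : 0 < n.+1%:R ^+ 2 :> R by rewrite exprn_gt0.
have T m' q : `|w n (q + gstep n i *+ m') - w n q - m'%:R / n.+1%:R * gdiff i w n q|
    <= M * (m'%:R / n.+1%:R) ^+ 2.
  rewrite -(ler_pM2l N2); apply: (le_trans (gstep_path2_nat q m' wM)).
  by rewrite expr_div_n mulrCA [X in _ <= _ * X]mulrC divfK ?gt_eqF // mulrC.
case: m => m.
  apply: (le_trans (T m p)); rewrite ler_wpM2r ?sqr_ge0 //; lra.
set q := p + _; have pq : p = q + gstep n i *+ m.+1.
  by rewrite /q -addrA [_ *~ _ + _]addrC subrr addr0.
have := T m.+1 q; rewrite -pq => H1.
have := gstep_path q m.+1 wM; rewrite -pq => H2.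
have -> : (Negz m)%:~R = - m.+1%:R :> R by rewrite NegzE mulrNz.
rewrite mulNr sqrrN mulNr opprK.
set k := m.+1%:R / n.+1%:R in H1 *.
have k0 : 0 <= k by rewrite divr_ge0.
have H3 : `|gdiff i w n p - gdiff i w n q| <= k * M.
  by rewrite -(ler_pM2l N0) /k !mulrA [n.+1%:R * m.+1%:R]mulrC mulfK ?gt_eqF.
have -> : w n q - w n p + k * gdiff i w n p =
   k * (gdiff i w n p - gdiff i w n q) - (w n p - w n q - k * gdiff i w n q) by ring.
apply: (le_trans (ler_normB _ _)); rewrite normrM (ger0_norm k0).
nra.
Qed.

(** Signed number of grid steps separating the cells of [x] and [x + t] in one coordinate. *)
Definition gfloor n (x : R) (t : R) : int :=
  Num.floor (n.+1%:R * (x + t)) - Num.floor (n.+1%:R * x).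

Lemma gpoint_shift n x i t :
  gpoint n (x + t *: 'e_i) = gpoint n x + gstep n i *~ gfloor n (x 0 i) t.
Proof.
have [->|->] : i = 0 \/ i = 1 by case: i => -[|[|//]] ?; [left|right]; apply/val_inj.
  rewrite /gpoint /gfloor !mxE /= mulr1 mulr0 addr0 addrAC mulrzBr; congr (_ + _).
  by rewrite [RHS]addrC subrK.
rewrite /gpoint /gfloor !mxE /= mulr1 mulr0 addr0 -addrA mulrzBr; congr (_ + _).
by rewrite [RHS]addrC subrK.
Qed.

Lemma gfloor_cvg (x t : R) : (gfloor n x t)%:~R / n.+1%:R @[n --> U] --> t.
Proof.
apply/cvgrPdist_le => e e0.
apply: Uoo; have := near_infty_natSinv_lt (PosNum e0).
apply: filterS => n /= ne.
have N0 : 0 < n.+1%:R :> R by [].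
apply: ltW; apply: le_lt_trans ne.
rewrite -(ler_pM2l N0) mulfV ?gt_eqF // -[X in X * _](gtr0_norm N0) -normrM mulrBr.
rewrite mulrC [_ * (_ / _)]mulrC divfK ?gt_eqF // /gfloor intrB.
have /andP[a1 a2] := Num.Theory.floor_itv (n.+1%:R * (x + t)).
have /andP[b1 b2] := Num.Theory.floor_itv (n.+1%:R * x).
rewrite intrD in a2; rewrite intrD in b2.
set A := (Num.floor _)%:~R in a1 a2 *; set B := (Num.floor _)%:~R in b1 b2 *.
rewrite ler_norml; apply/andP; split; nra.
Qed.

Arguments gfloor_cvg : clear implicits.

Lemma glim_lip w i : gsup w -> gsup (gdiff i w) ->
  exists M, forall x (t : R), `|glim w (x + t *: 'e_i) - glim w x| <= M * `|t|.
Proof.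
move=> wb [M wM]; exists M => x t.
have A : `|w n (gpoint n (x + t *: 'e_i)) - w n (gpoint n x)| @[n --> U]
    --> `|glim w (x + t *: 'e_i) - glim w x|.
  by apply: cvg_norm; apply: cvgB; exact: cvg_glim.
have B : M * `|(gfloor n (x 0 i) t)%:~R / n.+1%:R| @[n --> U] --> M * `|t|.
  by apply: cvgM; [exact: cvg_cst|apply: cvg_norm; exact: gfloor_cvg].
apply: (filter_lim_le UP A B) => n; rewrite gpoint_shift.
have N0 : 0 < n.+1%:R :> R by [].
rewrite -(ler_pM2l N0); apply: (le_trans (gstep_pathz (gpoint n x) (gfloor n (x 0 i) t) (wM n))).
rewrite normrM normfV (gtr0_norm N0).
by rewrite mulrCA [n.+1%:R * _]mulrC divfK ?gt_eqF // mulrC -intr_norm.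
Qed.

(** The quadratic Taylor bound has a constant independent of [n] and survives pointwise limits;
    differentiability of the limit follows from it directly. *)
Lemma is_derive_glim w i x : gsup w -> gsup (gdiff i w) -> gsup (gdiff i (gdiff i w)) ->
  is_derive x 'e_i (glim w) (glim (gdiff i w) x).
Proof.
move=> wb dwb [M wM].
have T (t : R) : `|glim w (x + t *: 'e_i) - glim w x - t * glim (gdiff i w) x| <= 2 * M * t ^+ 2.
  have F := gfloor_cvg (x 0 i) t.
  have A : `|w n (gpoint n (x + t *: 'e_i)) - w n (gpoint n x)
      - (gfloor n (x 0 i) t)%:~R / n.+1%:R * gdiff i w n (gpoint n x)| @[n --> U]
    --> `|glim w (x + t *: 'e_i) - glim w x - t * glim (gdiff i w) x|.
    apply: cvg_norm; apply: cvgB; first by apply: cvgB; exact: cvg_glim.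
    by apply: cvgM => //; exact: cvg_glim.
  have B : 2 * M * ((gfloor n (x 0 i) t)%:~R / n.+1%:R) ^+ 2 @[n --> U] --> 2 * M * t ^+ 2.
    by apply: cvgM; [exact: cvg_cst|apply: cvgM; exact: F].
  by apply: (filter_lim_le UP A B) => n; rewrite gpoint_shift; exact: gstep_path2.
have M0 : 0 <= M by apply: le_trans (wM 0%N 0).
have D : h^-1 *: ((glim w \o shift x) (h *: 'e_i) - glim w x) @[h --> 0^'] --> glim (gdiff i w) x.
  apply/cvgrPdist_le => e e0.
  have d0 : 0 < e / (2 * M + 1) by rewrite divr_gt0 // ltr_wpDl // mulr_ge0.
  near=> h.
  have h0 : h != 0 by near: h; exact: nbhs_dnbhs_neq.
  have hd : `|h| < e / (2 * M + 1).
    by near: h; apply: dnbhs0_lt.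
  have H := T h; rewrite /= [h *: _ + x]addrC.
  have hn : 0 < `|h| by rewrite normr_gt0.
  rewrite -(ler_pM2l hn) -normrM mulrBr distrC /GRing.scale /= mulVKf //.
  apply: (le_trans H); rewrite -[h ^+ 2]real_normK ?num_real // expr2 mulrCA ler_wpM2l //.
  move: hd; rewrite ltr_pdivlMr ?ltr_wpDl ?mulr_ge0 // mulrDr mulr1 => hd.
  by rewrite mulrC (le_trans _ (ltW hd)) // lerDl.
split; first by apply/cvg_ex; exists (glim (gdiff i w) x).
by apply/cvg_lim => //; exact: norm_hausdorff.
Unshelve. all: by end_near. Qed.

End GridLimit.

Arguments gfloor_cvg {R U} UF Uoo x t.

Lemma cvg_dominated (R : realType) (T : Type) (F : set_system T) (FF : Filter F)
  (f e : T -> R) (l : R) : (forall y, `|l - f y| <= e y) ->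
  e y @[y --> F] --> 0 -> f y @[y --> F] --> l.
Proof.
move=> fe e0; apply/cvgrPdist_le => d d0; move/cvgrPdist_le : e0 => /(_ d d0).
apply: filterS => y; rewrite sub0r normrN => H.
by apply: (le_trans (fe y)); apply: le_trans H; rewrite ler_norm.
Qed.

Lemma cvg_scaled_coord (R : realType) (M : R) (i : 'I_2) (x : 'rV[R]_2) :
  M * `|y 0 i - x 0 i| @[y --> x] --> M * `|x 0 i - x 0 i|.
Proof.
apply: cvgMl_tmp; apply: cvg_norm; apply: cvgB; last exact: cvg_cst.
exact: coord_continuous.
Qed.
Arguments cvg_scaled_coord {R} M i x.

Section GridLimitSmooth.
Context {R : realType}.
Variable U : set_system nat.
Hypothesis UF : UltraFilter U.
Hypothesis Uoo : \oo `<=` U.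
Implicit Types (v w : gfun R) (x : 'rV[R]_2) (i j : 'I_2).

Let UP : ProperFilter U := @ultra_proper _ _ UF.

Lemma rV2_decomp (x : 'rV[R]_2) : x = x 0 0 *: 'e_0 + x 0 1 *: 'e_1.
Proof.
apply/rowP => i; rewrite !mxE.
by case: i => -[|[|//]] ? /=; rewrite ?(mulr1, mulr0, addr0, add0r); congr (x _ _); apply/val_inj.
Qed.

Lemma I2P (P : 'I_2 -> Prop) : P 0 -> P 1 -> forall i, P i.
Proof.
move=> P0 P1 [[|[|//]] i2].
  by have -> : Ordinal i2 = 0 by apply/val_inj.
by have -> : Ordinal i2 = 1 by apply/val_inj.
Qed.

Definition gsmooth w := forall k, gbd gsup k w.

Lemma gsmooth_sup w : gsmooth w -> gsup w. Proof. by move=> /(_ 0%N) []. Qed.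

Lemma gsmooth_diff i w : gsmooth w -> gsmooth (gdiff i w).
Proof. by move=> ws k; have [_] := ws k.+1; exact. Qed.

Lemma gsmoothM v w : gsmooth v -> gsmooth w -> gsmooth (fun n p => v n p * w n p).
Proof.
by move=> vs ws k; apply: gbdM => //; [exact: gsupD|exact: gsupM|move=> ? ?; exact: gsup_shift].
Qed.

Lemma gsmoothD v w : gsmooth v -> gsmooth w -> gsmooth (fun n p => v n p + w n p).
Proof. by move=> vs ws k; apply: gbdD => //; exact: gsupD. Qed.

Lemma glim_continuous w : gsup w -> (forall i, gsup (gdiff i w)) -> continuous (glim U w).
Proof.
move=> wb dwb; suff C (x : 'rV[R]_2) : glim U w y @[y --> x] --> glim U w x by exact: C.
have [M0 H0] := glim_lip UF Uoo wb (dwb 0).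
have [M1 H1] := glim_lip UF Uoo wb (dwb 1).
pose e (y : 'rV[R]_2) := M0 * `|y 0 0 - x 0 0| + M1 * `|y 0 1 - x 0 1|.
have ye y : `|glim U w x - glim U w y| <= e y.
  (* [y] is reached from [x] along two segments parallel to the axes, on each of which the limit is
     Lipschitz. *)
  have yE : y = x + (y 0 0 - x 0 0) *: 'e_0 + (y 0 1 - x 0 1) *: 'e_1.
    by apply/rowP; apply: I2P; rewrite !mxE /=; ring.
  rewrite [in X in X <= _]yE distrC; set z := x + _ *: _.
  apply: (le_trans (ler_distD (glim U w z) _ _)).
  by rewrite addrC lerD // H0.
have ec : e y @[y --> x] --> 0.
  have := cvgD (cvg_scaled_coord M0 0 x) (cvg_scaled_coord M1 1 x).
  rewrite !subrr normr0 !mulr0 addr0; exact.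
exact: cvg_dominated ye ec.
Qed.

Lemma is_derive_glim_smooth w i x : gsmooth w ->
  is_derive x 'e_i (glim U w) (glim U (gdiff i w) x).
Proof.
by move=> ws; apply: is_derive_glim => //; apply: gsmooth_sup => //;
  do !apply: gsmooth_diff.
Qed.

Lemma glim_smooth w : gsmooth w -> smooth (glim U w).
Proof.
move=> ws k; elim: k w ws => [|k IH] w ws.
  split=> //; apply: glim_continuous => [|i]; apply: gsmooth_sup => //.
  exact: gsmooth_diff.
apply: (@Ck_intro _ _ _ _ (fun i => glim U (gdiff i w))).
- by apply: glim_continuous => [|i]; apply: gsmooth_sup => //; exact: gsmooth_diff.
- by move=> i x; exact: is_derive_glim_smooth.
- by move=> i; apply: IH; exact: gsmooth_diff.
Qed.

Lemma pd_glim w i x : gsmooth w -> pd (glim U w) i x = glim U (gdiff i w) x.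
Proof. by move=> ws; apply: pd_val; exact: is_derive_glim_smooth. Qed.

Lemma gstep_period n i : gstep n i *~ n.+1 = 0.
Proof.
have P (x y : 'I_n.+1) m : ((x, y) : grid n) *+ m = (x *+ m, y *+ m).
  by elim: m => // m IH; rewrite !mulrSr IH.
rewrite /gstep -pmulrn; case: ifP => _; rewrite P mul0rn; congr (_, _);
  by apply/val_inj; rewrite Zp_mulrn /= modnMl.
Qed.

Lemma glim_periodic w : T2_periodic (glim U w).
Proof.
move=> i x; rewrite -[x in RHS]addr0 /glim.
congr (lim _); apply/seteqP.
suff E n : gpoint n (x + 'e_i) = gpoint n (x + 0).
  by split => A; rewrite /= /nbhs /=; move=> H; apply: filterS H => n /=; rewrite E.
(* Translation by one period moves the grid point by [n.+1] steps, that is, once around the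
   torus. *)
rewrite addr0 -['e_i]scale1r gpoint_shift /gfloor mulrDr mulr1.
rewrite Num.Theory.floorDrz ?natr_int //.
have -> : Num.floor (n.+1%:R : R) = Posz n.+1.
  by apply: Num.Theory.floor_def; apply/andP; split; [exact: lexx|rewrite intrD ltrDl].
by rewrite [_ + Posz _]addrC addrK gstep_period addr0.
Qed.

Definition gpos n (p : grid n) : 'rV[R]_2 :=
  \row_i (((if i == 0 then p.1 else p.2) : nat)%:R / n.+1%:R).

Definition gsample (f : nat -> 'rV[R]_2 -> R) : gfun R := fun n p => f n (gpos p).

(** [k] tells whether the step wraps around. The position in the plane then jumps by a whole period,
    which periodic functions do not see. *)
Lemma val_next n (z : 'I_n.+1) : exists k : bool,
  (nat_of_ord (z + inZp 1)%R)%:R = z%:R + 1 - k%:R * n.+1%:R :> R.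
Proof.
rewrite /= modnDmr addn1; have := ltn_ord z; rewrite leq_eqVlt => /orP[/eqP[zn]|zn].
  by exists true; rewrite zn modnn mul1r natr1 subrr.
by exists false; rewrite modn_small // mul0r subr0 natr1.
Qed.

Lemma T2_periodicn (T : Type) (f : 'rV[R]_2 -> T) i (k : bool) x : T2_periodic f ->
  f (x + k%:R *: 'e_i) = f x.
Proof. by move=> fp; case: k; rewrite ?scale1r ?fp // scale0r addr0. Qed.

Lemma gpos_step (T : Type) (f : 'rV[R]_2 -> T) n (p : grid n) i : T2_periodic f ->
  f (gpos (p + gstep n i)) = f (gpos p + n.+1%:R^-1 *: 'e_i).
Proof.
move=> fp; have N0 : n.+1%:R != 0 :> R by rewrite pnatr_eq0.
have g0 (q : grid n) : gpos q 0 0 = (q.1 : nat)%:R / n.+1%:R by rewrite mxE.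
have g1 (q : grid n) : gpos q 0 1 = (q.2 : nat)%:R / n.+1%:R by rewrite mxE.
have e00 : ('e_0 : 'rV[R]_2) 0 0 = 1 by rewrite mxE.
have e01 : ('e_0 : 'rV[R]_2) 0 1 = 0 by rewrite mxE.
have e10 : ('e_1 : 'rV[R]_2) 0 0 = 0 by rewrite mxE.
have e11 : ('e_1 : 'rV[R]_2) 0 1 = 1 by rewrite mxE.
move: i; apply: I2P.
  have s1 : (p + gstep n 0).1 = p.1 + inZp 1 by [].
  have s2 : (p + gstep n 0).2 = p.2 := addr0 _.
  have [k E] := val_next p.1.
  rewrite -(T2_periodicn 0 k (gpos (p + gstep n 0))) //; congr f.
  apply/rowP; apply: I2P; rewrite mxE [RHS]mxE [X in _ + X = _]mxE [X in _ = _ + X]mxE.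
    by rewrite !g0 e00 s1 E; field; rewrite // natr1.
  by rewrite !g1 e01 s2; ring.
have s1 : (p + gstep n 1).1 = p.1 := addr0 _.
have s2 : (p + gstep n 1).2 = p.2 + inZp 1 by [].
have [k E] := val_next p.2.
rewrite -(T2_periodicn 1 k (gpos (p + gstep n 1))) //; congr f.
apply/rowP; apply: I2P; rewrite mxE [RHS]mxE [X in _ + X = _]mxE [X in _ = _ + X]mxE.
  by rewrite !g0 e10 s1; ring.
by rewrite !g1 e11 s2 E; field; rewrite // natr1.
Qed.

(** Positions of grid points are compared only modulo periods, hence through a periodic function;
    steps are composed by letting the induction range over all such functions, in particular
    translates. *)
Lemma gpos_stepz (T : Type) (f : 'rV[R]_2 -> T) n (p : grid n) i (m : int) : T2_periodic f ->
  f (gpos (p + gstep n i *~ m)) = f (gpos p + (m%:~R / n.+1%:R) *: 'e_i).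
Proof.
move=> fp.
have P (k : nat) (f' : 'rV[R]_2 -> T) q : T2_periodic f' -> f' (gpos (q + gstep n i *+ k)) = f' (gpos q + (k%:R / n.+1%:R) *: 'e_i).
  elim: k f' => [|k IH] f' fp'; first by rewrite mulr0n mul0r scale0r !addr0.
  rewrite (mulrSr (gstep n i)) addrA gpos_step //.
  rewrite (IH (fun y => f' (y + n.+1%:R^-1 *: 'e_i))); last first.
    by move=> j y; rewrite /= addrAC fp'.
  by rewrite -addrA -scalerDl -[k.+1%:R]natr1 mulrDl mul1r.
case: m => m; first exact: P.
set q := p + _; have pq : p = q + gstep n i *+ m.+1.
  by rewrite /q -addrA [_ *~ _ + _]addrC subrr addr0.
rewrite pq (P _ (fun y => f (y + ((Negz m)%:~R / n.+1%:R) *: 'e_i))); last first.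
  by move=> j y; rewrite /= addrAC fp.
by rewrite -addrA -scalerDl -mulrDl NegzE mulrNz subrr mul0r scale0r addr0.
Qed.

Lemma gpos_gpoint (T : Type) (f : 'rV[R]_2 -> T) n x : T2_periodic f ->
  f (gpos (gpoint n x)) = f (((Num.floor (n.+1%:R * x 0 0))%:~R / n.+1%:R) *: 'e_0 +
       ((Num.floor (n.+1%:R * x 0 1))%:~R / n.+1%:R) *: 'e_1).
Proof.
move=> fp; rewrite /gpoint gpos_stepz //.
rewrite -[X in gpos X]add0r (gpos_stepz (f := fun y => f (y + _))); last first.
  by move=> j y; rewrite /= addrAC fp.
congr f; rewrite (_ : gpos _ = 0) ?add0r //.
by apply/rowP; apply: I2P; rewrite !mxE /= mul0r.
Qed.

Lemma glim_sample (f : 'rV[R]_2 -> R) x : T2_periodic f -> continuous f ->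
  glim U (gsample (fun=> f)) x = f x.
Proof.
move=> fp fc; apply: glimP => //; rewrite /gsample.
pose y n := ((Num.floor (n.+1%:R * x 0 0))%:~R / n.+1%:R) *: 'e_0 +
       ((Num.floor (n.+1%:R * x 0 1))%:~R / n.+1%:R) *: 'e_1 : 'rV[R]_2.
rewrite (_ : (fun n => _) = (fun n => f (y n))); last first.
  by apply/funext => n; exact: gpos_gpoint.
have C i : (Num.floor (n.+1%:R * x 0 i))%:~R / n.+1%:R @[n --> U] --> x 0 i.
  have := gfloor_cvg UF Uoo 0 (x 0 i); apply: cvg_trans; apply: near_eq_cvg.
  by apply: nearW => n; rewrite /gfloor add0r mulr0 floor0 subr0.
have yx : y n @[n --> U] --> x.
  rewrite (rV2_decomp x); by apply: cvgD; apply: cvgZr_tmp; exact: C.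
apply: continuous_cvg; [exact: fc|exact: yx].
Qed.

End GridLimitSmooth.

(** * Divergence-form equations on the torus *)

Section TorusPoisson.
Context {R : realType}.
Implicit Types (x : 'rV[R]_2) (i j : 'I_2).

Lemma T2_periodicz (T : Type) (f : 'rV[R]_2 -> T) i (m : int) x : T2_periodic f ->
  f (x + m%:~R *: 'e_i) = f x.
Proof.
move=> fp.
have P y (k : nat) : f (y + k%:R *: 'e_i) = f y.
  elim: k => [|k IH]; first by rewrite scale0r addr0.
  by rewrite -natr1 scalerDl scale1r addrA fp.
case: m => m; first exact: P.
rewrite -(P (x + _) m.+1) -addrA -scalerDl NegzE mulrNz.
by rewrite [X in X *: _]addrC subrr scale0r addr0.
Qed.

Lemma T2_periodic_bounded (f : 'rV[R]_2 -> R) : T2_periodic f -> continuous f ->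
  exists M, forall x, `|f x| <= M.
Proof.
move=> fp fc.
have K : compact [set v : 'rV[R]_2 | forall i, v ord0 i \in `[(0 : R), 1]%R].
  apply: (@rV_compact _ _ (fun=> `[(0 : R), 1]%classic)) => _; exact: segment_compact.
have KI : compact (f @` [set v : 'rV[R]_2 | forall i, v ord0 i \in `[(0 : R), 1]%R]).
  by apply: continuous_compact => //; apply: continuous_subspaceT.
have [M [_ HM]] := compact_bounded KI.
exists (M + 1) => x.
pose y := x + (- Num.floor (x 0 0))%:~R *: 'e_0 + (- Num.floor (x 0 1))%:~R *: 'e_1.
have -> : f x = f y by rewrite /y !T2_periodicz.
apply: (HM (M + 1)); first by rewrite ltrDl.
exists y => //.
have F (t : R) : t + (- Num.floor t)%:~R \in `[(0 : R), 1]%R.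
  have := Num.Theory.floor_itv t; rewrite intrD mulrNz in_itv /=; lra.
apply: I2P; rewrite !mxE /=.
  by rewrite mulr1 mulr0 addr0 F.
by rewrite mulr0 mulr1 addr0 F.
Qed.

Lemma pd_periodic (f : 'rV[R]_2 -> R) i : T2_periodic f -> T2_periodic (pd f i).
Proof.
move=> fp j x; rewrite /pd /derive.
suff -> : (fun h : R => h^-1 *: ((f \o shift (x + 'e_j)) (h *: 'e_i) - f (x + 'e_j))) =
  (fun h : R => h^-1 *: ((f \o shift x) (h *: 'e_i) - f x)) by [].
by apply/funext => h /=; rewrite fp addrA fp.
Qed.

(** The functions depend on [n] because the difference quotient of a fixed function with the mesh as
    its step does; the bounds are uniform in [n]. *)
Fixpoint fbd (k : nat) (f : nat -> 'rV[R]_2 -> R) : Prop :=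
  (exists M, forall n x, `|f n x| <= M) /\
  if k is k'.+1
  then forall i, (forall n x, derivable (f n) x 'e_i) /\ fbd k' (fun n => pd (f n) i)
  else True.

Definition fquot i (f : nat -> 'rV[R]_2 -> R) (n : nat) x : R :=
  n.+1%:R * (f n (x + n.+1%:R^-1 *: 'e_i) - f n x).

Lemma fquot_is_derive i j (f : nat -> 'rV[R]_2 -> R) n x :
  (forall y, derivable (f n) y 'e_j) ->
  is_derive x 'e_j (fquot i f n) (fquot i (fun n => pd (f n) j) n x).
Proof.
move=> df; rewrite /fquot.
have D1 : is_derive x 'e_j (fun y => f n (y + n.+1%:R^-1 *: 'e_i)) (pd (f n) j (x + n.+1%:R^-1 *: 'e_i)).
  apply/is_derive_line0; have /is_derive_line0 := pdP (df (x + n.+1%:R^-1 *: 'e_i)).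
  by congr is_derive; apply/funext => t; rewrite addrAC.
have D2 : is_derive x 'e_j (fun y => - f n y) (- pd (f n) j x).
  by apply: is_deriveN; exact: pdP.
have := is_deriveMl (is_derive_cst (n.+1%:R : R) x 'e_j) (is_deriveDl D1 D2).
by rewrite mul0r add0r.
Qed.

(** By the mean value theorem a quotient is a value of the derivative, and quotients commute with
    derivatives, so that only one order is lost. *)
Lemma fbd_fquot k i f : fbd k.+1 f -> fbd k (fquot i f).
Proof.
elim: k f => [|k IH] f [fb fd].
  have [df [[M fM] _]] := fd i; split=> //; exists M => n x.
  have N0 : 0 < n.+1%:R :> R by [].
  have Ni : 0 < n.+1%:R^-1 :> R by rewrite invr_gt0.
  have [c _ E] := mean_value_pd x (df n) Ni.
  by rewrite /fquot E mulrA mulfV ?gt_eqF // mul1r.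
have [df [[M fM] _]] := fd i; split.
  exists M => n x.
  have Ni : 0 < n.+1%:R^-1 :> R by rewrite invr_gt0.
  have [c _ E] := mean_value_pd x (df n) Ni.
  by rewrite /fquot E mulrA mulfV ?gt_eqF // mul1r.
move=> j; have [dj fj] := fd j; split=> [n x|].
  by have [] := fquot_is_derive i x (dj n).
rewrite (_ : (fun n => pd _ j) = fquot i (fun n => pd (f n) j)); first exact: IH.
by apply/funext => n; apply/funext => x; apply: pd_val; exact: fquot_is_derive.
Qed.

Lemma gdiff_sample i f : (forall n, T2_periodic (f n)) ->
  gdiff i (gsample f) = gsample (fquot i f).
Proof. by move=> fp; apply: gfunP => n p; rewrite /gdiff /gsample gpos_step. Qed.

Lemma gbd_sample k f : (forall n, T2_periodic (f n)) -> fbd k f -> gbd gsup k (gsample f).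
Proof.
elim: k f => [|k IH] f fp fk.
  by case: fk => [[M fM] _]; split=> //; exists M => n p; exact: fM.
split=> [|i]; first by case: fk => [[M fM] _]; exists M => n p; exact: fM.
rewrite gdiff_sample //; apply: IH; last exact: fbd_fquot.
by move=> n j x; rewrite /fquot addrAC !fp.
Qed.

Lemma gsmooth_sample (f : 'rV[R]_2 -> R) : T2_periodic f -> smooth f -> gsmooth (gsample (fun=> f)).
Proof.
move=> fp fs k; apply: gbd_sample => //.
have {fs} := fs k.
elim: k f fp => [|k IH] f fp fk.
  by split=> //; have [M HM] := T2_periodic_bounded fp (fun x => Ck_continuous fk x); exists M.
split.
  by have [M HM] := T2_periodic_bounded fp (fun x => Ck_continuous fk x); exists M.
move=> i; split=> [n x|]; first exact: Ck_derivable fk.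
by apply: IH; [exact: pd_periodic|exact: Ck_pd].
Qed.

Lemma torus_poisson (a : 'I_2 -> 'I_2 -> 'rV[R]_2 -> R) (F : 'I_2 -> 'rV[R]_2 -> R) (lam : R) :
  0 < lam ->
  (forall i j, T2_periodic (a i j) /\ smooth (a i j)) ->
  (forall i, T2_periodic (F i) /\ smooth (F i)) ->
  (forall x (v : 'I_2 -> R), lam * \sum_i v i ^+ 2 <= \sum_i \sum_j a i j x * v j * v i) ->
  exists u, [/\ T2_periodic u, smooth u &
    forall x, \sum_i pd (fun y => \sum_j a i j y * pd u j y - F i y) i x = 0].
Proof.
move=> lam0 ha hF ell.
have [U [UF Uoo]] := ultraFilterLemma (F := \oo) _.
pose ga i j := gsample (fun=> a i j); pose gF i := gsample (fun=> F i).
have gas i j : gsmooth (ga i j) by have [] := ha i j; exact: gsmooth_sample.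
have gFs i : gsmooth (gF i) by have [] := hF i; exact: gsmooth_sample.
have gell : gelliptic ga lam by move=> n p v; exact: ell.
have [u [u0 uE]] := discrete_poisson gF lam0 gell.
have dus i : gsmooth (gdiff i u).
  (* Order [k.+2] in mean square gives order [k] in the sup norm. *)
  move=> k; apply: gbd_gsup_gL2; apply: (gbd_gdiff_solution lam0 gell gas uE) => j.
  move: k.+2 (gFs j) => l Fs; have {Fs} := Fs l.
  elim: l (gF j) => [|l IH] w; first by move=> [/gL2_sup].
  by move=> [/gL2_sup ws dw]; split => // m; apply: IH; exact: dw.
have us : gsmooth u.
  (* Differences control only the oscillation of [u]; the normalization at the origin turns this
     into a bound. *)
  have ub : gsup u.
    have [M0 H0] := gsmooth_sup (dus 0); have [M1 H1] := gsmooth_sup (dus 1).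
    exists (2 * (`|M0| + `|M1|)) => n p.
    rewrite -[u n p]subr0 -(u0 n); apply: grid_oscillation; apply: I2P => q.
      by rewrite (le_trans (H0 n q)) // (le_trans (ler_norm _)) // lerDl.
    by rewrite (le_trans (H1 n q)) // (le_trans (ler_norm _)) // lerDr.
  by case=> [|k]; split => // i; exact: dus.
exists (glim U u); split; [exact: glim_periodic|exact: glim_smooth|].
move=> x.
pose H i := gflux ga gF u i.
have Hs i : gsmooth (H i).
  have P j : gsmooth (fun n p => ga i j n p * gdiff j u n p) by exact: gsmoothM.
  have Fs : gsmooth (fun n p => - gF i n p).
    by move=> k; apply: gbd_opp; [exact: gsupD|exact: gsupM|move=> ? ?; exact: gsup_shift|exact: gFs].
  have := gsmoothD (gsmoothD (P 0) (P 1)) Fs.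
  by congr gsmooth; apply: gfunP => n p; rewrite /H /gflux sum_I2.
have EH i y : glim U (H i) y = \sum_j a i j y * pd (glim U u) j y - F i y.
  have [ap as_] := (fun j => (ha i j).1, fun j => (ha i j).2).
  have L j : ga i j n (gpoint n y) * gdiff j u n (gpoint n y) @[n --> U] --> a i j y * pd (glim U u) j y.
    rewrite pd_glim // -(glim_sample UF Uoo y (ap j) (fun z => Ck_continuous (as_ j 0%N) z)).
    by apply: cvgM; apply: cvg_glim => //; exact: gsmooth_sup.
  have LF : gF i n (gpoint n y) @[n --> U] --> F i y.
    rewrite -(glim_sample UF Uoo y (hF i).1 (fun z => Ck_continuous ((hF i).2 0%N) z)).
    by apply: cvg_glim => //; exact: gsmooth_sup.
  apply: glimP => //; rewrite sum_I2.
  rewrite (_ : (fun n => _) = (fun n => ga i 0 n (gpoint n y) * gdiff 0 u n (gpoint n y)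
      + ga i 1 n (gpoint n y) * gdiff 1 u n (gpoint n y) - gF i n (gpoint n y))).
    by apply: cvgB => //; apply: cvgD; exact: L.
  by apply/funext => n; rewrite /H /gflux sum_I2.
have EP i : pd (fun y => \sum_j a i j y * pd (glim U u) j y - F i y) i x = glim U (gdiff i (H i)) x.
  rewrite -pd_glim //; congr (pd _ i x); by apply/funext => y; rewrite EH.
have UP : ProperFilter U := @ultra_proper _ _ UF.
(* Backward and forward differences of the flux differ by the mesh size times a second difference,
   so both tend to the derivative of the limit flux. *)
have C i : gdiffm i (H i) n (gpoint n x) @[n --> U] --> glim U (gdiff i (H i)) x.
  have mb : gsup (gdiffm i (H i)).
    have [M HM] := gsmooth_sup (gsmooth_diff i (Hs i)).
    by exists M => n p; have := HM n (p - gstep n i); rewrite /gdiff subrK.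
  have [M HM] := gsmooth_sup (gsmooth_diff i (gsmooth_diff i (Hs i))).
  rewrite -(@glim_eq_near _ U UF Uoo (gdiffm i (H i)) (gdiff i (H i)) x M).
  - exact: cvg_glim.
  - move=> n; set p := gpoint n x.
    have -> : gdiffm i (H i) n p = gdiff i (H i) n (p - gstep n i) by rewrite /gdiff subrK.
    have := HM n (p - gstep n i).
    have -> : gdiff i (gdiff i (H i)) n (p - gstep n i) =
      n.+1%:R * (gdiff i (H i) n p - gdiff i (H i) n (p - gstep n i)) by rewrite {1}/gdiff subrK.
    by rewrite normrM ger0_norm // distrC.
  - exact: gsmooth_sup (gsmooth_diff i (Hs i)).
rewrite (eq_bigr (fun i => glim U (gdiff i (H i)) x)) => [|i _]; last exact: EP.
rewrite sum_I2.
have CC : (0 : R) @[n --> U] --> glim U (gdiff 0 (H 0)) x + glim U (gdiff 1 (H 1)) x.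
  apply: cvg_trans (cvgD (C 0) (C 1)); apply: near_eq_cvg; apply: nearW => n.
  by have := uE n (gpoint n x); rewrite sum_I2 => E0; rewrite /= -[RHS]E0.
apply: (cvg_unique _ CC); [exact: norm_hausdorff|exact: cvg_cst].
Qed.

End TorusPoisson.

(** * Riemannian geometry in coordinates *)

(* Keeps unification from unfolding distinct derivatives down to limits. *)
Opaque pd.

Section Bilinear.
Context {R : realType}.

(** [inner] at a given matrix: derivatives of the metric can then be used as bilinear forms too. *)
Definition bilin n (M : 'M[R]_n) (v w : 'rV[R]_n) : R := (v *m M *m w^T) 0 0.

Context {n : nat}.
Implicit Types (M : 'M[R]_n) (v w : 'rV[R]_n).

Lemma bilinE M v w : bilin M v w = \sum_i \sum_j v 0 i * M i j * w 0 j.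
Proof.
rewrite /bilin mxE exchange_big /=; apply: eq_bigr => j _.
by rewrite !mxE mulr_suml.
Qed.

Lemma bilinDl M v1 v2 w : bilin M (v1 + v2) w = bilin M v1 w + bilin M v2 w.
Proof. by rewrite /bilin !mulmxDl mxE. Qed.

Lemma bilinDr M v w1 w2 : bilin M v (w1 + w2) = bilin M v w1 + bilin M v w2.
Proof. by rewrite /bilin linearD mulmxDr mxE. Qed.

Lemma bilinZl M c v w : bilin M (c *: v) w = c * bilin M v w.
Proof. by rewrite /bilin -!scalemxAl mxE. Qed.

Lemma bilinZr M c v w : bilin M v (c *: w) = c * bilin M v w.
Proof. by rewrite /bilin linearZ -scalemxAr mxE. Qed.

Lemma bilinNl M v w : bilin M (- v) w = - bilin M v w.
Proof. by rewrite -scaleN1r bilinZl mulN1r. Qed.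

Lemma bilinNr M v w : bilin M v (- w) = - bilin M v w.
Proof. by rewrite -scaleN1r bilinZr mulN1r. Qed.

Lemma bilin0l M w : bilin M 0 w = 0.
Proof. by rewrite /bilin !mul0mx mxE. Qed.

Lemma bilin0r M v : bilin M v 0 = 0.
Proof. by rewrite /bilin trmx0 mulmx0 mxE. Qed.

Lemma bilin0m v w : bilin 0 v w = 0.
Proof. by rewrite /bilin mulmx0 mul0mx mxE. Qed.

Lemma bilin_suml M (I : Type) (r : seq I) (P : pred I) (F : I -> 'rV[R]_n) w :
  bilin M (\sum_(i <- r | P i) F i) w = \sum_(i <- r | P i) bilin M (F i) w.
Proof. by rewrite /bilin !mulmx_suml summxE. Qed.

Lemma bilinDm M M' v w : bilin (M + M') v w = bilin M v w + bilin M' v w.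
Proof. by rewrite /bilin mulmxDr mulmxDl mxE. Qed.

Lemma bilin_mull M (A : 'M[R]_n) v w : bilin (A *m M) v w = bilin M (v *m A) w.
Proof. by rewrite /bilin mulmxA. Qed.

Lemma bilin_mulr M (A : 'M[R]_n) v w : bilin (M *m A^T) v w = bilin M v (w *m A).
Proof. by rewrite /bilin trmx_mul !mulmxA. Qed.

Lemma bilin_tr M v w : bilin M^T v w = bilin M w v.
Proof.
rewrite !bilinE exchange_big; apply: eq_bigr => i _; apply: eq_bigr => j _.
by rewrite mxE; ring.
Qed.

Lemma bilin_delta M i j : bilin M 'e_i 'e_j = M i j.
Proof.
rewrite bilinE (bigD1 i) //= (bigD1 j) //= !mxE !eqxx !mul1r mulr1.
rewrite big1 => [|k kj]; last by rewrite !mxE (negbTE kj) mulr0.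
rewrite addr0 big1 ?addr0 // => k ki; rewrite big1 // => l _.
by rewrite !mxE (negbTE ki) !mul0r.
Qed.

Lemma bilin_sym M v w : M^T = M -> bilin M v w = bilin M w v.
Proof. by move=> Ms; rewrite -bilin_tr Ms. Qed.

Lemma bilin_eq0 M v : (forall w, w != 0 -> 0 < bilin M w w) ->
  (forall w, bilin M v w = 0) -> v = 0.
Proof.
by move=> Mp v0; apply/eqP/negPn/negP => /Mp; rewrite v0 ltxx.
Qed.

Lemma posdef_unit M : (forall w, w != 0 -> 0 < bilin M w w) -> M \in unitmx.
Proof.
move=> Mp; rewrite -row_free_unit; apply/inj_row_free => v vM.
by apply: (bilin_eq0 Mp) => w; rewrite /bilin vM mul0mx mxE.
Qed.

End Bilinear.

Section MatrixCalculus.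
Context {R : realType} {n : nat}.
Implicit Types (x : 'rV[R]_n) (i : 'I_n).

Definition mxpd p q (M : 'rV[R]_n -> 'M[R]_(p, q)) i x : 'M[R]_(p, q) :=
  \matrix_(a, b) pd (fun y => M y a b) i x.

Definition mxder p q (M : 'rV[R]_n -> 'M[R]_(p, q)) i x (D : 'M[R]_(p, q)) :=
  forall a b, is_derive x 'e_i (fun y => M y a b) (D a b).

Lemma mxder_mxpd p q (M : 'rV[R]_n -> 'M[R]_(p, q)) i x D :
  mxder M i x D -> mxpd M i x = D.
Proof. by move=> MD; apply/matrixP => a b; rewrite mxE; exact: pd_val. Qed.

Lemma mxpdP p q (M : 'rV[R]_n -> 'M[R]_(p, q)) i x :
  (forall a b, derivable (fun y => M y a b) x 'e_i) -> mxder M i x (mxpd M i x).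
Proof. by move=> dM a b; rewrite mxE; exact: pdP. Qed.

Lemma is_derive_sumf (I : Type) (r : seq I) (F : I -> 'rV[R]_n -> R) x v (D : I -> R) :
  (forall k, is_derive x v (F k) (D k)) ->
  is_derive x v (fun y => \sum_(k <- r) F k y) (\sum_(k <- r) D k).
Proof.
move=> FD; elim: r => [|k r IH].
  rewrite big_nil (_ : (fun y => _) = cst 0); first exact: is_derive_cst.
  by apply/funext => y; rewrite big_nil.
rewrite big_cons (_ : (fun y => _) = (fun y => F k y + \sum_(l <- r) F l y)); last first.
  by apply/funext => y; rewrite big_cons.
exact: is_deriveDl.
Qed.

Lemma mxderM p q r (M : 'rV[R]_n -> 'M[R]_(p, q)) (N : 'rV[R]_n -> 'M[R]_(q, r)) i x D E :
  mxder M i x D -> mxder N i x E ->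
  mxder (fun y => M y *m N y) i x (D *m N x + M x *m E).
Proof.
move=> MD NE a b; rewrite !mxE -big_split /=.
rewrite (_ : (fun y => _) = (fun y => \sum_k M y a k * N y k b)); last first.
  by apply/funext => y; rewrite mxE.
by apply: is_derive_sumf => k; exact: is_deriveMl.
Qed.

Lemma mxderD p q (M N : 'rV[R]_n -> 'M[R]_(p, q)) i x D E :
  mxder M i x D -> mxder N i x E -> mxder (fun y => M y + N y) i x (D + E).
Proof.
move=> MD NE a b; rewrite mxE (_ : (fun y => _) = (fun y => M y a b + N y a b)).
  exact: is_deriveDl.
by apply/funext => y; rewrite mxE.
Qed.

Lemma mxderZ p q (f : 'rV[R]_n -> R) (M : 'rV[R]_n -> 'M[R]_(p, q)) i x d D :
  is_derive x 'e_i f d -> mxder M i x D ->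
  mxder (fun y => f y *: M y) i x (d *: M x + f x *: D).
Proof.
move=> fd MD a b; rewrite !mxE (_ : (fun y => _) = (fun y => f y * M y a b)).
  exact: is_deriveMl.
by apply/funext => y; rewrite mxE.
Qed.

Lemma mxderT p q (M : 'rV[R]_n -> 'M[R]_(p, q)) i x D :
  mxder M i x D -> mxder (fun y => (M y)^T) i x D^T.
Proof.
move=> MD a b; rewrite mxE (_ : (fun y => _) = (fun y => M y b a)); first exact: MD.
by apply/funext => y; rewrite mxE.
Qed.

Lemma mxder_cst p q (M : 'M[R]_(p, q)) i x : mxder (fun=> M) i x 0.
Proof. by move=> a b; rewrite mxE; exact: is_derive_cst. Qed.

Lemma is_derive_bilin m (M : 'rV[R]_n -> 'M[R]_m) (v w : 'rV[R]_n -> 'rV[R]_m) i x D dv dw :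
  mxder M i x D -> mxder v i x dv -> mxder w i x dw ->
  is_derive x 'e_i (fun y => bilin (M y) (v y) (w y))
    (bilin D (v x) (w x) + bilin (M x) dv (w x) + bilin (M x) (v x) dw).
Proof.
move=> MD vd wd.
have := mxderM (mxderM vd MD) (mxderT wd) 0 0.
rewrite mulmxDl [in X in is_derive _ _ _ X]mxE [in X in is_derive _ _ _ X]mxE.
by rewrite [X in X + _]addrC.
Qed.

End MatrixCalculus.

(** * Christoffel symbols and the Koszul formula *)

Section Christoffel.
Context {R : realType} {n : nat}.
Implicit Types (g : 'rV[R]_n -> 'M[R]_n) (x v w z : 'rV[R]_n) (i j k : 'I_n).

(* [w *m chr g i x] is the row of the Gamma^k_ij w^j. *)
Definition chr g i x : 'M[R]_n := \matrix_(j, k) christoffel g k i j x.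

Lemma christoffel_formE g x v w :
  christoffel_form g x v w = \sum_i v 0 i *: (w *m chr g i x).
Proof.
apply/rowP => k; rewrite mxE summxE; apply: eq_bigr => i _.
rewrite !mxE mulr_sumr; apply: eq_bigr => j _; rewrite !mxE; ring.
Qed.

Lemma christoffel_form_delta g x i w : christoffel_form g x 'e_i w = w *m chr g i x.
Proof.
rewrite christoffel_formE (bigD1 i) //= mxE !eqxx scale1r big1 ?addr0 // => j ji.
by rewrite mxE (negbTE ji) scale0r.
Qed.

Section Metric.
Variable g : 'rV[R]_n -> 'M[R]_n.
Hypothesis gm : is_metric g.

Lemma is_metric_sym x : (g x)^T = g x. Proof. by have [] := gm x. Qed.

Lemma is_metric_symE x i j : g x i j = g x j i.
Proof. by rewrite -[in LHS]is_metric_sym mxE. Qed.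

Lemma is_metric_pos x v : v != 0 -> 0 < bilin (g x) v v.
Proof. by have [_] := gm x; exact. Qed.

Lemma is_metric_unit x : g x \in unitmx.
Proof. by apply: posdef_unit; exact: is_metric_pos. Qed.

Lemma invmx_metric_sym x i j : invmx (g x) i j = invmx (g x) j i.
Proof. by rewrite -[in LHS](is_metric_sym x) -trmx_inv mxE. Qed.

Lemma mxpd_metric_sym i x : (mxpd g i x)^T = mxpd g i x.
Proof.
apply/matrixP => a b; rewrite !mxE; congr (pd _ i x).
by apply/funext => y; rewrite is_metric_symE.
Qed.

(** Lowering the upper index cancels the inverse metric and leaves the Christoffel symbols of the
    first kind. *)
Lemma chr_mul i x j l : (chr g i x *m g x) j l =
  2^-1 * (mxpd g i x j l + mxpd g j x i l - mxpd g l x i j).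
Proof.
pose L i := \matrix_(j, l) (2^-1 * (mxpd g i x j l + mxpd g j x i l - mxpd g l x i j)).
have -> : chr g i x = L i *m invmx (g x).
  apply/matrixP => a b; rewrite !mxE /christoffel mulr_sumr; apply: eq_bigr => c _.
  by rewrite !mxE mulrCA mulrC invmx_metric_sym.
by rewrite mulmxKV ?is_metric_unit // mxE.
Qed.

Lemma chr_sym i j x : ('e_i : 'rV[R]_n) *m chr g j x = 'e_j *m chr g i x.
Proof.
apply/rowP => k; rewrite -!rowE !mxE /christoffel; congr (_ * _).
apply: eq_bigr => l _; have gs : (fun y => g y i j) = (fun y => g y j i) by apply/funext => y; exact: is_metric_symE.
by rewrite gs [X in X - _]addrC.
Qed.

Lemma metric_compat i x : mxpd g i x = chr g i x *m g x + g x *m (chr g i x)^T.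
Proof.
apply/matrixP => a b; rewrite [RHS]mxE.
have -> : (g x *m (chr g i x)^T) a b = (chr g i x *m g x) b a.
  by rewrite -[in LHS](is_metric_sym x) -trmx_mul mxE.
rewrite !chr_mul.
have E : mxpd g i x b a = mxpd g i x a b by rewrite -[in LHS]mxpd_metric_sym mxE.
rewrite E.
have half (X Y Z : R) : X = 2^-1 * (X + Y - Z) + 2^-1 * (X + Z - Y) by field.
exact: half.
Qed.

Definition metric_deriv u (p v w : 'rV[R]_n) : R := \sum_a p 0 a * bilin (mxpd g a u) v w.

(** Koszul formula for constant fields. It replaces Christoffel symbols by derivatives of the
    metric, so that the inverse of the metric of the tangent bundle is never computed. *)
Lemma christoffel_form_lower u v w z :
  bilin (g u) (christoffel_form g u v w) z =
  2^-1 * (metric_deriv u v w z + metric_deriv u w v z - metric_deriv u z v w).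
Proof.
rewrite christoffel_formE bilin_suml.
transitivity (\sum_a \sum_b \sum_c v 0 a * w 0 b * z 0 c *
   (2^-1 * (mxpd g a u b c + mxpd g b u a c - mxpd g c u a b))).
  apply: eq_bigr => a _; rewrite bilinZl -bilin_mull bilinE mulr_sumr.
  apply: eq_bigr => b _; rewrite mulr_sumr; apply: eq_bigr => c _.
  rewrite chr_mul; ring.
have E1 : metric_deriv u v w z = \sum_a \sum_b \sum_c v 0 a * w 0 b * z 0 c * mxpd g a u b c.
  apply: eq_bigr => a _; rewrite bilinE mulr_sumr; apply: eq_bigr => b _.
  by rewrite mulr_sumr; apply: eq_bigr => c _; ring.
have E2 : metric_deriv u w v z = \sum_a \sum_b \sum_c v 0 a * w 0 b * z 0 c * mxpd g b u a c.
  rewrite exchange_big; apply: eq_bigr => b _; rewrite bilinE mulr_sumr; apply: eq_bigr => a _.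
  by rewrite mulr_sumr; apply: eq_bigr => c _; ring.
have E3 : metric_deriv u z v w = \sum_a \sum_b \sum_c v 0 a * w 0 b * z 0 c * mxpd g c u a b.
  rewrite (eq_bigr (fun a => \sum_c \sum_b v 0 a * w 0 b * z 0 c * mxpd g c u a b)).
    rewrite exchange_big; apply: eq_bigr => c _; rewrite bilinE mulr_sumr; apply: eq_bigr => a _.
    by rewrite mulr_sumr; apply: eq_bigr => b _; ring.
  by move=> a _; rewrite exchange_big.
rewrite E1 E2 E3 -sumrN -!big_split /= mulr_sumr; apply: eq_bigr => a _.
rewrite -sumrN -!big_split /= mulr_sumr; apply: eq_bigr => b _.
rewrite -sumrN -!big_split /= mulr_sumr; apply: eq_bigr => c _; ring.
Qed.

End Metric.

End Christoffel.

(** * The tension field tested against a vector *)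

Section TensionLower.
Context {R : realType} {m n : nat}.
Variables (g : 'rV[R]_m -> 'M[R]_m) (h : 'rV[R]_n -> 'M[R]_n).
Variable phi : 'rV[R]_m -> 'rV[R]_n.
Hypothesis hm : is_metric h.

Lemma nabla_dE i j x : nabla_d g h phi i j x =
  mxpd (mxpd phi j) i x - \sum_k christoffel g k i j x *: mxpd phi k x
  + christoffel_form h (phi x) (mxpd phi i x) (mxpd phi j x).
Proof.
apply/rowP => c; rewrite !mxE; congr (_ + _).
  congr (_ - _); last by rewrite summxE; apply: eq_bigr => k _; rewrite !mxE.
  by congr (pd _ i x); apply/funext => y; rewrite mxE.
by apply: eq_bigr => a _; apply: eq_bigr => b _; rewrite !mxE.
Qed.

Lemma tension_lower x z : bilin (h (phi x)) (tension g h phi x) z =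
  \sum_i \sum_j invmx (g x) i j *
    (bilin (h (phi x)) (mxpd (mxpd phi j) i x) z
     - \sum_k christoffel g k i j x * bilin (h (phi x)) (mxpd phi k x) z
     + 2^-1 * (metric_deriv h (phi x) (mxpd phi i x) (mxpd phi j x) z
             + metric_deriv h (phi x) (mxpd phi j x) (mxpd phi i x) z
             - metric_deriv h (phi x) z (mxpd phi i x) (mxpd phi j x))).
Proof.
rewrite /tension bilin_suml; apply: eq_bigr => i _.
rewrite bilin_suml; apply: eq_bigr => j _; rewrite bilinZl; congr (_ * _).
rewrite nabla_dE bilinDl christoffel_form_lower // bilinDl bilinNl bilin_suml.
by congr (_ - _ + _); apply: eq_bigr => k _; rewrite bilinZl.
Qed.

End TensionLower.

(** * Regularity in product coordinates and of matrix-valued functions *)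

Section CkCoordinates.
Context {R : realType}.

Lemma lsubmx_continuous n m : continuous (fun u : 'rV[R]_(n + m) => lsubmx u).
Proof.
suff C (u : 'rV[R]_(n + m)) : lsubmx y @[y --> u] --> lsubmx u by exact: C.
have E (v : 'rV[R]_(n + m)) : lsubmx v = \sum_i v 0 (lshift m i) *: 'e_i.
  by rewrite [LHS]row_sum_delta; apply: eq_bigr => i _; rewrite mxE.
pose G (r : seq 'I_n) (y : 'rV[R]_(n + m)) : 'rV[R]_n := \sum_(i <- r) y 0 (lshift m i) *: 'e_i.
have FF : Filter (nbhs u) := @nbhs_filter _ u.
have S (r : seq 'I_n) : G r y @[y --> u] --> G r u.
  elim: r => [|i r IH].
    have -> : G [::] = fun=> 0 by apply/funext => y; rewrite /G big_nil.
    exact: cvg_cst.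
  have -> : G (i :: r) = (fun y => y 0 (lshift m i) *: 'e_i + G r y).
    by apply/funext => y; rewrite /G big_cons.
  by apply: cvgD => //; apply: cvgZr_tmp; exact: coord_continuous.
have -> : (fun y : 'rV[R]_(n + m) => lsubmx y) = G (index_enum 'I_n).
  by apply/funext => y; rewrite E.
rewrite E; exact: S.
Qed.

Lemma lsubmxD n m (u v : 'rV[R]_(n + m)) : lsubmx (u + v) = lsubmx u + lsubmx v.
Proof. exact: raddfD. Qed.

Lemma is_derive_lshift n m (f : 'rV[R]_n -> 'rV[R]_m -> R) (k : 'I_n) (u : 'rV[R]_(n + m)) d :
  is_derive (lsubmx u) 'e_k (fun x => f x (rsubmx u)) d ->
  is_derive u 'e_(lshift m k) (fun w => f (lsubmx w) (rsubmx w)) d.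
Proof.
move=> /is_derive_line0 H; apply/is_derive_line0.
have El : lsubmx ('e_(lshift m k) : 'rV[R]_(n + m)) = 'e_k.
  by apply/rowP => i; rewrite !mxE eq_lshift.
have Er : rsubmx ('e_(lshift m k) : 'rV[R]_(n + m)) = 0.
  by apply/rowP => i; rewrite !mxE eq_rlshift.
rewrite (_ : (fun s => _) = (fun s => f (lsubmx u + s *: 'e_k) (rsubmx u))) //.
by apply/funext => s; rewrite !linearD !linearZ /= El Er scaler0 addr0.
Qed.

Lemma is_derive_rshift n m (f : 'rV[R]_n -> 'rV[R]_m -> R) (k : 'I_m) (u : 'rV[R]_(n + m)) d :
  is_derive (rsubmx u) 'e_k (f (lsubmx u)) d ->
  is_derive u 'e_(rshift n k) (fun w => f (lsubmx w) (rsubmx w)) d.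
Proof.
move=> /is_derive_line0 H; apply/is_derive_line0.
have El : lsubmx ('e_(rshift n k) : 'rV[R]_(n + m)) = 0.
  by apply/rowP => i; rewrite !mxE eq_lrshift.
have Er : rsubmx ('e_(rshift n k) : 'rV[R]_(n + m)) = 'e_k.
  by apply/rowP => i; rewrite !mxE eq_rshift.
rewrite (_ : (fun s => _) = (fun s => f (lsubmx u) (rsubmx u + s *: 'e_k))) //.
by apply/funext => s; rewrite !linearD !linearZ /= El Er scaler0 addr0.
Qed.

Lemma Ck_lsubmx n m k (f : 'rV[R]_n -> R) :
  Ck k f -> Ck k (fun u : 'rV[R]_(n + m) => f (lsubmx u)).
Proof.
have fc (h : 'rV[R]_n -> R) : continuous h -> continuous (fun u : 'rV[R]_(n + m) => h (lsubmx u)).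
  move=> hc u; apply: (@continuous_comp _ _ _ (fun u : 'rV[R]_(n + m) => lsubmx u) h).
    exact: lsubmx_continuous.
  exact: hc.
elim: k f => [|k IH] f fk; first by split=> //; apply: fc; exact: fk.1.
apply: (@Ck_intro R (n + m) k _ (fun (a : 'I_(n + m)) (u : 'rV[R]_(n + m)) => match fintype.split a with
  | inl i => pd f i (lsubmx u) | inr _ => 0 end)).
- by apply: fc; exact: fk.1.
- move=> a u; rewrite -[a]splitK; case: (fintype.split a) => i; rewrite unsplitK /=.
    apply: (is_derive_lshift (f := fun x _ => f x)); exact: Ck_is_derive fk.
  by apply: (is_derive_rshift (f := fun x _ => f x)); exact: is_derive_cst.
- by move=> a; case: (fintype.split a) => i; [apply: IH; exact: Ck_pd|exact: Ck_cst].
Qed.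

Lemma is_derive_coord n (a i : 'I_n) (x : 'rV[R]_n) :
  is_derive x 'e_i (fun u : 'rV[R]_n => u 0 a) ((a == i)%:R : R).
Proof.
apply/is_derive_line0; set c : R := (a == i)%:R.
have D1 : is_derive (0 : R) (1 : R) (fun s : R => c *: s) (c *: 1) := is_deriveZ _ (is_derive_id _ _).
have D : is_derive (0 : R) (1 : R) (fun s : R => x 0 a + c *: s) (0 + c *: 1).
  by apply: is_deriveD.
rewrite add0r [c *: 1]mulr1 in D.
rewrite (_ : (fun s => _) = (fun s : R => x 0 a + c *: s)) //.
by apply/funext => s; rewrite !mxE eqxx /= [c *: s]mulrC.
Qed.

Lemma Ck_coord n k (a : 'I_n) : Ck k (fun u : 'rV[R]_n => u 0 a).
Proof.
case: k => [|k]; first by split=> // u; exact: coord_continuous.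
apply: (@Ck_intro _ _ _ _ (fun i _ => (a == i)%:R)).
- by move=> u; exact: coord_continuous.
- by move=> i u; exact: is_derive_coord.
- by move=> i; exact: Ck_cst.
Qed.

Definition mxCk n p q k (M : 'rV[R]_n -> 'M[R]_(p, q)) := forall a b, Ck k (fun y => M y a b).

Lemma mxCkM n p q r k (M : 'rV[R]_n -> 'M[R]_(p, q)) (N : 'rV[R]_n -> 'M[R]_(q, r)) :
  mxCk k M -> mxCk k N -> mxCk k (fun y => M y *m N y).
Proof.
move=> Mk Nk a b; rewrite (_ : (fun y => _) = (fun y => \sum_c M y a c * N y c b)).
  by apply: Ck_sum => c _; exact: CkM.
by apply/funext => y; rewrite mxE.
Qed.

Lemma mxCkD n p q k (M N : 'rV[R]_n -> 'M[R]_(p, q)) :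
  mxCk k M -> mxCk k N -> mxCk k (fun y => M y + N y).
Proof.
move=> Mk Nk a b; rewrite (_ : (fun y => _) = (fun y => M y a b + N y a b)).
  exact: CkD.
by apply/funext => y; rewrite mxE.
Qed.

Lemma mxCkZ n p q k (f : 'rV[R]_n -> R) (M : 'rV[R]_n -> 'M[R]_(p, q)) :
  Ck k f -> mxCk k M -> mxCk k (fun y => f y *: M y).
Proof.
move=> fk Mk a b; rewrite (_ : (fun y => _) = (fun y => f y * M y a b)).
  exact: CkM.
by apply/funext => y; rewrite mxE.
Qed.

Lemma mxCkT n p q k (M : 'rV[R]_n -> 'M[R]_(p, q)) :
  mxCk k M -> mxCk k (fun y => (M y)^T).
Proof.
move=> Mk a b; rewrite (_ : (fun y => _) = (fun y => M y b a)); first exact: Mk.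
by apply/funext => y; rewrite mxE.
Qed.

Lemma mxCk_cst n p q k (M : 'M[R]_(p, q)) : mxCk k (fun _ : 'rV[R]_n => M).
Proof. by move=> a b; exact: Ck_cst. Qed.

Lemma mxCk_block n p q r s k (M1 : 'rV[R]_n -> 'M[R]_(p, q)) (M2 : 'rV[R]_n -> 'M[R]_(p, r))
  (M3 : 'rV[R]_n -> 'M[R]_(s, q)) (M4 : 'rV[R]_n -> 'M[R]_(s, r)) :
  mxCk k M1 -> mxCk k M2 -> mxCk k M3 -> mxCk k M4 ->
  mxCk k (fun y => block_mx (M1 y) (M2 y) (M3 y) (M4 y)).
Proof.
move=> K1 K2 K3 K4 a b.
rewrite -[a]splitK -[b]splitK; case: (fintype.split a) => a'; case: (fintype.split b) => b' /=.
- rewrite (_ : (fun y => _) = (fun y => M1 y a' b')); first exact: K1.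
  by apply/funext => y; rewrite block_mxEul.
- rewrite (_ : (fun y => _) = (fun y => M2 y a' b')); first exact: K2.
  by apply/funext => y; rewrite block_mxEur.
- rewrite (_ : (fun y => _) = (fun y => M3 y a' b')); first exact: K3.
  by apply/funext => y; rewrite block_mxEdl.
- rewrite (_ : (fun y => _) = (fun y => M4 y a' b')); first exact: K4.
  by apply/funext => y; rewrite block_mxEdr.
Qed.

Lemma mxCk_pd n p q k (M : 'rV[R]_n -> 'M[R]_(p, q)) i : mxCk k.+1 M -> mxCk k (mxpd M i).
Proof.
move=> Mk a b; rewrite (_ : (fun y => _) = pd (fun y => M y a b) i).
  exact: Ck_pd.
by apply/funext => y; rewrite mxE.
Qed.

Lemma mxCk_lsubmx n m p q k (M : 'rV[R]_n -> 'M[R]_(p, q)) : mxCk k M ->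
  mxCk k (fun u : 'rV[R]_(n + m) => M (lsubmx u)).
Proof. by move=> Mk a b; apply: (@Ck_lsubmx _ _ _ (fun x => M x a b)). Qed.

Lemma mxCk_rsubmx n m k : mxCk k (fun u : 'rV[R]_(n + m) => rsubmx u).
Proof.
move=> a b; rewrite (_ : (fun y : 'rV[R]_(n + m) => rsubmx y a b) = (fun y => y 0 (rshift n b))); first exact: Ck_coord.
by apply/funext => y; rewrite mxE ord1.
Qed.

Lemma mxCk_mxder n p q k (M : 'rV[R]_n -> 'M[R]_(p, q)) i x : mxCk k.+1 M ->
  mxder M i x (mxpd M i x).
Proof. by move=> Mk; apply: mxpdP => a b; exact: Ck_derivable (Mk a b). Qed.

Lemma Ck_bilin n m k (M : 'rV[R]_n -> 'M[R]_m) (v w : 'rV[R]_n -> 'rV[R]_m) :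
  mxCk k M -> mxCk k v -> mxCk k w -> Ck k (fun y => bilin (M y) (v y) (w y)).
Proof. by move=> Mk vk wk; exact: (mxCkM (mxCkM vk Mk) (mxCkT wk) 0 0). Qed.

End CkCoordinates.

(** * Kaluza-Klein metrics and the tension of a unit field *)

Section KaluzaKleinMetric.
Context {R : realType} {n : nat}.
Variables (g : 'rV[R]_n -> 'M[R]_n) (B : R -> R).
Implicit Types (x e v w : 'rV[R]_n) (u z : 'rV[R]_(n + n)).

Definition nonlinear_connection x e : 'M[R]_n :=
  \matrix_(i, k) christoffel_form g x 'e_i e 0 k.

Definition vertical_frame u : 'M[R]_(n + n) :=
  block_mx 1%:M (nonlinear_connection (lsubmx u) (rsubmx u)) 0 1%:M.

(** Right multiplication by [vertical_frame u] sends a tangent vector to its horizontal and vertical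
    parts, so this is the Kaluza-Klein metric with A = 1 and C = 0. As a matrix product it is
    visibly symmetric and as regular as its factors. *)
Definition kk_metric u : 'M[R]_(n + n) :=
  vertical_frame u *m
  block_mx (g (lsubmx u)) 0 0
    (B (bilin (g (lsubmx u)) (rsubmx u) (rsubmx u)) *: g (lsubmx u)) *m
  (vertical_frame u)^T.

(* [w *m cmx g x v] is the row of the Gamma^k_ij v^i w^j. *)
Definition cmx x v : 'M[R]_n := \sum_i v 0 i *: chr g i x.

Lemma christoffel_form_cmx x v w : christoffel_form g x v w = w *m cmx x v.
Proof.
rewrite christoffel_formE /cmx mulmx_sumr; apply: eq_bigr => i _.
by rewrite scalemxAr.
Qed.

Lemma cmx_delta x i : cmx x 'e_i = chr g i x.
Proof.
rewrite /cmx (bigD1 i) //= mxE !eqxx scale1r big1 ?addr0 // => j ji.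
by rewrite mxE (negbTE ji) scale0r.
Qed.

Lemma cmx0 x : cmx x 0 = 0.
Proof. by rewrite /cmx big1 // => i _; rewrite mxE scale0r. Qed.

Lemma nonlinear_connectionE x e v :
  v *m nonlinear_connection x e = e *m cmx x v.
Proof.
rewrite -christoffel_form_cmx christoffel_formE mulmx_sum_row.
apply: eq_bigr => i _; congr (_ *: _); rewrite -christoffel_form_delta.
by apply/rowP => k; rewrite 2![LHS]mxE.
Qed.

Lemma kk_bilin u (v w : 'rV[R]_(n + n)) : bilin (kk_metric u) v w =
  bilin (g (lsubmx u)) (lsubmx v) (lsubmx w) +
  B (bilin (g (lsubmx u)) (rsubmx u) (rsubmx u)) *
  bilin (g (lsubmx u)) (rsubmx v + rsubmx u *m cmx (lsubmx u) (lsubmx v))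
    (rsubmx w + rsubmx u *m cmx (lsubmx u) (lsubmx w)).
Proof.
rewrite /kk_metric bilin_mulr bilin_mull.
have E z : z *m vertical_frame u =
    row_mx (lsubmx z) (rsubmx z + rsubmx u *m cmx (lsubmx u) (lsubmx z)).
  rewrite -[in LHS](hsubmxK z) /vertical_frame mul_row_block !mulmx1 mulmx0 addr0.
  by rewrite nonlinear_connectionE addrC.
rewrite !E /bilin mul_row_block !mulmx0 addr0 add0r tr_row_mx mul_row_col mxE.
by congr (_ + _); rewrite -scalemxAr -scalemxAl mxE.
Qed.

Hypothesis gm : is_metric g.
Hypothesis Bpos : forall t, 0 <= t -> 0 < B t.

Lemma metric_ge0 x v : 0 <= bilin (g x) v v.
Proof.
have [->|v0] := eqVneq v 0; first by rewrite bilin0l.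
by apply: ltW; exact: is_metric_pos.
Qed.

Lemma kk_is_metric : is_metric kk_metric.
Proof.
move=> u; split.
  rewrite /kk_metric !trmx_mul trmxK tr_block_mx !trmx0 linearZ /=.
  by rewrite is_metric_sym // mulmxA.
move=> v v0; rewrite -[inner _ _ _ _]/(bilin (kk_metric u) v v) kk_bilin.
have Bp := Bpos (metric_ge0 (lsubmx u) (rsubmx u)).
have [l0|l0] := eqVneq (lsubmx v) 0; last first.
  by rewrite ltr_pwDl ?is_metric_pos // mulr_ge0 ?metric_ge0 // ltW.
rewrite l0 bilin0l add0r cmx0 mulmx0 addr0 mulr_gt0 // is_metric_pos //.
apply: contraNneq v0 => r0; by rewrite -(hsubmxK v) l0 r0 row_mx0.
Qed.

Hypothesis gs : forall k, mxCk k g.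
Hypothesis chrs : forall k i, mxCk k (chr g i).
Hypothesis BCk : forall m k (f : 'rV[R]_m -> R), (forall y, 0 <= f y) -> Ck k f -> Ck k (fun y => B (f y)).

Lemma mxCk_cmx k v : mxCk k (fun x => cmx x v).
Proof.
move=> a b; rewrite (_ : (fun y => _) = (fun y => \sum_i v 0 i * chr g i y a b)).
  by apply: Ck_sum => i _; apply: CkZ; exact: chrs.
by apply/funext => y; rewrite /cmx summxE; apply: eq_bigr => i _; rewrite mxE.
Qed.

Lemma kk_Ck k : mxCk k kk_metric.
Proof.
have Gk : mxCk k (fun u : 'rV[R]_(n + n) => g (lsubmx u)) by exact: mxCk_lsubmx.
have rk : Ck k (fun u : 'rV[R]_(n + n) => B (bilin (g (lsubmx u)) (rsubmx u) (rsubmx u))).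
  apply: BCk => [y|]; first exact: metric_ge0.
  by apply: Ck_bilin => //; exact: mxCk_rsubmx.
have Nk : mxCk k (fun u : 'rV[R]_(n + n) => nonlinear_connection (lsubmx u) (rsubmx u)).
  move=> a b.
  have := mxCkM (@mxCk_rsubmx R n n k) (@mxCk_lsubmx R n n n n k _ (@mxCk_cmx k 'e_a)) 0 b.
  congr Ck; apply/funext => u; rewrite -nonlinear_connectionE -rowE.
  by rewrite [RHS]mxE mxE mxE.
have Zk : mxCk k vertical_frame by apply: mxCk_block => //; exact: mxCk_cst.
apply: mxCkM; last exact: mxCkT.
apply: mxCkM => //; apply: mxCk_block => //; try exact: mxCk_cst.
exact: mxCkZ.
Qed.

Variable B' : R -> R.
Hypothesis Bder : forall t : R, 0 <= t -> is_derive t 1 B (B' t).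

(** [V] and [W] are the vertical parts of the constant vectors [v] and [w]; they vary with the base
    point through [cmx], which produces the last two terms. *)
Definition kk_dx u k (v w : 'rV[R]_(n + n)) : R :=
  let x := lsubmx u in let e := rsubmx u in
  let V := rsubmx v + e *m cmx x (lsubmx v) in let W := rsubmx w + e *m cmx x (lsubmx w) in
  let r := bilin (g x) e e in
  bilin (mxpd g k x) (lsubmx v) (lsubmx w)
  + B' r * bilin (mxpd g k x) e e * bilin (g x) V W
  + B r * (bilin (mxpd g k x) V W
           + bilin (g x) (e *m mxpd (fun y => cmx y (lsubmx v)) k x) W
           + bilin (g x) V (e *m mxpd (fun y => cmx y (lsubmx w)) k x)).

Definition kk_de u (q : 'rV[R]_n) (v w : 'rV[R]_(n + n)) : R :=
  let x := lsubmx u in let e := rsubmx u in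
  let V := rsubmx v + e *m cmx x (lsubmx v) in let W := rsubmx w + e *m cmx x (lsubmx w) in
  let r := bilin (g x) e e in
  B' r * (2 * bilin (g x) e q) * bilin (g x) V W
  + B r * (bilin (g x) (q *m cmx x (lsubmx v)) W + bilin (g x) V (q *m cmx x (lsubmx w))).

Let mgx k x : mxder g k x (mxpd g k x). Proof. exact: mxCk_mxder (gs 1%N). Qed.

Lemma is_derive_kk_x u k (v w : 'rV[R]_(n + n)) :
  is_derive u 'e_(lshift n k) (fun z => bilin (kk_metric z) v w) (kk_dx u k v w).
Proof.
pose F x e := bilin (g x) (lsubmx v) (lsubmx w) + B (bilin (g x) e e) *
  bilin (g x) (rsubmx v + e *m cmx x (lsubmx v)) (rsubmx w + e *m cmx x (lsubmx w)).
rewrite (_ : (fun z => _) = (fun z => F (lsubmx z) (rsubmx z))); last first.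
  by apply/funext => z; rewrite kk_bilin.
apply: is_derive_lshift; rewrite /F /kk_dx.
set x := lsubmx u; set e := rsubmx u.
have cc v0 := @mxder_cst R n 1 n v0 k x.
have cm v0 : mxder (fun y => cmx y v0) k x (mxpd (fun y => cmx y v0) k x) := mxCk_mxder k x (@mxCk_cmx 1 v0).
have V z0 : mxder (fun y => rsubmx z0 + e *m cmx y (lsubmx z0)) k x (e *m mxpd (fun y => cmx y (lsubmx z0)) k x).
  have := mxderD (cc (rsubmx z0)) (mxderM (cc e) (cm (lsubmx z0))).
  by rewrite add0r mul0mx add0r.
have D1 := is_derive_bilin (mgx k x) (cc (lsubmx v)) (cc (lsubmx w)).
have D2 := is_derive_bilin (mgx k x) (V v) (V w).
have D3 := is_derive_bilin (mgx k x) (cc e) (cc e).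
have D4 := @is_derive_comp_real _ _ B (fun y => bilin (g y) e e) x 'e_k _ _ (Bder (metric_ge0 x e)) D3.
have := is_deriveDl D1 (is_deriveMl D4 D2).
rewrite !bilin0l !bilin0r !addr0; congr is_derive.
by rewrite addrA.
Qed.

Lemma is_derive_kk_e u k (v w : 'rV[R]_(n + n)) :
  is_derive u 'e_(rshift n k) (fun z => bilin (kk_metric z) v w) (kk_de u 'e_k v w).
Proof.
pose F x e := bilin (g x) (lsubmx v) (lsubmx w) + B (bilin (g x) e e) *
  bilin (g x) (rsubmx v + e *m cmx x (lsubmx v)) (rsubmx w + e *m cmx x (lsubmx w)).
rewrite (_ : (fun z => _) = (fun z => F (lsubmx z) (rsubmx z))); last first.
  by apply/funext => z; rewrite kk_bilin.
apply: is_derive_rshift; rewrite /F /kk_de.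
set x := lsubmx u; set e := rsubmx u.
have cc v0 := @mxder_cst R n 1 n v0 k e.
have cn (M : 'M[R]_n) := @mxder_cst R n n n M k e.
have idd : mxder (fun y => y) k e 'e_k.
  move=> a b; rewrite ord1 !mxE eqxx /=; have := is_derive_coord b k e.
  by rewrite eq_sym.
have V z0 : mxder (fun y => rsubmx z0 + y *m cmx x (lsubmx z0)) k e ('e_k *m cmx x (lsubmx z0)).
  have := mxderD (cc (rsubmx z0)) (mxderM idd (cn (cmx x (lsubmx z0)))).
  by rewrite add0r mulmx0 addr0.
have D1 := is_derive_bilin (cn (g x)) (cc (lsubmx v)) (cc (lsubmx w)).
have D2 := is_derive_bilin (cn (g x)) (V v) (V w).
have D3 := is_derive_bilin (cn (g x)) idd idd.
have D4 := @is_derive_comp_real _ _ B (fun y => bilin (g x) y y) e 'e_k _ _ (Bder (metric_ge0 x e)) D3.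
have := is_deriveDl D1 (is_deriveMl D4 D2).
rewrite !bilin0m !bilin0l !bilin0r !add0r; congr is_derive.
rewrite (bilin_sym 'e_k e (is_metric_sym gm x)) mulr2n mulrDl mul1r; ring.
Qed.

Lemma kk_de_linear u c q1 q2 (v w : 'rV[R]_(n + n)) :
  kk_de u (c *: q1 + q2) v w = c * kk_de u q1 v w + kk_de u q2 v w.
Proof.
rewrite /kk_de !mulmxDl -!scalemxAl !bilinDr !bilinDl !bilinZr !bilinZl; ring.
Qed.

Lemma kk_de_sum u q (v w : 'rV[R]_(n + n)) :
  kk_de u q v w = \sum_k q 0 k * kk_de u 'e_k v w.
Proof.
have Z0 : kk_de u 0 v w = 0.
  by have := kk_de_linear u (-1) 0 0 v w; rewrite scaleN1r oppr0 addr0; lra.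
rewrite {1}(row_sum_delta q).
elim: (index_enum _) => [|k r IH]; first by rewrite !big_nil.
by rewrite !big_cons kk_de_linear IH.
Qed.

Lemma kk_metric_deriv u p (v w : 'rV[R]_(n + n)) : metric_deriv kk_metric u p v w =
  \sum_k lsubmx p 0 k * kk_dx u k v w + kk_de u (rsubmx p) v w.
Proof.
have E a : bilin (mxpd kk_metric a u) v w = pd (fun z => bilin (kk_metric z) v w) a u.
  have := is_derive_bilin (mxCk_mxder a u (kk_Ck 1)) (mxder_cst v a u) (mxder_cst w a u).
  by rewrite bilin0l bilin0r !addr0 => /pd_val.
rewrite /metric_deriv big_split_ord /= kk_de_sum; congr (_ + _); apply: eq_bigr => k _.
  by rewrite E (pd_val (is_derive_kk_x u k v w)) mxE.
by rewrite E (pd_val (is_derive_kk_e u k v w)) mxE.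
Qed.

End KaluzaKleinMetric.

Lemma mxpd_row_mx (R : realType) n p q (M : 'rV[R]_n -> 'rV[R]_p) (N : 'rV[R]_n -> 'rV[R]_q) i x :
  mxpd (fun y => row_mx (M y) (N y)) i x = row_mx (mxpd M i x) (mxpd N i x).
Proof.
apply/rowP => a; rewrite mxE -[a]splitK; case: (fintype.split a) => b /=.
  by rewrite row_mxEl mxE; congr (pd _ i x); apply/funext => y; rewrite row_mxEl.
by rewrite row_mxEr mxE; congr (pd _ i x); apply/funext => y; rewrite row_mxEr.
Qed.

Lemma mxpd_id (R : realType) n i x : mxpd (fun y : 'rV[R]_n => y) i x = 'e_i.
Proof.
apply/rowP => a; rewrite !mxE eqxx /=; apply: pd_val; have := is_derive_coord a i x.
by [].
Qed.

Lemma mxpd_cst (R : realType) n p q (M : 'M[R]_(p, q)) i (x : 'rV[R]_n) : mxpd (fun=> M) i x = 0.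
Proof. by apply: mxder_mxpd; exact: mxder_cst. Qed.

(** The two orders of covariant differentiation are subtracted: the common second derivative [d] and
    the terms in [s] cancel. The identity is isolated for bare vectors so that [ring] meets only
    variables. *)
Lemma curvature_identity (R : realType) n (k1 k2 a0 a1 : R)
  (s nu d s01 s10 d0 d1 n0 n1 : 'rV[R]_n) :
  d + (a0 *: n1 - s01) + d1 = k1 *: nu + a1 *: (- a0 *: s - n0) ->
  d + (a1 *: n0 - s10) + d0 = k2 *: nu + a0 *: (- a1 *: s - n1) ->
  d1 - d0 + s10 - s01 = (k1 - k2) *: nu.
Proof.
move=> /rowP E1 /rowP E2; apply/rowP => k.
have := E1 k; have := E2 k; rewrite !mxE => H2 H1.
apply/eqP; rewrite -subr_eq0; apply/eqP.
move/eqP: H1; rewrite -subr_eq0 => /eqP H1; move/eqP: H2; rewrite -subr_eq0 => /eqP H2.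
rewrite -[RHS](subrr 0) -{1}H1 -H2; ring.
Qed.

Lemma mxpd_comm (R : realType) n p q (M : 'rV[R]_n -> 'M[R]_(p, q)) i j x :
  mxCk 2 M -> mxpd (mxpd M j) i x = mxpd (mxpd M i) j x.
Proof.
move=> Mk; apply/matrixP => a b.
have E k l : mxpd (mxpd M l) k x a b = pd (pd (fun y => M y a b) l) k x.
  by rewrite mxE; congr (pd _ k x); apply/funext => y; rewrite mxE.
exact: (etrans (E i j) (etrans (pd_comm j i x (Mk a b)) (esym (E j i)))).
Qed.

(* [ring] compares atoms up to conversion, which is slow on tensor expressions. *)
Ltac bilin_atoms :=
  repeat match goal with |- context [bilin ?M ?v ?w] => generalize (bilin M v w); intro end;
  repeat match goal with |- context [christoffel ?g ?k ?i ?j ?x] =>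
    generalize (christoffel g k i j x); intro end;
  repeat match goal with |- context [pd ?f ?i ?x] => generalize (pd f i x); intro end;
  repeat match goal with |- context [?f 1] => is_var f; generalize (f 1); intro end;
  repeat match goal with |- context [?f ?i ?x] => is_var f; generalize (f i x); intro end.

Ltac bilin_ring := bilin_atoms; ring.

Lemma bilin_combination (R : realType) n (M : 'M[R]_n) (a b c : R) u u' d s t y :
  u' = c *: s - t ->
  bilin M (a *: u + b *: u' - d) y =
  a * bilin M u y - bilin M d y + b * (c * bilin M s y - bilin M t y).
Proof.
move=> ->; rewrite scalerBr scalerA.
rewrite (bilinDl M (a *: u + _)).
rewrite (bilinDl M (a *: u)).
rewrite (bilinDl M ((b * c) *: s)).
rewrite !bilinNl !bilinZl; ring.
Qed.

(** * The tension of a unit field viewed as a section *)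

Section SectionTension.
Local Opaque bilin mxpd chr.
Context {R : realType}.
Variables (g : 'rV[R]_2 -> 'M[R]_2) (B B' : R -> R).
Hypothesis gm : is_metric g.
Hypothesis Bpos : forall t, 0 <= t -> 0 < B t.
Hypothesis gs : forall k, mxCk k g.
Hypothesis chrs : forall k i, mxCk k (chr g i).
Hypothesis BCk : forall m k (f : 'rV[R]_m -> R), (forall y, 0 <= f y) -> Ck k f -> Ck k (fun y => B (f y)).
Hypothesis Bder : forall t : R, 0 <= t -> is_derive t 1 B (B' t).

Variables (sigma nu : 'rV[R]_2 -> 'rV[R]_2) (eta : 'I_2 -> 'rV[R]_2 -> R).
Hypothesis sigma_smooth : forall k, mxCk k sigma.
Hypothesis nu_smooth : forall k, mxCk k nu.
Hypothesis eta_smooth : forall k i, Ck k (eta i).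
Hypothesis sigma_unit : forall x, bilin (g x) (sigma x) (sigma x) = 1.
Hypothesis sigma_cov : forall i x, mxpd sigma i x + sigma x *m chr g i x = eta i x *: nu x.
Hypothesis nu_cov : forall i x, mxpd nu i x + nu x *m chr g i x = - eta i x *: sigma x.

Let G := kk_metric g B.

(** The curvature operator acting on rows: [v *m curv i c x] is R(d_i, d_c) v. *)
Definition curv i c x : 'M[R]_2 :=
  mxpd (chr g c) i x - mxpd (chr g i) c x + chr g c x *m chr g i x - chr g i x *m chr g c x.

(** [sigma_cov] differentiated once more; it serves to eliminate the derivatives of the Christoffel
    symbols applied to [sigma]. *)
Lemma second_cov i j x :
  mxpd (mxpd sigma j) i x + mxpd sigma i x *m chr g j x + sigma x *m mxpd (chr g j) i x
  = pd (eta j) i x *: nu x + eta j x *: mxpd nu i x.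
Proof.
have D1 : mxder (mxpd sigma j) i x (mxpd (mxpd sigma j) i x).
  by apply: (@mxCk_mxder _ _ _ _ 0); apply: mxCk_pd; exact: sigma_smooth.
have D2 := mxderM (mxCk_mxder i x (sigma_smooth 1)) (mxCk_mxder i x (chrs 1 j)).
have D3 := mxderZ (Ck_is_derive i x (eta_smooth 1 j)) (mxCk_mxder i x (nu_smooth 1)).
rewrite -addrA -(mxder_mxpd D3) -(mxder_mxpd (mxderD D1 D2)).
by congr (mxpd _ i x); apply/funext => y; exact: sigma_cov.
Qed.

Lemma sigma_unit_deriv i x :
  bilin (mxpd g i x) (sigma x) (sigma x) + 2 * bilin (g x) (sigma x) (mxpd sigma i x) = 0.
Proof.
have D := is_derive_bilin (mxCk_mxder i x (gs 1)) (mxCk_mxder i x (sigma_smooth 1))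
  (mxCk_mxder i x (sigma_smooth 1)).
have E : (fun y => bilin (g y) (sigma y) (sigma y)) = fun=> 1 by apply/funext.
have := pd_val D; rewrite E (pd_val (is_derive_cst (1 : R) x 'e_i)).
by rewrite (bilin_sym (mxpd sigma i x) _ (is_metric_sym gm x)) mulr2n mulrDl mul1r addrA.
Qed.

Lemma bilin_mxpd_metric i x v w : bilin (mxpd g i x) v w =
  bilin (g x) (v *m chr g i x) w + bilin (g x) v (w *m chr g i x).
Proof. by rewrite metric_compat // bilinDm bilin_mull bilin_mulr. Qed.

Lemma mxpd_section i x : mxpd (section sigma) i x = row_mx 'e_i (mxpd sigma i x).
Proof. by rewrite [LHS]mxpd_row_mx mxpd_id. Qed.

Lemma mxpd_mxpd_section i j x :
  mxpd (mxpd (section sigma) j) i x = row_mx 0 (mxpd (mxpd sigma j) i x).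
Proof.
have -> : mxpd (section sigma) j = fun y => row_mx 'e_j (mxpd sigma j y).
  by apply/funext => y; exact: mxpd_section.
by rewrite mxpd_row_mx mxpd_cst.
Qed.

(* The terms of [tension_lower] at [phi = section sigma]. *)
Definition sff_term x z i j : R :=
    (bilin (G (section sigma x)) (mxpd (mxpd (section sigma) j) i x) z
     - \sum_k christoffel g k i j x * bilin (G (section sigma x)) (mxpd (section sigma) k x) z
     + 2^-1 * (metric_deriv G (section sigma x) (mxpd (section sigma) i x) (mxpd (section sigma) j x) z
             + metric_deriv G (section sigma x) (mxpd (section sigma) j x) (mxpd (section sigma) i x) z
             - metric_deriv G (section sigma x) z (mxpd (section sigma) i x) (mxpd (section sigma) j x))).

Lemma tension_section x z : bilin (G (section sigma x)) (tau g G sigma x) z =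
  \sum_i \sum_j invmx (g x) i j * sff_term x z i j.
Proof. by rewrite [LHS]tension_lower //; exact: kk_is_metric. Qed.

Lemma metric_deriv_section x i q v w :
  metric_deriv G (section sigma x) (row_mx 'e_i q) v w =
  kk_dx g B B' (section sigma x) i v w + kk_de g B B' (section sigma x) q v w.
Proof.
rewrite (kk_metric_deriv gm gs chrs BCk Bder) row_mxKl row_mxKr; congr (_ + _).
rewrite (bigD1 i) //= mxE !eqxx mul1r big1 ?addr0 // => k ki.
by rewrite mxE (negbTE ki) mul0r.
Qed.

Lemma metric_deriv_section0 x q v w :
  metric_deriv G (section sigma x) (row_mx 0 q) v w = kk_de g B B' (section sigma x) q v w.
Proof.
rewrite (kk_metric_deriv gm gs chrs BCk Bder) row_mxKl row_mxKr big1 ?add0r // => k _.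
by rewrite mxE mul0r.
Qed.

Lemma bilin_section x v1 v2 w1 w2 : bilin (G (section sigma x)) (row_mx v1 v2) (row_mx w1 w2) =
  bilin (g x) v1 w1 + B 1 * bilin (g x) (v2 + sigma x *m cmx g x v1) (w2 + sigma x *m cmx g x w1).
Proof. by rewrite kk_bilin /section !row_mxKl !row_mxKr sigma_unit. Qed.

Lemma kk_dx_section x k v1 v2 w1 w2 :
  kk_dx g B B' (section sigma x) k (row_mx v1 v2) (row_mx w1 w2) =
  bilin (mxpd g k x) v1 w1
  + B' 1 * bilin (mxpd g k x) (sigma x) (sigma x) *
    bilin (g x) (v2 + sigma x *m cmx g x v1) (w2 + sigma x *m cmx g x w1)
  + B 1 * (bilin (mxpd g k x) (v2 + sigma x *m cmx g x v1) (w2 + sigma x *m cmx g x w1)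
           + bilin (g x) (sigma x *m mxpd (fun y => cmx g y v1) k x) (w2 + sigma x *m cmx g x w1)
           + bilin (g x) (v2 + sigma x *m cmx g x v1) (sigma x *m mxpd (fun y => cmx g y w1) k x)).
Proof. by rewrite /kk_dx /section !row_mxKl !row_mxKr sigma_unit. Qed.

Lemma kk_de_section x q v1 v2 w1 w2 :
  kk_de g B B' (section sigma x) q (row_mx v1 v2) (row_mx w1 w2) =
  B' 1 * (2 * bilin (g x) (sigma x) q) *
    bilin (g x) (v2 + sigma x *m cmx g x v1) (w2 + sigma x *m cmx g x w1)
  + B 1 * (bilin (g x) (q *m cmx g x v1) (w2 + sigma x *m cmx g x w1)
           + bilin (g x) (v2 + sigma x *m cmx g x v1) (q *m cmx g x w1)).
Proof. by rewrite /kk_de /section !row_mxKl !row_mxKr sigma_unit. Qed.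

Lemma mxpd_cmx_delta i k x : mxpd (fun y => cmx g y 'e_k) i x = mxpd (chr g k) i x.
Proof. by congr (mxpd _ i x); apply/funext => y; rewrite cmx_delta. Qed.

Lemma mxpd_cmx0 i x : mxpd (fun y => cmx g y 0) i x = 0.
Proof.
rewrite (_ : (fun y => _) = fun=> 0) ?mxpd_cst //.
by apply/funext => y; rewrite cmx0.
Qed.

(** Component (i, j) of the covariant derivative of the one-form [eta]. *)
Definition div_term i j x : R := pd (eta j) i x - \sum_k christoffel g k i j x * eta k x.

Lemma mxpd_nu i x : mxpd nu i x = - eta i x *: sigma x - nu x *m chr g i x.
Proof. by rewrite -nu_cov addrK. Qed.

Lemma bilin_second_cov x y i j :
  bilin (g x) (mxpd sigma i x *m chr g j x + sigma x *m mxpd (chr g j) i x) y =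
  pd (eta j) i x * bilin (g x) (nu x) y - bilin (g x) (mxpd (mxpd sigma j) i x) y
  + eta j x * (- eta i x * bilin (g x) (sigma x) y - bilin (g x) (nu x *m chr g i x) y).
Proof.
have -> : mxpd sigma i x *m chr g j x + sigma x *m mxpd (chr g j) i x =
   pd (eta j) i x *: nu x + eta j x *: mxpd nu i x - mxpd (mxpd sigma j) i x.
  by rewrite -second_cov [RHS]addrAC [X in X - _ + _]addrC addrK.
exact: bilin_combination (mxpd_nu i x).
Qed.

Lemma metric_deriv_vertical x y i j :
  metric_deriv G (section sigma x) (mxpd (section sigma) i x) (mxpd (section sigma) j x) (row_mx 0 y) =
  B 1 * (pd (eta j) i x * bilin (g x) (nu x) y - bilin (g x) (mxpd (mxpd sigma j) i x) y
         - eta j x * eta i x * bilin (g x) (sigma x) y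
         + eta j x * bilin (g x) (nu x) (y *m chr g i x)).
Proof.
rewrite !mxpd_section metric_deriv_section kk_dx_section kk_de_section.
rewrite !cmx_delta !cmx0 !mulmx0 !addr0 mxpd_cmx_delta mxpd_cmx0 !mulmx0 !bilin0r !addr0 add0r.
rewrite sigma_cov.
have := bilin_second_cov x y i j; rewrite bilinDl => H.
have := sigma_unit_deriv i x; rewrite !bilin_mxpd_metric -!scalemxAl !bilinZl.
move: H; bilin_atoms => H1 H2.
(* The differentiated equation and the unit length condition are each solved for one atom and
   substituted, leaving a pure ring identity. *)
match type of H1 with ?a + ?b = ?c => have -> : b = c - a by rewrite -H1 addrC addKr end.
match type of H2 with ?a + ?b = 0 => have -> : b = - a by rewrite -[a](addrK b) H2 sub0r opprK end.
ring.
Qed.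

Lemma metric_deriv_vertical_dir x y i j :
  metric_deriv G (section sigma x) (row_mx 0 y) (mxpd (section sigma) i x) (mxpd (section sigma) j x) =
  2 * B' 1 * eta i x * eta j x * bilin (g x) (nu x) (nu x) * bilin (g x) (sigma x) y
  + B 1 * (eta j x * bilin (g x) (nu x) (y *m chr g i x)
           + eta i x * bilin (g x) (nu x) (y *m chr g j x)).
Proof.
rewrite !mxpd_section metric_deriv_section0 kk_de_section !cmx_delta !sigma_cov.
rewrite !bilinZl !bilinZr (bilin_sym (y *m _) _ (is_metric_sym gm x)); bilin_ring.
Qed.

Lemma bilin_section_vertical x v1 v2 y : bilin (G (section sigma x)) (row_mx v1 v2) (row_mx 0 y) =
  B 1 * bilin (g x) (v2 + sigma x *m cmx g x v1) y.
Proof. by rewrite bilin_section cmx0 mulmx0 addr0 bilin0r add0r. Qed.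

Hypothesis nu_unit : forall x, bilin (g x) (nu x) (nu x) = 1.

Lemma bilin_mxpd2_vertical x y i j :
  bilin (G (section sigma x)) (mxpd (mxpd (section sigma) j) i x) (row_mx 0 y) =
  B 1 * bilin (g x) (mxpd (mxpd sigma j) i x) y.
Proof. by rewrite mxpd_mxpd_section bilin_section_vertical cmx0 mulmx0 addr0. Qed.

Lemma bilin_mxpd_vertical x y k :
  bilin (G (section sigma x)) (mxpd (section sigma) k x) (row_mx 0 y) =
  B 1 * (eta k x * bilin (g x) (nu x) y).
Proof. by rewrite mxpd_section bilin_section_vertical cmx_delta sigma_cov bilinZl. Qed.

Lemma sff_term_vertical x y i j : sff_term x (row_mx 0 y) i j =
  B 1 * bilin (g x) (mxpd (mxpd sigma j) i x) y
  - (christoffel g 0 i j x * (B 1 * (eta 0 x * bilin (g x) (nu x) y)) +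
     christoffel g 1 i j x * (B 1 * (eta 1 x * bilin (g x) (nu x) y)))
  + 2^-1 * (
  B 1 * (pd (eta j) i x * bilin (g x) (nu x) y - bilin (g x) (mxpd (mxpd sigma j) i x) y
         - eta j x * eta i x * bilin (g x) (sigma x) y
         + eta j x * bilin (g x) (nu x) (y *m chr g i x)) +
  B 1 * (pd (eta i) j x * bilin (g x) (nu x) y - bilin (g x) (mxpd (mxpd sigma i) j x) y
         - eta i x * eta j x * bilin (g x) (sigma x) y
         + eta i x * bilin (g x) (nu x) (y *m chr g j x)) -
  (2 * B' 1 * eta i x * eta j x * bilin (g x) (nu x) (nu x) * bilin (g x) (sigma x) y
  + B 1 * (eta j x * bilin (g x) (nu x) (y *m chr g i x)
           + eta i x * bilin (g x) (nu x) (y *m chr g j x)))).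
Proof.
rewrite /sff_term sum_I2; congr (_ - (_ * _ + _ * _) + _ * (_ + _ - _)).
- exact: bilin_mxpd2_vertical.
- exact: bilin_mxpd_vertical.
- exact: bilin_mxpd_vertical.
- exact: metric_deriv_vertical.
- exact: metric_deriv_vertical.
- exact: metric_deriv_vertical_dir.
Qed.

(* [g^ij] being symmetric, only the symmetric part in [i], [j] is needed; using it
   avoids the symmetry of second derivatives of [sigma]. *)
Lemma sff_vertical x y i j : sff_term x (row_mx 0 y) i j + sff_term x (row_mx 0 y) j i =
  B 1 * (div_term i j x + div_term j i x) * bilin (g x) (nu x) y
  - 2 * (B 1 + B' 1) * eta i x * eta j x * bilin (g x) (sigma x) y.
Proof.
rewrite (sff_term_vertical x y i j) (sff_term_vertical x y j i).
rewrite /div_term !sum_I2 (nu_unit x).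
bilin_atoms; by field.
Qed.

Lemma bilin_section_horizontal x v1 v2 c :
  bilin (G (section sigma x)) (row_mx v1 v2) (row_mx 'e_c 0) =
  bilin (g x) v1 'e_c + B 1 * bilin (g x) (v2 + sigma x *m cmx g x v1) (sigma x *m chr g c x).
Proof. by rewrite bilin_section cmx_delta add0r. Qed.

Lemma bilin_mxpd2_horizontal x c i j :
  bilin (G (section sigma x)) (mxpd (mxpd (section sigma) j) i x) (row_mx 'e_c 0) =
  B 1 * bilin (g x) (mxpd (mxpd sigma j) i x) (sigma x *m chr g c x).
Proof. by rewrite mxpd_mxpd_section bilin_section_horizontal cmx0 mulmx0 addr0 bilin0l add0r. Qed.

Lemma bilin_mxpd_horizontal x c k :
  bilin (G (section sigma x)) (mxpd (section sigma) k x) (row_mx 'e_c 0) =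
  g x k c + B 1 * (eta k x * bilin (g x) (nu x) (sigma x *m chr g c x)).
Proof. by rewrite mxpd_section bilin_section_horizontal cmx_delta sigma_cov bilinZl bilin_delta. Qed.

Lemma bilin_cov_chr x i c :
  bilin (g x) (nu x) (mxpd sigma i x *m chr g c x) =
  eta i x * bilin (g x) (nu x) (nu x *m chr g c x) - bilin (g x) (nu x) (sigma x *m chr g i x *m chr g c x).
Proof.
have -> : mxpd sigma i x = eta i x *: nu x - sigma x *m chr g i x by rewrite -sigma_cov addrK.
by rewrite mulmxBl -scalemxAl bilinDr bilinNr bilinZr.
Qed.

Lemma metric_deriv_horizontal x c i j :
  let y := sigma x *m chr g c x in
  metric_deriv G (section sigma x) (mxpd (section sigma) i x) (mxpd (section sigma) j x) (row_mx 'e_c 0) =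
  mxpd g i x j c +
  B 1 * (pd (eta j) i x * bilin (g x) (nu x) y - bilin (g x) (mxpd (mxpd sigma j) i x) y
         - eta j x * eta i x * bilin (g x) (sigma x) y
         + eta j x * bilin (g x) (nu x) (y *m chr g i x)
         + eta j x * (bilin (g x) (nu x) (sigma x *m mxpd (chr g c) i x)
            + eta i x * bilin (g x) (nu x) (nu x *m chr g c x)
            - bilin (g x) (nu x) (sigma x *m chr g i x *m chr g c x))).
Proof.
move=> y; rewrite !mxpd_section metric_deriv_section kk_dx_section kk_de_section.
rewrite !cmx_delta !add0r !mxpd_cmx_delta -/y.
rewrite sigma_cov.
have := bilin_second_cov x y i j; rewrite bilinDl => H.
have := sigma_unit_deriv i x; rewrite bilin_delta !bilin_mxpd_metric -!scalemxAl !bilinZl.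
rewrite bilin_cov_chr.
move: H; generalize (mxpd g i x j c) => m; bilin_atoms => H1 H2.
match type of H1 with ?a + ?b = ?c => have -> : b = c - a by rewrite -H1 addrC addKr end.
match type of H2 with ?a + ?b = 0 => have -> : b = - a by rewrite -[a](addrK b) H2 sub0r opprK end.
ring.
Qed.

Lemma metric_deriv_horizontal_dir x c i j :
  let y := sigma x *m chr g c x in
  metric_deriv G (section sigma x) (row_mx 'e_c 0) (mxpd (section sigma) i x) (mxpd (section sigma) j x) =
  mxpd g c x i j + 2 * B' 1 * eta i x * eta j x * bilin (g x) (nu x) (nu x) * bilin (g x) (sigma x) y
  + B 1 * (2 * eta i x * eta j x * bilin (g x) (nu x) (nu x *m chr g c x)
           + eta j x * bilin (g x) (nu x) (sigma x *m mxpd (chr g i) c x)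
           + eta i x * bilin (g x) (nu x) (sigma x *m mxpd (chr g j) c x)).
Proof.
move=> y; rewrite !mxpd_section metric_deriv_section kk_dx_section kk_de_section.
rewrite !cmx_delta !mxpd_cmx_delta !mul0mx !bilin0r !bilin0l bilin_delta !sigma_cov !bilin_mxpd_metric.
rewrite -!scalemxAl -/y !bilinZl !bilinZr.
rewrite (bilin_sym y _ (is_metric_sym gm x)) (bilin_sym (nu x *m _) _ (is_metric_sym gm x)).
rewrite (bilin_sym (sigma x *m mxpd _ _ _) _ (is_metric_sym gm x)).
generalize (mxpd g c x i j) => m; bilin_ring.
Qed.

Lemma chr_lower x i j c :
  christoffel g 0 i j x * g x 0 c + christoffel g 1 i j x * g x 1 c =
  2^-1 * (mxpd g i x j c + mxpd g j x i c - mxpd g c x i j).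
Proof. by rewrite -chr_mul // mxE sum_I2; congr (_ * _ + _ * _); rewrite [RHS]mxE. Qed.

Lemma mul_curv (v : 'rV[R]_2) x i c : v *m curv i c x =
  v *m mxpd (chr g c) i x - v *m mxpd (chr g i) c x
  + v *m chr g c x *m chr g i x - v *m chr g i x *m chr g c x.
Proof. by rewrite /curv mulmxBr mulmxDr mulmxBr !mulmxA. Qed.

Lemma bilin_curv x i c : bilin (g x) (nu x) (sigma x *m curv i c x) =
  bilin (g x) (nu x) (sigma x *m mxpd (chr g c) i x) - bilin (g x) (nu x) (sigma x *m mxpd (chr g i) c x)
  + bilin (g x) (nu x) (sigma x *m chr g c x *m chr g i x)
  - bilin (g x) (nu x) (sigma x *m chr g i x *m chr g c x).
Proof.
rewrite mul_curv.
by rewrite (bilinDr _ _ (_ + _)) (bilinDr _ _ (_ - _)) bilinDr !bilinNr.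
Qed.

Lemma sff_term_horizontal x c i j : let y := sigma x *m chr g c x in
  sff_term x (row_mx 'e_c 0) i j =
  B 1 * bilin (g x) (mxpd (mxpd sigma j) i x) y
  - (christoffel g 0 i j x * (g x 0 c + B 1 * (eta 0 x * bilin (g x) (nu x) y)) +
     christoffel g 1 i j x * (g x 1 c + B 1 * (eta 1 x * bilin (g x) (nu x) y)))
  + 2^-1 * (
  (mxpd g i x j c +
  B 1 * (pd (eta j) i x * bilin (g x) (nu x) y - bilin (g x) (mxpd (mxpd sigma j) i x) y
         - eta j x * eta i x * bilin (g x) (sigma x) y
         + eta j x * bilin (g x) (nu x) (y *m chr g i x)
         + eta j x * (bilin (g x) (nu x) (sigma x *m mxpd (chr g c) i x)
            + eta i x * bilin (g x) (nu x) (nu x *m chr g c x)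
            - bilin (g x) (nu x) (sigma x *m chr g i x *m chr g c x)))) +
  (mxpd g j x i c +
  B 1 * (pd (eta i) j x * bilin (g x) (nu x) y - bilin (g x) (mxpd (mxpd sigma i) j x) y
         - eta i x * eta j x * bilin (g x) (sigma x) y
         + eta i x * bilin (g x) (nu x) (y *m chr g j x)
         + eta i x * (bilin (g x) (nu x) (sigma x *m mxpd (chr g c) j x)
            + eta j x * bilin (g x) (nu x) (nu x *m chr g c x)
            - bilin (g x) (nu x) (sigma x *m chr g j x *m chr g c x)))) -
  (mxpd g c x i j + 2 * B' 1 * eta i x * eta j x * bilin (g x) (nu x) (nu x) * bilin (g x) (sigma x) y
  + B 1 * (2 * eta i x * eta j x * bilin (g x) (nu x) (nu x *m chr g c x)
           + eta j x * bilin (g x) (nu x) (sigma x *m mxpd (chr g i) c x)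
           + eta i x * bilin (g x) (nu x) (sigma x *m mxpd (chr g j) c x)))).
Proof.
move=> y; rewrite /sff_term sum_I2; congr (_ - (_ * _ + _ * _) + _ * (_ + _ - _)).
- exact: bilin_mxpd2_horizontal.
- exact: bilin_mxpd_horizontal.
- exact: bilin_mxpd_horizontal.
- exact: metric_deriv_horizontal.
- exact: metric_deriv_horizontal.
- exact: metric_deriv_horizontal_dir.
Qed.

(** The coordinate vector [row_mx 'e_c 0] is not horizontal: its vertical part at [sigma x] is [y],
    which yields the same terms as a vertical test vector. The derivatives of [g] cancel by
    [chr_lower], since base and horizontal space carry the same metric, and curvature is all that
    remains. *)
Lemma sff_horizontal x c i j : let y := sigma x *m chr g c x in
  sff_term x (row_mx 'e_c 0) i j + sff_term x (row_mx 'e_c 0) j i =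
  B 1 * (div_term i j x + div_term j i x) * bilin (g x) (nu x) y
  - 2 * (B 1 + B' 1) * eta i x * eta j x * bilin (g x) (sigma x) y
  + B 1 * (eta j x * bilin (g x) (nu x) (sigma x *m curv i c x) +
           eta i x * bilin (g x) (nu x) (sigma x *m curv j c x)).
Proof.
move=> y; rewrite (sff_term_horizontal x c i j) (sff_term_horizontal x c j i) /y {y}.
rewrite /div_term !sum_I2.
rewrite (nu_unit x).
have := bilin_curv x i c; have := bilin_curv x j c.
have := chr_lower x i j c; have := chr_lower x j i c.
generalize (mxpd g i x j c) (mxpd g j x i c) (mxpd g c x i j) (mxpd g c x j i) (g x 0 c) (g x 1 c).
intros m1 m2 m3 m4 m5 m6; bilin_atoms => H1 H2 -> ->.
match type of H1 with ?l = _ => have -> : m4 = m2 + m1 - 2 * l by rewrite H1; by field end.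
match type of H2 with ?l = _ => have -> : m3 = m1 + m2 - 2 * l by rewrite H2; by field end.
by field.
Qed.

Lemma symmetric_contraction (s t t' : 'I_2 -> 'I_2 -> R) : (forall i j, s i j = s j i) ->
  (forall i j, t i j + t j i = t' i j + t' j i) ->
  \sum_i \sum_j s i j * t i j = \sum_i \sum_j s i j * t' i j.
Proof.
move=> ss tt; rewrite !sum_I2 (ss 1 0).
have := tt 0 0; have := tt 0 1; have := tt 1 1.
move: (s 0 0) (s 0 1) (s 1 1) (t 0 0) (t 0 1) (t 1 0) (t 1 1) (t' 0 0) (t' 0 1) (t' 1 0) (t' 1 1).
move=> s0 s1 s2 t0 t1 t2 t3 t0' t1' t2' t3' E3 E1 E0.
have -> : t0 = t0' by lra.
have -> : t3 = t3' by lra.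
have -> : t1 = t1' + t2' - t2 by lra.
ring.
Qed.

Lemma linear_contraction (s d e : 'I_2 -> 'I_2 -> R) (b c : R) :
  \sum_i \sum_j s i j * (b * d i j + c * e i j) =
  b * (\sum_i \sum_j s i j * d i j) + c * (\sum_i \sum_j s i j * e i j).
Proof.
rewrite !mulr_sumr -big_split; apply: eq_bigr => i _ /=.
rewrite !mulr_sumr -big_split; apply: eq_bigr => j _ /=; ring.
Qed.

(** Trace of the covariant derivative, that is, minus the codifferential of [eta]. *)
Definition divergence x : R := \sum_i \sum_j invmx (g x) i j * div_term i j x.

Hypothesis divergence0 : forall x, divergence x = 0.
Hypothesis B1 : B 1 + B' 1 = 0.

Lemma tension_vertical x y : bilin (G (section sigma x)) (tau g G sigma x) (row_mx 0 y) = 0.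
Proof.
rewrite tension_section (@symmetric_contraction _ _ (fun i j => B 1 * bilin (g x) (nu x) y * div_term i j x + 0 * 0)).
- rewrite (linear_contraction _ (fun i j => div_term i j x) (fun _ _ => 0) _ 0).
  by rewrite -/(divergence x) divergence0 mulr0 mul0r addr0.
- exact: invmx_metric_sym.
- move=> i j; rewrite sff_vertical B1.
  generalize (div_term i j x) (div_term j i x) => *; bilin_ring.
Qed.

Lemma tension_horizontal x c : bilin (G (section sigma x)) (tau g G sigma x) (row_mx 'e_c 0) =
  B 1 * \sum_i \sum_j invmx (g x) i j * (eta j x * bilin (g x) (nu x) (sigma x *m curv i c x)).
Proof.
set y := sigma x *m chr g c x.
rewrite tension_section (@symmetric_contraction _ _ (fun i j => B 1 * bilin (g x) (nu x) y * div_term i j x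
   + B 1 * (eta j x * bilin (g x) (nu x) (sigma x *m curv i c x)))).
- rewrite (linear_contraction _ (fun i j => div_term i j x)
    (fun i j => eta j x * bilin (g x) (nu x) (sigma x *m curv i c x))).
  by rewrite -/(divergence x) divergence0 mulr0 add0r.
- exact: invmx_metric_sym.
- move=> i j; rewrite (sff_horizontal x c i j) B1 -/y.
  generalize (div_term i j x) (div_term j i x); intros; bilin_ring.
Qed.

Definition kappa x : R := pd (eta 1) 0 x - pd (eta 0) 1 x.

Lemma curv_diag i x : curv i i x = 0.
Proof. by rewrite /curv subrr add0r subrr. Qed.

Lemma curv_anti i c x : curv i c x = - curv c i x.
Proof.
rewrite /curv; generalize (mxpd (chr g c) i x) (mxpd (chr g i) c x) (chr g c x *m chr g i x) (chr g i x *m chr g c x).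
by move=> a b d e; apply/matrixP => k l; rewrite !mxE; ring.
Qed.

(** Both orders of the second covariant derivative of [sigma] are compared; as the second partial
    derivatives commute, only the antisymmetrized derivative of [eta] is left. *)
Lemma sigma_curv x : sigma x *m curv 0 1 x = kappa x *: nu x.
Proof.
have S := mxpd_comm 0 1 x (sigma_smooth 2).
have E1 := second_cov 0 1 x; have E2 := second_cov 1 0 x.
rewrite S (mxpd_nu 0 x) in E1; rewrite (mxpd_nu 1 x) in E2.
have D i : mxpd sigma i x = eta i x *: nu x - sigma x *m chr g i x by rewrite -sigma_cov addrK.
rewrite (D 0) mulmxBl -scalemxAl in E1; rewrite (D 1) mulmxBl -scalemxAl in E2.
rewrite mul_curv; exact: curvature_identity E1 E2.
Qed.

End SectionTension.

(** * Coclosed frames on the torus *)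

Section Frames.
Context {R : realType}.

(** The matrix [P] with rows [s] and [t] has the right inverse [M *m P^T]. For a square matrix this
    is also a left inverse, which is the expansion of [v]. *)
Lemma orthonormal_expand (M : 'M[R]_2) (s t v : 'rV[R]_2) :
  bilin M s s = 1 -> bilin M t t = 1 -> bilin M s t = 0 -> bilin M t s = 0 ->
  v = bilin M v s *: s + bilin M v t *: t.
Proof.
move=> ss tt st ts.
pose P : 'M[R]_2 := \matrix_i (if i == 0 then s else t).
have r0 : row 0 P = s by rewrite rowK.
have r1 : row 1 P = t by rewrite rowK.
have E (u : 'rV[R]_2) i : (u *m M *m P^T) 0 i = bilin M u (row i P).
  by rewrite /bilin mxE [RHS]mxE; apply: eq_bigr => k _; rewrite !mxE.
have PP : P *m (M *m P^T) = 1%:M.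
  apply/matrixP => i j; rewrite mulmxA.
  have -> : (P *m M *m P^T) i j = (row i P *m M *m P^T) 0 j by rewrite -!row_mul [RHS]mxE.
  by rewrite E mxE; move: i j; apply: I2P; apply: I2P; rewrite ?r0 ?r1 ?ss ?tt ?st ?ts.
have {1}-> : v = v *m M *m P^T *m P by rewrite -!mulmxA (mulmxA M) (mulmx1C PP) mulmx1.
by rewrite mulmx_sum_row sum_I2 !E r0 r1.
Qed.

Lemma bilin_I2 (M : 'M[R]_2) (v w : 'rV[R]_2) : bilin M v w =
  v 0 0 * M 0 0 * w 0 0 + v 0 0 * M 0 1 * w 0 1 + (v 0 1 * M 1 0 * w 0 0 + v 0 1 * M 1 1 * w 0 1).
Proof. by rewrite bilinE !sum_I2. Qed.

Variable g : 'rV[R]_2 -> 'M[R]_2.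
Hypothesis gm : is_metric g.
Hypothesis gs : forall k, mxCk k g.

Definition gdet x : R := g x 0 0 * g x 1 1 - g x 0 1 ^+ 2.

Lemma g00_gt0 x : 0 < g x 0 0.
Proof.
rewrite -bilin_delta is_metric_pos //; apply/eqP => /rowP /(_ 0).
by rewrite !mxE /= => /eqP; rewrite oner_eq0.
Qed.

Lemma gdet_gt0 x : 0 < gdet x.
Proof.
(* This vector is orthogonal to ['e_0], and its squared length is [g x 0 0 * gdet x]. *)
pose v : 'rV[R]_2 := \row_i (if i == 0 then - g x 0 1 else g x 0 0).
have v0 : v 0 0 = - g x 0 1 by rewrite mxE.
have v1 : v 0 1 = g x 0 0 by rewrite mxE.
have : 0 < bilin (g x) v v.
  apply: is_metric_pos => //; apply/eqP => /rowP /(_ 1); rewrite v1 mxE => E.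
  by have := g00_gt0 x; rewrite E ltxx.
rewrite bilin_I2 v0 v1 (is_metric_symE gm x 1 0).
have -> : - g x 0 1 * g x 0 0 * - g x 0 1 + - g x 0 1 * g x 0 1 * g x 0 0 +
  (g x 0 0 * g x 0 1 * - g x 0 1 + g x 0 0 * g x 1 1 * g x 0 0) = g x 0 0 * gdet x.
  by rewrite /gdet; ring.
by rewrite pmulr_rgt0 // g00_gt0.
Qed.

(** In ['I_2] the map [1 - i] exchanges the two indices, so the displayed matrix is the adjugate. *)
Lemma invmx_metric x : invmx (g x) =
  (gdet x)^-1 *: \matrix_(i, j) (if i == j then g x (1 - i) (1 - j) else - g x 0 1).
Proof.
set A := _ *: _.
have gA : g x *m A = 1%:M.
  have d0 : gdet x != 0 by rewrite gt_eqF // gdet_gt0.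
  have s10 : g x 1 0 = g x 0 1 by exact: is_metric_symE.
  have o : (1 - 1 : 'I_2) = 0 by apply/val_inj.
  have z : (1 - 0 : 'I_2) = 1 by apply/val_inj.
  rewrite /A -scalemxAr; apply/matrixP => i j; rewrite mxE mxE sum_I2 [RHS]mxE ![(\matrix_(_, _) _) _ _]mxE.
  move: i j; apply: I2P; apply: I2P; rewrite /= ?o ?z ?s10; move: d0; rewrite /gdet => d0; by field.
by rewrite -[RHS](mulKmx (is_metric_unit gm x)) gA mulmx1.
Qed.

Lemma invmx00 x : invmx (g x) 0 0 = g x 1 1 / gdet x.
Proof.
rewrite invmx_metric mxE mxE /= mulrC; congr (g x _ _ / _); exact/val_inj.
Qed.

Lemma invmx01 x : invmx (g x) 0 1 = - g x 0 1 / gdet x.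
Proof. by rewrite invmx_metric mxE mxE /= mulrC. Qed.

Lemma invmx11 x : invmx (g x) 1 1 = g x 0 0 / gdet x.
Proof.
rewrite invmx_metric mxE mxE /= mulrC; congr (g x _ _ / _); exact/val_inj.
Qed.

Lemma invmx10 x : invmx (g x) 1 0 = - g x 0 1 / gdet x.
Proof. by rewrite invmx_metric_sym // invmx01. Qed.

Lemma gdet_Ck k : Ck k gdet.
Proof.
apply: CkB; first by apply: CkM; exact: gs.
by apply: CkM; exact: gs.
Qed.

Lemma invmx_Ck k : mxCk k (fun x => invmx (g x)).
Proof.
have dk : Ck k (fun x => (gdet x)^-1).
  by apply: CkV; [move=> x; rewrite gt_eqF // gdet_gt0|exact: gdet_Ck].
have ok : Ck k (fun x => - g x 0 1 / gdet x) by apply: CkM => //; apply: CkN; exact: gs.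
apply: I2P; apply: I2P.
- by under eq_fun do rewrite invmx00; apply: CkM => //; exact: gs.
- by under eq_fun do rewrite invmx01.
- by under eq_fun do rewrite invmx10.
- by under eq_fun do rewrite invmx11; apply: CkM => //; exact: gs.
Qed.

Lemma chr_Ck k i : mxCk k (chr g i).
Proof.
move=> a b; rewrite (_ : (fun y => _) = christoffel g b i a); last first.
  by apply/funext => y; rewrite mxE.
apply: CkZ; apply: Ck_sum => l _; apply: CkM; first exact: invmx_Ck.
by apply: CkB; [apply: CkD|]; apply: Ck_pd; exact: gs.
Qed.

(** Gram-Schmidt applied to the coordinate fields, which yields a frame on the whole torus. The
    quantity [g x 0 0 * gdet x] in [frame2] is the squared length of the vector being normalized. *)
Definition frame1 x : 'rV[R]_2 := (Num.sqrt (g x 0 0))^-1 *: 'e_0.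
Definition frame2 x : 'rV[R]_2 :=
  (Num.sqrt (g x 0 0 * gdet x))^-1 *: (g x 0 0 *: 'e_1 - g x 0 1 *: 'e_0).

Lemma frame1_Ck k : mxCk k frame1.
Proof.
apply: mxCkZ; last exact: mxCk_cst.
by apply: CkV => [x|]; [rewrite gt_eqF // sqrtr_gt0 g00_gt0|apply: Ck_sqrt; [exact: g00_gt0|exact: gs]].
Qed.

Lemma frame2_Ck k : mxCk k frame2.
Proof.
have p x : 0 < g x 0 0 * gdet x by rewrite mulr_gt0 ?g00_gt0 ?gdet_gt0.
apply: mxCkZ.
  apply: CkV => [x|]; first by rewrite gt_eqF // sqrtr_gt0.
  by apply: Ck_sqrt => //; apply: CkM; [exact: gs|exact: gdet_Ck].
apply: mxCkD; first by apply: mxCkZ; [exact: gs|exact: mxCk_cst].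
move=> a b; rewrite (_ : (fun y => _) = (fun y => - (g y 0 1 * ('e_0 : 'rV[R]_2) a b))).
  by apply: CkN; apply: CkM; [exact: gs|exact: Ck_cst].
by apply/funext => y; rewrite !mxE.
Qed.

Lemma frame11 x : bilin (g x) (frame1 x) (frame1 x) = 1.
Proof.
rewrite /frame1 bilinZl bilinZr bilin_delta mulrA -invfM -expr2 sqr_sqrtr ?ltW ?g00_gt0 //.
by rewrite mulVf // gt_eqF // g00_gt0.
Qed.

Lemma frame12 x : bilin (g x) (frame1 x) (frame2 x) = 0.
Proof.
by rewrite /frame1 /frame2 bilinZl bilinZr bilinDr bilinNr !bilinZr !bilin_delta
  [X in X - _]mulrC subrr !mulr0.
Qed.

Lemma frame21 x : bilin (g x) (frame2 x) (frame1 x) = 0.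
Proof. by rewrite bilin_sym ?frame12 //; exact: is_metric_sym. Qed.

Lemma frame22 x : bilin (g x) (frame2 x) (frame2 x) = 1.
Proof.
have p : 0 < g x 0 0 * gdet x by rewrite mulr_gt0 ?g00_gt0 ?gdet_gt0.
rewrite /frame2 bilinZl bilinZr mulrA -invfM -expr2 sqr_sqrtr ?ltW //.
rewrite !(bilinDl, bilinDr, bilinNl, bilinNr, bilinZl, bilinZr) !bilin_delta.
rewrite (is_metric_symE gm x 1 0).
transitivity ((g x 0 0 * gdet x)^-1 * (g x 0 0 * gdet x)); last by rewrite mulVf // gt_eqF.
congr (_ * _); rewrite /gdet.
generalize (g x 0 0) (g x 0 1) (g x 1 1) => a b c; ring.
Qed.

End Frames.

(** * Rotated frames and the divergence of their connection forms *)

Section CoclosedFrame.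
Context {R : realType}.
Variable g : 'rV[R]_2 -> 'M[R]_2.
Hypothesis gm : is_metric g.
Hypothesis gs : forall k, mxCk k g.

Definition cov (v : 'rV[R]_2 -> 'rV[R]_2) i x : 'rV[R]_2 := mxpd v i x + v x *m chr g i x.

Lemma bilin_cov_deriv v w i x : mxCk 1 v -> mxCk 1 w ->
  is_derive x 'e_i (fun y => bilin (g y) (v y) (w y))
    (bilin (g x) (cov v i x) (w x) + bilin (g x) (v x) (cov w i x)).
Proof.
move=> vk wk.
have := is_derive_bilin (mxCk_mxder i x (gs 1)) (mxCk_mxder i x vk) (mxCk_mxder i x wk).
congr is_derive; rewrite metric_compat // bilinDm bilin_mull bilin_mulr /cov.
generalize (mxpd v i x) (mxpd w i x) (v x *m chr g i x) (w x *m chr g i x) (v x) (w x) (g x).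
move=> a b c d p q M; rewrite bilinDl bilinDr.
generalize (bilin M c q) (bilin M p d) (bilin M a q) (bilin M p b) => *; ring.
Qed.

Lemma bilin_cov_cst v w i x (c : R) : mxCk 1 v -> mxCk 1 w ->
  (forall y, bilin (g y) (v y) (w y) = c) ->
  bilin (g x) (cov v i x) (w x) + bilin (g x) (v x) (cov w i x) = 0.
Proof.
move=> vk wk vw; rewrite -(pd_val (bilin_cov_deriv i x vk wk)).
have -> : (fun y => bilin (g y) (v y) (w y)) = fun=> c by apply/funext.
exact: pd_val (is_derive_cst (c : R) x 'e_i).
Qed.

Section Frame.
Variables s t : 'rV[R]_2 -> 'rV[R]_2.
Hypothesis sk : forall k, mxCk k s.
Hypothesis tk : forall k, mxCk k t.
Hypothesis ss : forall x, bilin (g x) (s x) (s x) = 1.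
Hypothesis tt : forall x, bilin (g x) (t x) (t x) = 1.
Hypothesis st : forall x, bilin (g x) (s x) (t x) = 0.
Hypothesis ts : forall x, bilin (g x) (t x) (s x) = 0.

Definition connection_form i x : R := bilin (g x) (cov s i x) (t x).

Lemma connection_form_Ck k i : Ck k (connection_form i).
Proof.
apply: Ck_bilin => //; apply: mxCkD; first exact: mxCk_pd.
by apply: mxCkM => //; exact: chr_Ck.
Qed.

Let sym v w x : bilin (g x) v w = bilin (g x) w v.
Proof. by apply: bilin_sym; exact: is_metric_sym. Qed.

(** Since [s] has constant length, its covariant derivative has no component along [s]. *)
Lemma cov_frame1 i x : cov s i x = connection_form i x *: t x.
Proof.
rewrite {1}(orthonormal_expand (cov s i x) (ss x) (tt x) (st x) (ts x)).
suff -> : bilin (g x) (cov s i x) (s x) = 0 by rewrite scale0r add0r.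
have := bilin_cov_cst i x (sk 1) (sk 1) ss.
by rewrite [X in _ + X]sym => H; lra.
Qed.

Lemma cov_frame2 i x : cov t i x = - connection_form i x *: s x.
Proof.
rewrite {1}(orthonormal_expand (cov t i x) (ss x) (tt x) (st x) (ts x)).
have -> : bilin (g x) (cov t i x) (t x) = 0.
  have := bilin_cov_cst i x (tk 1) (tk 1) tt.
  by rewrite [X in _ + X]sym => H; lra.
rewrite scale0r addr0; congr (_ *: _).
have := bilin_cov_cst i x (sk 1) (tk 1) st.
by rewrite [X in _ + X]sym /connection_form => H; lra.
Qed.

Variable theta : 'rV[R]_2 -> R.
Hypothesis thetak : forall k, Ck k theta.

Definition rotated1 x := cos (theta x) *: s x + sin (theta x) *: t x.
Definition rotated2 x := - sin (theta x) *: s x + cos (theta x) *: t x.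

Lemma rotated1_Ck k : mxCk k rotated1.
Proof.
by apply: mxCkD; apply: mxCkZ => //; [exact: (Ck_sin_cos (thetak k)).2|exact: (Ck_sin_cos (thetak k)).1].
Qed.

Lemma rotated2_Ck k : mxCk k rotated2.
Proof.
by apply: mxCkD; apply: mxCkZ => //; [apply: CkN; exact: (Ck_sin_cos (thetak k)).1|exact: (Ck_sin_cos (thetak k)).2].
Qed.

Lemma bilin_rotated x (a b c d : R) :
  bilin (g x) (a *: s x + b *: t x) (c *: s x + d *: t x) = a * c + b * d.
Proof.
by rewrite bilinDl !bilinDr !bilinZl !bilinZr ss tt st ts; ring.
Qed.

Lemma rotated11 x : bilin (g x) (rotated1 x) (rotated1 x) = 1.
Proof. by rewrite bilin_rotated -!expr2 cos2Dsin2. Qed.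

Lemma rotated22 x : bilin (g x) (rotated2 x) (rotated2 x) = 1.
Proof. by rewrite bilin_rotated mulrNN -!expr2 addrC cos2Dsin2. Qed.

Lemma rotated12 x : bilin (g x) (rotated1 x) (rotated2 x) = 0.
Proof. by rewrite bilin_rotated mulrN addrC mulrC subrr. Qed.

Lemma cov_comb (a b : 'rV[R]_2 -> R) (da db : R) i x :
  is_derive x 'e_i a da -> is_derive x 'e_i b db ->
  cov (fun y => a y *: s y + b y *: t y) i x =
  (da - b x * connection_form i x) *: s x + (db + a x * connection_form i x) *: t x.
Proof.
move=> ad bd.
have D := mxderD (mxderZ ad (mxCk_mxder i x (sk 1))) (mxderZ bd (mxCk_mxder i x (tk 1))).
rewrite /cov (mxder_mxpd D) mulmxDl -!scalemxAl.
have -> : mxpd s i x = connection_form i x *: t x - s x *m chr g i x by rewrite -cov_frame1 addrK.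
have -> : mxpd t i x = - connection_form i x *: s x - t x *m chr g i x by rewrite -cov_frame2 addrK.
generalize (s x *m chr g i x) (t x *m chr g i x) (s x) (t x) (connection_form i x) (a x) (b x).
move=> u v p q w c d; apply/rowP => k; rewrite !mxE; ring.
Qed.

Definition rotated_form i x : R := pd theta i x + connection_form i x.

Lemma rotated_form_Ck k i : Ck k (rotated_form i).
Proof. by apply: CkD; [exact: Ck_pd|exact: connection_form_Ck]. Qed.

Let dth i x : is_derive x 'e_i theta (pd theta i x) := Ck_is_derive i x (thetak 1).

Lemma cov_rotated1 i x : cov rotated1 i x = rotated_form i x *: rotated2 x.
Proof.
rewrite (cov_comb (is_derive_comp_real (is_derive_cos _) (dth i x))
  (is_derive_comp_real (is_derive_sin _) (dth i x))) /rotated_form /rotated2.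
generalize (pd theta i x) (connection_form i x) (cos (theta x)) (sin (theta x)) (s x) (t x).
by move=> a b c d u v; rewrite scalerDr !scalerA; congr (_ *: _ + _ *: _); ring.
Qed.

Lemma cov_rotated2 i x : cov rotated2 i x = - rotated_form i x *: rotated1 x.
Proof.
have ds : is_derive x 'e_i (fun y => - sin (theta y)) (- (cos (theta x) * pd theta i x)).
  exact: is_deriveN (is_derive_comp_real (is_derive_sin _) (dth i x)).
rewrite (cov_comb ds
  (is_derive_comp_real (is_derive_cos _) (dth i x))) /rotated_form /rotated1.
generalize (pd theta i x) (connection_form i x) (cos (theta x)) (sin (theta x)) (s x) (t x).
by move=> a b c d u v; rewrite scalerDr !scalerA; congr (_ *: _ + _ *: _); ring.
Qed.

End Frame.

Lemma christoffel_sym k i j x : christoffel g k i j x = christoffel g k j i x.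
Proof.
have /rowP /(_ k) := chr_sym gm j i x.
by rewrite -!rowE !mxE.
Qed.

(** Jacobi's formula, obtained in dimension two by expanding the determinant and inserting
    [metric_compat]. *)
Lemma is_derive_gdet i x : is_derive x 'e_i (gdet g)
  (2 * gdet g x * (christoffel g 0 i 0 x + christoffel g 1 i 1 x)).
Proof.
have D a b := Ck_is_derive i x (gs 1 a b).
have := is_deriveDl (is_deriveMl (D 0 0) (D 1 1))
  (is_deriveN (is_deriveMl (D 0 1) (D 0 1))).
congr is_derive.
have E a b : pd (fun y => g y a b) i x =
    \sum_c christoffel g c i a x * g x c b + \sum_c g x a c * christoffel g c i b x.
  have /matrixP /(_ a b) := metric_compat gm i x; rewrite [LHS]mxE => ->.
  by rewrite mxE mxE [X in _ + X]mxE; congr (_ + _); apply: eq_bigr => c _; rewrite !mxE.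
rewrite !E !sum_I2 /gdet (is_metric_symE gm x 1 0).
generalize (christoffel g 0 i 0 x) (christoffel g 0 i 1 x) (christoffel g 1 i 0 x) (christoffel g 1 i 1 x).
generalize (g x 0 0) (g x 0 1) (g x 1 1) => *; ring.
Qed.

(** The product of [g] with its inverse is constant; its derivative is solved for that of the
    inverse, using [metric_compat]. *)
Lemma is_derive_invmx i x a b : is_derive x 'e_i (fun y => invmx (g y) a b)
  (- (\sum_c invmx (g x) a c * christoffel g b i c x
      + \sum_c christoffel g a i c x * invmx (g x) c b)).
Proof.
have Sd := mxCk_mxder i x (invmx_Ck gm gs 1).
have gd := mxCk_mxder i x (gs 1).
have E : mxpd g i x *m invmx (g x) + g x *m mxpd (fun y => invmx (g y)) i x = 0.
  rewrite -(mxder_mxpd (mxderM gd Sd)) (_ : (fun y => _) = fun=> 1%:M) ?mxpd_cst //.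
  by apply/funext => y; rewrite mulmxV // is_metric_unit.
have -> : - (\sum_c invmx (g x) a c * christoffel g b i c x
      + \sum_c christoffel g a i c x * invmx (g x) c b) = mxpd (fun y => invmx (g y)) i x a b.
  have -> : mxpd (fun y => invmx (g y)) i x = - (invmx (g x) *m mxpd g i x *m invmx (g x)).
    rewrite -[LHS](mulKmx (is_metric_unit gm x)).
    have -> : g x *m mxpd (fun y => invmx (g y)) i x = - (mxpd g i x *m invmx (g x)).
      by apply/eqP; rewrite -addr_eq0 addrC E.
    by rewrite mulmxN mulmxA.
  rewrite metric_compat // mulmxDr mulmxDl mulmxA mulmxK ?is_metric_unit //.
  rewrite (mulmxA _ (g x)) mulVmx ?is_metric_unit // mul1mx.
  rewrite [RHS]mxE [in RHS]mxE; congr (- (_ + _)); rewrite mxE; apply: eq_bigr => c _.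
    by rewrite [in RHS]mxE.
  by rewrite [in RHS]mxE [in RHS]mxE.
exact: Sd.
Qed.

Definition laplace_coef i j x : R := Num.sqrt (gdet g x) * invmx (g x) i j.

Lemma laplace_coef_Ck k i j : Ck k (laplace_coef i j).
Proof.
apply: CkM; last exact: invmx_Ck.
by apply: Ck_sqrt; [exact: gdet_gt0|exact: gdet_Ck].
Qed.

(** Brings the geometric equation into the form of [torus_poisson]. The trace of the Christoffel
    symbols coming from the determinant cancels one of the two terms coming from the inverse
    metric. *)
Lemma divergence_form (eta : 'I_2 -> 'rV[R]_2 -> R) x : (forall i, Ck 1 (eta i)) ->
  \sum_i pd (fun y => \sum_j laplace_coef i j y * eta j y) i x =
  Num.sqrt (gdet g x) * divergence g eta x.
Proof.
move=> ek.
have d0 := gdet_gt0 gm x.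
have sd i : is_derive x 'e_i (fun y => Num.sqrt (gdet g y))
    (Num.sqrt (gdet g x) * (christoffel g 0 i 0 x + christoffel g 1 i 1 x)).
  have := is_derive_comp_real (is_derive1_sqrt d0) (is_derive_gdet i x).
  congr is_derive; rewrite -[X in 2 * X * _](sqr_sqrtr (ltW d0)).
  have : Num.sqrt (gdet g x) != 0 by rewrite gt_eqF // sqrtr_gt0.
  generalize (Num.sqrt (gdet g x)) (christoffel g 0 i 0 x + christoffel g 1 i 1 x) => q c q0.
  by field.
have ad i j := is_deriveMl (is_deriveMl (sd i) (is_derive_invmx i x i j)) (Ck_is_derive i x (ek j)).
have E i : pd (fun y => \sum_j laplace_coef i j y * eta j y) i x = _ :=
  pd_val (is_derive_sumf (index_enum 'I_2) (ad i)).
rewrite (eq_bigr _ (fun i _ => E i)) /divergence /div_term !sum_I2.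
rewrite !(christoffel_sym _ 1 0) (invmx_metric_sym gm x 1 0).
generalize (Num.sqrt (gdet g x)) (invmx (g x) 0 0) (invmx (g x) 0 1) (invmx (g x) 1 1).
generalize (christoffel g 0 0 0 x) (christoffel g 1 0 0 x) (christoffel g 0 0 1 x) (christoffel g 1 0 1 x).
generalize (christoffel g 0 1 1 x) (christoffel g 1 1 1 x) (eta 0 x) (eta 1 x).
generalize (pd (eta 0) 0 x) (pd (eta 0) 1 x) (pd (eta 1) 0 x) (pd (eta 1) 1 x) => *; ring.
Qed.

End CoclosedFrame.

(** * Periodicity, ellipticity and the coclosed rotation *)

Section PeriodicMetric.
Context {R : realType}.
Variable g : 'rV[R]_2 -> 'M[R]_2.
Hypothesis gp : T2_periodic g.

Lemma mxpd_periodic p q (M : 'rV[R]_2 -> 'M[R]_(p, q)) i : T2_periodic M -> T2_periodic (mxpd M i).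
Proof.
move=> Mp j x; apply/matrixP => a b; rewrite !mxE.
by apply: pd_periodic => k y; rewrite Mp.
Qed.

Lemma christoffel_periodic k i j : T2_periodic (christoffel g k i j).
Proof.
have P a b l : T2_periodic (pd (fun y => g y a b) l) by apply: pd_periodic => m y; rewrite gp.
move=> l x; rewrite /christoffel gp; congr (_ * _); apply: eq_bigr => m _.
by congr (_ * (_ + _ - _)); exact: P.
Qed.

Lemma chr_periodic i : T2_periodic (chr g i).
Proof. by move=> j x; apply/matrixP => a b; rewrite !mxE christoffel_periodic. Qed.

Lemma gdet_periodic : T2_periodic (gdet g).
Proof. by move=> i x; rewrite /gdet gp. Qed.

Lemma frame1_periodic : T2_periodic (frame1 g).
Proof. by move=> i x; rewrite /frame1 gp. Qed.

Lemma frame2_periodic : T2_periodic (frame2 g).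
Proof. by move=> i x; rewrite /frame2 gp gdet_periodic. Qed.

Lemma connection_form_periodic s t i : T2_periodic s -> T2_periodic t ->
  T2_periodic (connection_form g s t i).
Proof.
move=> sp tp j x.
by rewrite /connection_form /cov gp sp tp chr_periodic (mxpd_periodic i sp).
Qed.

Lemma laplace_coef_periodic i j : T2_periodic (laplace_coef g i j).
Proof. by move=> k x; rewrite /laplace_coef gdet_periodic gp. Qed.

Lemma kk_metric_periodic B : TT2_periodic (kk_metric g B).
Proof.
move=> i u.
have El : lsubmx (u + 'e_(lshift 2 i)) = lsubmx u + 'e_i.
  by rewrite lsubmxD; congr (_ + _); apply/rowP => k; rewrite !mxE eq_lshift.
have Er : rsubmx (u + 'e_(lshift 2 i)) = rsubmx u.
  apply/rowP => k; rewrite !mxE eq_rlshift andbF addr0 //.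
have N x e : nonlinear_connection g (x + 'e_i) e = nonlinear_connection g x e.
  apply/matrixP => a b; rewrite mxE [RHS]mxE mxE [RHS]mxE.
  apply: eq_bigr => k _; apply: eq_bigr => l _.
  by rewrite christoffel_periodic.
by rewrite /kk_metric /vertical_frame El Er gp N.
Qed.

Hypothesis gm : is_metric g.
Hypothesis gs : forall k, mxCk k g.

(** In dimension two the coefficient matrix has determinant 1, and its trace is bounded by
    periodicity. The smallest eigenvalue is at least determinant over trace, so the inverse of a
    bound for the trace serves as [lam]. *)
Lemma laplace_coef_elliptic : exists2 lam : R, 0 < lam &
  forall x (v : 'I_2 -> R), lam * \sum_i v i ^+ 2 <= \sum_i \sum_j laplace_coef g i j x * v j * v i.
Proof.
have Tp : T2_periodic (fun x => laplace_coef g 0 0 x + laplace_coef g 1 1 x).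
  by move=> i x; rewrite !laplace_coef_periodic.
have Tc : continuous (fun x => laplace_coef g 0 0 x + laplace_coef g 1 1 x).
  by apply: (@Ck_continuous _ _ 0); apply: CkD; exact: laplace_coef_Ck.
have [M HM] := T2_periodic_bounded Tp Tc.
have dpos x : 0 < laplace_coef g 0 0 x /\ 0 < laplace_coef g 1 1 x.
  have q0 : 0 < Num.sqrt (gdet g x) by rewrite sqrtr_gt0 gdet_gt0.
  have d0 := gdet_gt0 gm x; have a0 := g00_gt0 gm x.
  have b0 : 0 < g x 1 1.
    have : 0 < g x 0 0 * g x 1 1 by move: d0; rewrite /gdet; have := sqr_ge0 (g x 0 1); lra.
    by rewrite pmulr_rgt0.
  by rewrite /laplace_coef invmx00 // invmx11 //; split; rewrite mulr_gt0 // divr_gt0.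
have det1 x : laplace_coef g 0 0 x * laplace_coef g 1 1 x - laplace_coef g 0 1 x ^+ 2 = 1.
  rewrite /laplace_coef invmx00 // invmx11 // invmx01 //.
  have d0 : gdet g x != 0 by rewrite gt_eqF // gdet_gt0.
  have q2 := sqr_sqrtr (ltW (gdet_gt0 gm x)).
  have K (q a b c d : R) : d != 0 ->
      q * (c / d) * (q * (a / d)) - (q * (- b / d)) ^+ 2 = q ^+ 2 * (a * c - b ^+ 2) / d ^+ 2.
    by move=> ?; field.
  rewrite K // -/(gdet g x).
  by rewrite q2 -expr2 mulfV // expf_neq0.
have M0 : 0 < M.
  have [a0 b0] := dpos 0; apply: lt_le_trans (HM 0); apply: lt_le_trans (ler_norm _).
  by rewrite addr_gt0.
exists M^-1; first by rewrite invr_gt0.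
move=> x v; rewrite !sum_I2.
have s10 : laplace_coef g 1 0 x = laplace_coef g 0 1 x by rewrite /laplace_coef invmx_metric_sym.
have [a0 b0] := dpos x; have D := det1 x; have TM := le_trans (ler_norm _) (HM x).
rewrite s10 -(ler_pM2l M0) mulrA mulfV ?gt_eqF // mul1r.
move: a0 b0 TM D; generalize (laplace_coef g 0 0 x) (laplace_coef g 1 1 x) (laplace_coef g 0 1 x) (v 0) (v 1).
move=> a b c p q a0 b0 TM D.
set Q := _ + _ + _.
(* Cayley-Hamilton with determinant 1: the trace times the quadratic form of A at v is |v|^2 + |A
   v|^2. *)
have TQ : (a + b) * Q = p ^+ 2 + q ^+ 2 + ((a * p + c * q) ^+ 2 + (c * p + b * q) ^+ 2).
  by rewrite -[p ^+ 2]mul1r -[q ^+ 2]mul1r -D /Q; ring.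
have H1 : p ^+ 2 + q ^+ 2 <= (a + b) * Q by rewrite TQ lerDl addr_ge0 ?sqr_ge0.
have Q0 : 0 <= Q.
  have ab0 : 0 < a + b by rewrite addr_gt0.
  by rewrite -(pmulr_rge0 _ ab0) (le_trans _ H1) // addr_ge0 ?sqr_ge0.
by apply: (le_trans H1); rewrite ler_wpM2r.
Qed.

Lemma coclosed_rotation : exists theta, [/\ T2_periodic theta, forall k, Ck k theta &
  forall x, divergence g (rotated_form g (frame1 g) (frame2 g) theta) x = 0].
Proof.
have [lam lam0 ell] := laplace_coef_elliptic.
pose om i := connection_form g (frame1 g) (frame2 g) i.
have omk k i : Ck k (om i).
  by apply: connection_form_Ck => // l; [exact: frame1_Ck|exact: frame2_Ck].
have omp i : T2_periodic (om i).
  by apply: connection_form_periodic; [exact: frame1_periodic|exact: frame2_periodic].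
(* With this sign the flux in [torus_poisson] is the coefficient matrix applied to d theta +
   omega. *)
pose F i (y : 'rV[R]_2) := - \sum_j laplace_coef g i j y * om j y.
have ak i j : T2_periodic (laplace_coef g i j) /\ smooth (laplace_coef g i j).
  by split=> [|k]; [exact: laplace_coef_periodic|exact: laplace_coef_Ck].
have Fk i : T2_periodic (F i) /\ smooth (F i).
  split=> [l x|k].
    by congr (- _); apply: eq_bigr => j _; rewrite laplace_coef_periodic omp.
  by apply: CkN; apply: Ck_sum => j _; apply: CkM; [exact: laplace_coef_Ck|exact: omk].
have [theta [tp tk tE]] := torus_poisson lam0 ak Fk ell.
exists theta; split=> // x.
have q0 : Num.sqrt (gdet g x) != 0 by rewrite gt_eqF // sqrtr_gt0 gdet_gt0.
apply: (mulfI q0); rewrite mulr0 -divergence_form //; last first.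
  by move=> i; apply: CkD; [exact: Ck_pd|exact: omk].
rewrite -[RHS](tE x); apply: eq_bigr => i _; congr (pd _ i x).
apply/funext => y; rewrite /F opprK -big_split; apply: eq_bigr => j _.
by rewrite /rotated_form mulrDr.
Qed.

End PeriodicMetric.

Lemma mxpdE (R : realType) n p q (M : 'rV[R]_n -> 'M[R]_(p, q)) i x a b :
  mxpd M i x a b = pd (fun y => M y a b) i x.
Proof. by rewrite mxE. Qed.

Lemma chrE (R : realType) n (g : 'rV[R]_n -> 'M[R]_n) i x j k :
  chr g i x j k = christoffel g k i j x.
Proof. by rewrite mxE. Qed.

(** * Harmonicity and curvature *)

Lemma bilin_comb3 (R : realType) n (M : 'M[R]_n) (a b : R) (v p q r : 'rV[R]_n) :
  bilin M v (a *: p + b *: q + r) = a * bilin M v p + b * bilin M v q + bilin M v r.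
Proof. by rewrite (bilinDr M v (_ + _)) bilinDr !bilinZr. Qed.

Section Harmonicity.
Local Opaque bilin mxpd chr.
Context {R : realType}.
Variables (g : 'rV[R]_2 -> 'M[R]_2) (B B' : R -> R).
Hypothesis gm : is_metric g.
Hypothesis Bpos : forall t, 0 <= t -> 0 < B t.
Hypothesis gs : forall k, mxCk k g.
Hypothesis BCk : forall m k (f : 'rV[R]_m -> R), (forall y, 0 <= f y) -> Ck k f -> Ck k (fun y => B (f y)).
Hypothesis Bder : forall t : R, 0 <= t -> is_derive t 1 B (B' t).
Hypothesis B1 : B 1 + B' 1 = 0.

Variables (sigma nu : 'rV[R]_2 -> 'rV[R]_2) (eta : 'I_2 -> 'rV[R]_2 -> R).
Hypothesis sk : forall k, mxCk k sigma.
Hypothesis nk : forall k, mxCk k nu.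
Hypothesis ek : forall k i, Ck k (eta i).
Hypothesis ss : forall x, bilin (g x) (sigma x) (sigma x) = 1.
Hypothesis nn : forall x, bilin (g x) (nu x) (nu x) = 1.
Hypothesis sn : forall x, bilin (g x) (sigma x) (nu x) = 0.
Hypothesis sc : forall i x, mxpd sigma i x + sigma x *m chr g i x = eta i x *: nu x.
Hypothesis nc : forall i x, mxpd nu i x + nu x *m chr g i x = - eta i x *: sigma x.
Hypothesis div0 : forall x, divergence g eta x = 0.

Let chrs k i : mxCk k (chr g i) := chr_Ck gm gs k i.
Let G := kk_metric g B.
Let kap := kappa eta.

Let tv x y : bilin (G (section sigma x)) (tau g G sigma x) (row_mx 0 y) = 0 :=
  tension_vertical gm Bpos gs chrs BCk Bder sk nk ek ss sc nc nn div0 B1 x y.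

Let th x c : bilin (G (section sigma x)) (tau g G sigma x) (row_mx 'e_c 0) =
  B 1 * \sum_i \sum_j invmx (g x) i j * (eta j x * bilin (g x) (nu x) (sigma x *m curv g i c x)) :=
  tension_horizontal gm Bpos gs chrs BCk Bder sk nk ek ss sc nc nn div0 B1 x c.

Let ns x : bilin (g x) (nu x) (sigma x) = 0.
Proof. by rewrite bilin_sym ?sn //; exact: is_metric_sym. Qed.

Lemma kk_pos u w : w != 0 -> 0 < bilin (G u) w w.
Proof. by apply: is_metric_pos; exact: kk_is_metric. Qed.

(** A vertical test vector sees only the vertical part of the tension, multiplied by the positive
    number [B 1]. *)
Lemma harmonic_section_sigma : harmonic_section g G sigma.
Proof.
move=> x; apply: (bilin_eq0 (@is_metric_pos _ _ _ gm x)) => y.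
have Bn : B 1 != 0 by rewrite gt_eqF // Bpos.
apply: (mulfI Bn); rewrite mulr0.
rewrite -[RHS](tv x y) kk_bilin /section !row_mxKl !row_mxKr ss bilin0r add0r cmx0 mulmx0 addr0.
by rewrite /tau_v /vpart christoffel_form_cmx.
Qed.

(** [sigma_curv] for the pair [nu], [sigma], whose connection form is the opposite of [eta]. *)
Lemma nu_curv x : nu x *m curv g 0 1 x = - kap x *: sigma x.
Proof.
have ek' k i : Ck k (fun y => - eta i y) by apply: CkN.
have := sigma_curv chrs nk sk ek' nc _ x.
have -> : kappa (fun i y => - eta i y) x = - kap x.
  rewrite /kap /kappa.
  have N i j : pd (fun y => - eta i y) j x = - pd (eta i) j x.
    by apply: pd_val; apply: is_deriveN; exact: Ck_is_derive (ek 1 i).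
  by rewrite !N; ring.
by apply=> i y; rewrite opprK.
Qed.

Lemma contraction_I2 (S : 'I_2 -> 'I_2 -> R) (e K : 'I_2 -> R) :
  \sum_i \sum_j S i j * (e j * K i) =
  K 0 * (S 0 0 * e 0 + S 0 1 * e 1) + K 1 * (S 1 0 * e 0 + S 1 1 * e 1).
Proof. by rewrite !sum_I2; ring. Qed.

Lemma sigma_curv01 x : bilin (g x) (nu x) (sigma x *m curv g 0 1 x) = kap x.
Proof. by rewrite (sigma_curv chrs sk nk ek sc nc) bilinZr nn mulr1. Qed.

Lemma contraction0 x : \sum_i \sum_j invmx (g x) i j *
   (eta j x * bilin (g x) (nu x) (sigma x *m curv g i 0 x)) =
  - kap x * (invmx (g x) 1 0 * eta 0 x + invmx (g x) 1 1 * eta 1 x).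
Proof.
apply: (etrans (contraction_I2 _ (fun j => eta j x) _)).
rewrite -[RHS]add0r -[X in _ = X + _](mul0r (invmx (g x) 0 0 * eta 0 x + invmx (g x) 0 1 * eta 1 x)).
congr (_ * _ + _ * _); first by rewrite (curv_diag g 0 x) mulmx0 bilin0r.
by rewrite (curv_anti g 1 0 x) mulmxN bilinNr sigma_curv01.
Qed.

Lemma contraction1 x : \sum_i \sum_j invmx (g x) i j *
   (eta j x * bilin (g x) (nu x) (sigma x *m curv g i 1 x)) =
  kap x * (invmx (g x) 0 0 * eta 0 x + invmx (g x) 0 1 * eta 1 x).
Proof.
apply: (etrans (contraction_I2 _ (fun j => eta j x) _)).
rewrite -[RHS]addr0.
rewrite -[X in _ = _ + X](mul0r (invmx (g x) 1 0 * eta 0 x + invmx (g x) 1 1 * eta 1 x)).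
congr (_ * _ + _ * _); first exact: sigma_curv01.
by rewrite (curv_diag g 1 x) mulmx0 bilin0r.
Qed.

(** Tested against the base coordinate vectors, the tension gives, up to sign and the factor [B 1],
    [kap] times the components of [eta] raised by the inverse metric, which is invertible.
    Conversely, these vectors and the vertical ones span the tangent space, and [G] is positive
    definite. *)
Lemma harmonic_map_kappa_eta : harmonic_map g G sigma <-> forall x i, kap x * eta i x = 0.
Proof.
have Bp : B 1 != 0 by rewrite gt_eqF // Bpos.
split=> [H x | H x].
  have H0 := th x 0; have H1 := th x 1.
  rewrite (H x) bilin0l (contraction0 x) in H0; rewrite (H x) bilin0l (contraction1 x) in H1.
  have {}H0 : kap x * (invmx (g x) 1 0 * eta 0 x + invmx (g x) 1 1 * eta 1 x) = 0.
    by apply: (mulfI Bp); rewrite mulr0 -[RHS]oppr0 H0; ring.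
  have {}H1 : kap x * (invmx (g x) 0 0 * eta 0 x + invmx (g x) 0 1 * eta 1 x) = 0.
    by apply: (mulfI Bp); rewrite mulr0 H1.
  pose v : 'cV[R]_2 := \col_i (kap x * eta i x).
  have v0 : invmx (g x) *m v = 0.
    apply/matrixP => i j; rewrite mxE sum_I2 [RHS]mxE ![v _ _]mxE.
    move: i; apply: I2P; [rewrite -[RHS]H1|rewrite -[RHS]H0]; ring.
  have : v = 0 by rewrite -(mulKVmx (is_metric_unit gm x) v) v0 mulmx0.
  by move=> /matrixP E i; have := E i 0; rewrite !mxE.
apply: (bilin_eq0 (@kk_pos (section sigma x))) => w.
rewrite -(hsubmxK w).
have -> : row_mx (lsubmx w) (rsubmx w) = lsubmx w 0 0 *: row_mx 'e_0 0 + lsubmx w 0 1 *: row_mx 'e_1 0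
   + row_mx 0 (rsubmx w).
  rewrite !scale_row_mx !scaler0 !add_row_mx !addr0 add0r; congr row_mx; exact: rV2_decomp.
apply: (etrans (bilin_comb3 _ _ _ _ _ _ _)).
have H0 := etrans (th x 0) (congr1 _ (contraction0 x)).
have H1 := etrans (th x 1) (congr1 _ (contraction1 x)).
have c0 : kap x * (invmx (g x) 0 0 * eta 0 x + invmx (g x) 0 1 * eta 1 x) = 0.
  by rewrite mulrDr !(mulrCA (kap x)) !H !mulr0 addr0.
have c1 : kap x * (invmx (g x) 1 0 * eta 0 x + invmx (g x) 1 1 * eta 1 x) = 0.
  by rewrite mulrDr !(mulrCA (kap x)) !H !mulr0 addr0.
rewrite mulNr c1 oppr0 mulr0 in H0; rewrite c0 mulr0 in H1.
transitivity (lsubmx w 0 0 * 0 + lsubmx w 0 1 * 0 + 0 : R); last by rewrite !mulr0 !addr0.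
congr (_ * _ + _ * _ + _); [exact: H0|exact: H1|exact: tv].
Qed.

Lemma kappa_eta0 : (forall x i, kap x * eta i x = 0) -> forall x, kap x = 0.
Proof.
move=> H x; apply/eqP/negPn/negP => kx.
have kc : {for x, continuous kap}.
  by apply: (@Ck_continuous _ _ 0); apply: CkB; apply: Ck_pd; exact: ek.
have near0 i : \near x, eta i x = 0.
  have : \forall y \near x, kap y != 0 by exact: (cvgr_neq0 _ kc kx).
  apply: filterS => y ky; have /eqP := H y i.
  by rewrite mulf_eq0 (negbTE ky) /= => /eqP.
have D i k : pd (eta i) k x = 0.
  apply: pd_val; apply: (near_eq_is_derive (f := fun=> 0)).
  by apply: filterS (near0 i) => y ->.
by move: kx; rewrite /kap /kappa !D subrr eqxx.
Qed.

Lemma riemann_curv i j k x : riemann g i j k x = 'e_k *m curv g i j x.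
Proof.
rewrite -rowE; apply/rowP => l; rewrite [LHS]mxE [RHS]mxE /curv.
have E (M1 M2 M3 M4 : 'M[R]_2) : (M1 - M2 + M3 - M4) k l = M1 k l - M2 k l + (M3 k l - M4 k l).
  by rewrite !mxE addrA.
have P a c : pd (christoffel g l a k) c x = mxpd (chr g a) c x k l.
  by rewrite mxpdE; congr (pd _ c x); apply/funext => y; rewrite chrE.
have Q a c : (chr g a x *m chr g c x) k l = \sum_m christoffel g m a k x * christoffel g l c m x.
  by rewrite mxE; apply: eq_bigr => m _; rewrite !chrE.
apply: (etrans _ (esym (E _ _ _ _))); congr (_ - _ + _); [exact: P|exact: P|].
apply: (etrans _ (esym (congr2 (fun p q => p - q) (Q j i) (Q i j)))).
by rewrite -sumrB.
Qed.

(** In the orthonormal pair [sigma], [nu] the curvature operator is [kap] times a quarter turn. The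
    numerator of the Gauss curvature is therefore [kap] times the determinant of the coordinate
    fields in that pair, up to sign. *)
Lemma gauss_curvature_kappa x : gauss_curvature g x = 0 <-> kap x = 0.
Proof.
have d0 : \det (g x) != 0 by have := is_metric_unit gm x; rewrite unitmxE unitfE.
pose a := bilin (g x) 'e_1 (sigma x); pose b := bilin (g x) 'e_1 (nu x).
pose c := bilin (g x) 'e_0 (sigma x); pose d := bilin (g x) 'e_0 (nu x).
have E0 : 'e_0 = c *: sigma x + d *: nu x := orthonormal_expand 'e_0 (ss x) (nn x) (sn x) (ns x).
have E1 : 'e_1 = a *: sigma x + b *: nu x := orthonormal_expand 'e_1 (ss x) (nn x) (sn x) (ns x).
have K : bilin (g x) (riemann g 0 1 1 x) 'e_0 = kap x * (a * d - b * c).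
  rewrite riemann_curv {1}E1 mulmxDl -!scalemxAl (sigma_curv chrs sk nk ek sc nc) nu_curv.
  rewrite bilinDl !bilinZl (bilin_sym (nu x) _ (is_metric_sym gm x)) (bilin_sym (sigma x) _ (is_metric_sym gm x)).
  by rewrite -/c -/d -/kap; ring.
have D0 : a * d - b * c != 0.
  apply/eqP => D0.
  (* Cramer's rule: this combination eliminates [sigma], the next one [nu], and each leaves a
     multiple of the determinant. If it vanished, ['e_1] would be zero. *)
  have F0 : c *: 'e_1 - a *: 'e_0 = 0 :> 'rV[R]_2.
    rewrite E0 E1; generalize (sigma x) (nu x) => u v; apply/rowP => k; rewrite !mxE.
    transitivity (- (a * d - b * c) * v 0 k); last by rewrite D0 oppr0 mul0r.
    ring.
  have F1 : d *: 'e_1 - b *: 'e_0 = 0 :> 'rV[R]_2.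
    rewrite E0 E1; generalize (sigma x) (nu x) => u v; apply/rowP => k; rewrite !mxE.
    transitivity ((a * d - b * c) * u 0 k); last by rewrite D0 mul0r.
    ring.
  have /rowP /(_ 0) := F0; have /rowP /(_ 0) := F1; rewrite !mxE /= => b0 a0.
  have {}a0 : a = 0 by move: a0; rewrite mulr0 mulr1 sub0r => /eqP; rewrite oppr_eq0 => /eqP.
  have {}b0 : b = 0 by move: b0; rewrite mulr0 mulr1 sub0r => /eqP; rewrite oppr_eq0 => /eqP.
  have /rowP /(_ 1) := E1; rewrite a0 b0 !scale0r addr0 !mxE /= => /eqP.
  by rewrite oner_eq0.
rewrite /gauss_curvature -[inner _ _ _ _]/(bilin (g x) (riemann g 0 1 1 x) 'e_0) K.
split=> [/eqP|->]; last by rewrite !mul0r.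
by rewrite mulf_eq0 invr_eq0 (negbTE d0) orbF mulf_eq0 (negbTE D0) orbF => /eqP.
Qed.

Lemma harmonic_map_sigma : harmonic_map g G sigma <-> forall x, gauss_curvature g x = 0.
Proof.
rewrite harmonic_map_kappa_eta; split=> [H x|H x i].
  by apply/gauss_curvature_kappa; exact: kappa_eta0.
by have /gauss_curvature_kappa -> := H x; rewrite mul0r.
Qed.

End Harmonicity.

(** * The weight on the vertical spaces *)

Section Weight.
Context {R : realType}.

(** Negative powers of 1 + t are closed under differentiation up to constants, so one lemma provides
    both derivatives required by [C2_halfline]. *)
Definition inv_pow (m : nat) (t : R) : R := ((1 + t) ^+ m)^-1.

Lemma is_derive_inv_pow m (t : R) : 0 <= t ->
  is_derive t 1 (inv_pow m.+1) (- m.+1%:R * inv_pow m.+2 t).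
Proof.
move=> t0; have n0 : 1 + t != 0 by rewrite gt_eqF // ltr_pwDl.
have D1 : is_derive t 1 (fun s : R => 1 + s) 1.
  by rewrite -[X in is_derive _ _ _ X]add0r; apply: is_deriveD.
have D2 : is_derive t 1 (fun s : R => (1 + s) ^+ m.+1) (m.+1%:R * (1 + t) ^+ m).
  by have := is_deriveX m.+1 D1; rewrite exprfctE [_ *: 1]mulr1.
have D3 := @is_deriveV_real R (fun s => (1 + s) ^+ m.+1) t _ (expf_neq0 m.+1 n0) D2.
move: D3; congr is_derive.
have p0 : (1 + t) ^+ m != 0 by rewrite expf_neq0.
rewrite /inv_pow !exprS; move: p0 n0.
by generalize ((1 + t) ^+ m) (1 + t) => p q p0 q0; field; rewrite p0.
Qed.

Lemma inv_pow_gt0 m (t : R) : 0 <= t -> 0 < inv_pow m t.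
Proof. by move=> t0; rewrite invr_gt0 exprn_gt0 // ltr_pwDl. Qed.

(** The one-sided limit is taken along a finer filter than the two-sided one. *)
Lemma halfline_deriv_is_derive (f f' : R -> R) :
  (forall t : R, 0 <= t -> is_derive t 1 f (f' t)) -> halfline_deriv f f'.
Proof.
move=> fd t t0; have [df vf] := fd t t0.
have C : h^-1 *: ((f \o shift t) (h *: 1) - f t) @[h --> 0^'] --> f' t.
  by rewrite -vf; exact: df.
have E : (fun h : R => h^-1 *: ((f \o shift t) (h *: 1) - f t)) =
    (fun h => h^-1 * (f (t + h) - f t)).
  by apply/funext => h /=; rewrite [h *: 1]mulr1 (addrC h t).
rewrite E in C; apply: cvg_trans C; apply: cvg_app; exact: cvg_within.
Qed.

Lemma is_derive_inv_powZ (c : R) m (t : R) : 0 <= t ->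
  is_derive t 1 (fun s => c * inv_pow m.+1 s) (c * (- m.+1%:R * inv_pow m.+2 t)).
Proof. by move=> t0; apply: is_deriveZ; exact: is_derive_inv_pow. Qed.

Lemma inv_pow_C2 : C2_halfline (inv_pow 2).
Proof.
exists (fun t => - 2%:R * inv_pow 3 t), (fun t => - 2%:R * - 3%:R * inv_pow 4 t); split.
- by apply: halfline_deriv_is_derive => t t0; exact: is_derive_inv_pow.
- by apply: halfline_deriv_is_derive => t t0; rewrite -mulrA; exact: is_derive_inv_powZ.
- apply: continuous_in_subspaceT => t; rewrite inE /= => t0.
  have D : is_derive t 1 (fun s => - 2%:R * - 3%:R * inv_pow 4 s) _ := is_derive_inv_powZ (- 2%:R * - 3%:R) 3 t0.
  by apply: differentiable_continuous; apply/derivable1_diffP; case: D.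
Qed.

Lemma cst_C2 (c : R) : C2_halfline (fun _ => c).
Proof.
have D (d : R) : halfline_deriv (fun=> d) (fun=> 0).
  by apply: halfline_deriv_is_derive => t _; exact: is_derive_cst.
exists (fun=> 0), (fun=> 0); split => //.
by apply: continuous_subspaceT => t; exact: cst_continuous.
Qed.

Lemma inv_pow_Ck n k (f : 'rV[R]_n -> R) :
  (forall y, 0 <= f y) -> Ck k f -> Ck k (fun y => inv_pow 2 (f y)).
Proof.
move=> f0 fk; apply: CkV => [y|]; first by rewrite gt_eqF // exprn_gt0 // ltr_pwDl.
have fk1 : Ck k (fun y => 1 + f y) by apply: CkD => //; exact: Ck_cst.
by have := CkM fk1 fk1; congr Ck; apply/funext => y; rewrite expr2.
Qed.

End Weight.

Theorem theorem5p1 (R : realType) (g : 'rV[R]_2 -> 'M[R]_2) (hg : T2_metric g) :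
  exists (sigma : 'rV[R]_2 -> 'rV[R]_2) (A B C : R -> R)
         (G : 'rV[R]_(2 + 2) -> 'M[R]_(2 + 2)),
    [/\ unit_vector_field g sigma,
        kaluza_klein g A B C G,
        forall t, 0 <= t -> A t = 1,
        harmonic_section g G sigma
      & harmonic_map g G sigma <-> forall x, gauss_curvature g x = 0].
Proof.
have [gp gsm gm] := hg.
have gs k : mxCk k g by move=> i j; exact: gsm.
have [theta [tp tk tdiv]] := coclosed_rotation gp gm gs.
have f1k k := frame1_Ck gm gs k; have f2k k := frame2_Ck gm gs k.
have f11 := frame11 gm; have f12 := frame12 g; have f21 := frame21 gm; have f22 := frame22 gm.
pose sigma := rotated1 (frame1 g) (frame2 g) theta.
pose nu := rotated2 (frame1 g) (frame2 g) theta.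
pose eta := rotated_form g (frame1 g) (frame2 g) theta.
have sk k : mxCk k sigma := rotated1_Ck f1k f2k tk k.
have nk k : mxCk k nu := rotated2_Ck f1k f2k tk k.
have ek k i : Ck k (eta i) := rotated_form_Ck gm gs f1k f2k tk k i.
have ss x : bilin (g x) (sigma x) (sigma x) = 1 := rotated11 f11 f22 f12 f21 theta x.
have nn x : bilin (g x) (nu x) (nu x) = 1 := rotated22 f11 f22 f12 f21 theta x.
have sn x : bilin (g x) (sigma x) (nu x) = 0 := rotated12 f11 f22 f12 f21 theta x.
have sc i x : mxpd sigma i x + sigma x *m chr g i x = eta i x *: nu x :=
  cov_rotated1 gm gs f1k f2k f11 f22 f12 f21 tk i x.
have nc i x : mxpd nu i x + nu x *m chr g i x = - eta i x *: sigma x :=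
  cov_rotated2 gm gs f1k f2k f11 f22 f12 f21 tk i x.
have Bpos (t : R) : 0 <= t -> 0 < inv_pow 2 t := @inv_pow_gt0 R 2 t.
have Bder (t : R) : 0 <= t -> is_derive t 1 (inv_pow 2) (- 2%:R * inv_pow 3 t) := @is_derive_inv_pow R 1 t.
have B1 : inv_pow 2 1 + - 2%:R * inv_pow 3 1 = 0 :> R.
  by rewrite /inv_pow; field.
exists sigma, (fun=> 1), (inv_pow 2), (fun=> 0), (kk_metric g (inv_pow 2)); split => //.
- split; last exact: ss.
  split=> [i x|i k]; last exact: sk.
  by rewrite /sigma /rotated1 tp frame1_periodic // frame2_periodic.
- split=> //.
  + by split; [exact: cst_C2|exact: inv_pow_C2|exact: cst_C2].
  + split; [exact: kk_metric_periodic| |exact: kk_is_metric].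
    by apply: kk_Ck => //; [exact: chr_Ck|exact: inv_pow_Ck].
  + move=> x e X Y u r.
    have KB v w : inner (kk_metric g (inv_pow 2)) u v w = _ := kk_bilin g (inv_pow 2) u v w.
    (* A horizontal lift has zero vertical part, after which the three identities are read off from
       [kk_bilin]. *)
    have h Z : - christoffel_form g x Z e + e *m cmx g x Z = 0.
      by rewrite christoffel_form_cmx addNr.
    rewrite !KB /u /hlift /vlift !row_mxKl !row_mxKr !h !cmx0 !mulmx0 !addr0 !bilin0l !bilin0r.
    by split; rewrite !(mulr0, mul0r, addr0, add0r, mul1r).
- have H := harmonic_section_sigma gm Bpos gs (@inv_pow_Ck R) Bder B1 sk nk ek ss nn sc nc tdiv.
  exact: H.
- have H := harmonic_map_sigma gm Bpos gs (@inv_pow_Ck R) Bder B1 sk nk ek ss nn sn sc nc tdiv.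
  exact: H.
Qed.
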